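(* Let $S_g$ be the fundamental group of the closed orientable hyperbolic surface of genus $g\geq 2$. Then for any finite collection of non-identity elements $\gamma_1,\ldots,\gamma_m\in S_g$ there is an action of $S_g$ on some locally finite tree which is minimal, faithful and such that each of $\gamma_1,\ldots,\gamma_m$ acts loxodromically.
   Context: All trees are simplicial trees, regarded as metric spaces with each edge of length 1; a group acts on a tree by simplicial automorphisms, possibly inverting edges. A tree is locally finite if every vertex has finite valence. An element acts elliptically on a tree if it fixes a point (a vertex or a midpoint of an edge), and otherwise it acts loxodromically (it has an invariant axis on which it acts as a non-trivial translation). An action on a tree is minimal if there is no proper invariant subtree. *)

(* Defs.v *)
From mathcomp Require Import all_boot all_order all_algebra all_fingroup.
From mathcomp Require Import all_classical all_reals all_analysis.
From Stdlib Require Import Relation_Operators.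
Import Order.TTheory GRing.Theory Num.Theory numFieldNormedType.Exports.

Set Implicit Arguments.
Unset Strict Implicit.
Unset Printing Implicit Defensive.

Local Open Scope classical_set_scope.
Local Open Scope ring_scope.

(* Fundamental groups.  Loops are maps R -> X of which only the restriction to
   [0, 1] matters. *)

Definition is_loop (R : realType) (X : topologicalType) (x0 : X) (f : R -> X)
    : Prop :=
  [/\ {within `[0, 1], continuous f}, f 0 = x0 & f 1 = x0].

Definition loop_homotopic (R : realType) (X : topologicalType) (x0 : X)
    (f h : R -> X) : Prop :=
  exists H : R * R -> X,
    [/\ {within `[0, 1] `*` `[0, 1], continuous H},
        forall s, s \in `[0, 1] -> H (s, 0) = f s /\ H (s, 1) = h s
      & forall t, t \in `[0, 1] -> H (0, t) = x0 /\ H (1, t) = x0].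

Definition loop_concat (R : realType) (X : Type) (f h : R -> X) : R -> X :=
  fun s => if s <= 2^-1 then f (2 * s) else h (2 * s - 1).

(* [S] is (a copy of) the group of homotopy classes of loops at [x0] : [cls]
   maps each loop to its class, and its values at functions that are not loops
   are irrelevant. *)
Definition is_fundamental_group (R : realType) (X : topologicalType) (x0 : X)
    (S : groupType) : Prop :=
  exists cls : (R -> X) -> S,
    [/\ forall a : S, exists2 f, is_loop x0 f & cls f = a,
        forall f h, is_loop x0 f -> is_loop x0 h ->
          (cls f = cls h <-> loop_homotopic x0 f h)
      & forall f h, is_loop x0 f -> is_loop x0 h ->
          cls (loop_concat f h) = (cls f * cls h)%g].

(* The closed orientable surface of genus g >= 1 is the quotient of a 4g-gon by
   the identification of its sides along the boundary word
   a_0 b_0 a_0^-1 b_0^-1 ... a_(g-1) b_(g-1) a_(g-1)^-1 b_(g-1)^-1.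
   The 4g-gon is the closed unit disc, with boundary divided into 4g equal
   arcs: the k-th side is [boundary_point g] on [k, k + 1]. *)

Definition closed_disc (R : realType) : set (R * R) :=
  [set p | p.1 ^+ 2 + p.2 ^+ 2 <= 1].

Definition boundary_point (R : realType) (g : nat) (s : R) : R * R :=
  (cos (2 * pi * s / (4 * g)%:R), sin (2 * pi * s / (4 * g)%:R)).

(* The sides 4i and 4i+2 (both labelled a_i), and the sides 4i+1 and 4i+3 (both
   labelled b_i), are identified with opposite orientations. *)
Inductive side_pairing (R : realType) (g : nat) : R * R -> R * R -> Prop :=
| pair_a (i : nat) (t : R) : (i < g)%N -> t \in `[0, 1] ->
    side_pairing g (boundary_point g ((4 * i)%:R + t))
                   (boundary_point g ((4 * i + 3)%:R - t))
| pair_b (i : nat) (t : R) : (i < g)%N -> t \in `[0, 1] ->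
    side_pairing g (boundary_point g ((4 * i + 1)%:R + t))
                   (boundary_point g ((4 * i + 4)%:R - t)).

Definition glued (R : realType) (g : nat) : R * R -> R * R -> Prop :=
  clos_refl_sym_trans (R * R) (@side_pairing R g).

(* As the disc is compact and X is Hausdorff, [q] is a quotient map: X is
   homeomorphic to the quotient of the disc by [glued g]. *)
Definition closed_orientable_surface (R : realType) (g : nat)
    (X : topologicalType) : Prop :=
  hausdorff_space X /\
  exists q : R * R -> X,
    [/\ {within @closed_disc R, continuous q},
        q @` @closed_disc R = [set: X]
      & forall u v, closed_disc u -> closed_disc v ->
          (q u = q v <-> glued g u v)].

(* Simplicial trees, given by their vertices and adjacency relation. *)

Record simplicial_tree := SimplicialTree {
  vertex :> eqType;
  adj : rel vertex;
  adj_sym : symmetric adj;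
  adj_irr : irreflexive adj;
  tree_nonempty : inhabited vertex;
  tree_connected : forall u v : vertex,
    exists2 p : seq vertex, path adj u p & last u p = v;
  tree_acyclic : forall c : seq vertex, (2 < size c)%N -> ~ ucycle adj c
}.

Definition locally_finite (T : simplicial_tree) : Prop :=
  forall v : T, finite_set [set w | adj v w].

(* A subtree is determined by its set of vertices. *)
Definition is_subtree (T : simplicial_tree) (W : set T) : Prop :=
  W !=set0 /\
  forall u v, W u -> W v ->
    exists p : seq T, [/\ path (@adj T) u p, last u p = v
                        & forall w, w \in p -> W w].

Record tree_action (S : groupType) (T : simplicial_tree) := TreeAction {
  act :> S -> T -> T;
  act1 : forall v, act 1%g v = v;
  actM : forall a b v, act (a * b)%g v = act a (act b v);
  act_adj : forall a u v, adj (act a u) (act a v) = adj u v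
}.

Definition faithful_action (S : groupType) (T : simplicial_tree)
    (rho : tree_action S T) : Prop :=
  forall a : S, (forall v, rho a v = v) -> a = 1%g.

Definition minimal_action (S : groupType) (T : simplicial_tree)
    (rho : tree_action S T) : Prop :=
  forall W : set T, is_subtree W ->
    (forall (a : S) v, W v -> W (rho a v)) -> W = [set: T].

(* An element fixes the midpoint of an edge, without fixing any vertex, exactly
   when it exchanges the endpoints of that edge. *)
Definition elliptic (S : groupType) (T : simplicial_tree)
    (rho : tree_action S T) (a : S) : Prop :=
  (exists v, rho a v = v) \/
  (exists u v, [/\ adj u v, rho a u = v & rho a v = u]).

Definition loxodromic (S : groupType) (T : simplicial_tree)
    (rho : tree_action S T) (a : S) : Prop := ~ elliptic rho a.

(* Main.v *)
(* The hyperelliptic involution embeds S_g with index two in the amalgam of two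
   copies of W, the free product of K = g + 1 groups of order two, along the
   product u of the generators.  The first copy acts on the Cayley tree T of W by
   left multiplication, the second one by the conjugate of this action by a tree
   automorphism c = u^N c_theta which commutes with u.  Here c_theta prolongs words
   so that the successive differences of letters (seen mod K) are preserved, except
   that the differences 1 and 2 are exchanged at the vertices of a u-invariant set
   theta disjoint from the axis of u.  Even words in W already act transitively on
   the vertices of each parity, whence minimality.  Every element outside the two
   factors is conjugate to an alternating product of syllables outside <u>; as N
   grows, such a product moves every vertex far along u-axes, so that finitely many
   given elements become loxodromic.  Enumerating all words and adding to theta,
   one word at a time, marks far away from the previous ones makes every word move
   a vertex, whence faithfulness.

   On the topological side, every point of the surface has a chart made of the
   points of the disc close to one of its lifts.  The deformation of such a chart
   to its centre shows that loops are products of loops crossing the boundary of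
   the disc, and the holonomy of cocycles given by potentials on the disc gives
   the universal property of the standard presentation. *)

Require Import Defs.
From HB Require Import structures.
From mathcomp Require Import all_boot all_order all_algebra all_fingroup.
From mathcomp Require Import all_classical all_reals all_analysis.
From mathcomp Require Import zify ring lra.
From Stdlib Require Import Relation_Operators.
Import Order.TTheory GRing.Theory Num.Theory numFieldNormedType.Exports.

Set Implicit Arguments.
Unset Strict Implicit.
Unset Printing Implicit Defensive.

(** * Reduced words in involutions *)

(** The quotient by the hyperelliptic involution is a sphere with 2g + 2 cone points of order two; a
    curve with half of them on each side splits its group as the amalgam. Conjugating the action of
    the second copy of W by a power of u alone cannot suffice: the action would factor through the
    virtually free group W, hence have a kernel. This is why the centralizer of u in the whole
    automorphism group of the tree is used; u^N takes care of the given elements and theta of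
    faithfulness. Indexing the letters by residues mod K turns the axis of u into an arithmetic
    progression, and c_theta commutes with u because u preserves the differences of letters away
    from its axis. Exchanging 1 and 2 requires 0, 1 and 2 to be distinct mod K, which holds since K
    = g + 1 >= 3. The amalgam is never constructed as a group: identities between words are
    quantified over all its actions ([model]), and an action on the set S itself detects the
    elements of S. *)

Section ReducedWords.
Variable I : eqType.
Implicit Types (a b : I) (x y w g : seq I).

Definition reduced x := sorted [rel a b | a != b] x.

(** Left multiplication by a generator, on the normal forms of a free product of groups of order
    two; [act] and [rmul] are multiplication by a word on the left and by a letter on the right. *)
Definition lact a x := if x is b :: x' then if a == b then x' else a :: x else [:: a].
Definition act g x := foldr lact x g.
Definition rmul x a := rev (lact a (rev x)).

Lemma reduced_rev x : reduced (rev x) = reduced x.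
Proof.
rewrite /reduced rev_sorted; apply: eq_sorted => a b /=.
by rewrite eq_sym.
Qed.

Lemma reduced_cons a x : reduced (a :: x) = (ohead x != Some a) && reduced x.
Proof. by case: x => //= b x; rewrite (inj_eq (@Some_inj _)) eq_sym. Qed.

Lemma reduced_catl x y : reduced (x ++ y) -> reduced x.
Proof. by rewrite /reduced => /cat_sorted2 []. Qed.

Lemma reduced_catr x y : reduced (x ++ y) -> reduced y.
Proof. by rewrite /reduced => /cat_sorted2 []. Qed.

Lemma lact_reduced a x : reduced x -> reduced (lact a x).
Proof.
case: x => //= b x h; case: eqVneq => [_|ab]; last by rewrite /= ab.
by move: h; case: x => //= c x /andP[].
Qed.

Lemma lactK a x : reduced x -> lact a (lact a x) = x.
Proof.
case: x => [|b x] //=; rewrite ?eqxx //; case: eqVneq => [->|ab] /=; last by rewrite eqxx.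
by case: x => //= c x /andP[/negPf-> _].
Qed.

Lemma act_reduced g x : reduced x -> reduced (act g x).
Proof. by move=> rx; elim: g => //= a g /(lact_reduced a). Qed.

Lemma act_cat g h x : act (g ++ h) x = act g (act h x).
Proof. by rewrite /act foldr_cat. Qed.

Lemma actKV g x : reduced x -> act (rev g) (act g x) = x.
Proof.
elim: g x => //= a g IH x rx; rewrite rev_cons -cats1 act_cat /=.
by rewrite lactK ?act_reduced // IH.
Qed.

Lemma actVK g x : reduced x -> act g (act (rev g) x) = x.
Proof. by move=> rx; rewrite -{1}[g]revK actKV. Qed.

Lemma lact_cons a x : reduced (a :: x) -> lact a x = a :: x.
Proof. by case: x => //= b x /andP[/negPf->]. Qed.

Lemma act_catE w x : reduced (w ++ x) -> act w x = w ++ x.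
Proof.
elim: w => // a w IH; rewrite cat_cons => h; rewrite /= IH ?lact_cons //.
by move: h; rewrite reduced_cons => /andP[].
Qed.

Lemma act_nil w : reduced w -> act w [::] = w.
Proof. by move=> rw; rewrite act_catE cats0. Qed.

Lemma act_lact a w x : reduced w -> reduced x -> act (lact a w) x = lact a (act w x).
Proof.
case: w => [|b w] //= rw rx; case: eqVneq => [->|//].
by rewrite lactK // act_reduced.
Qed.

Lemma act_norm g x : reduced x -> act (act g [::]) x = act g x.
Proof. by move=> rx; elim: g => //= a g IH; rewrite act_lact ?act_reduced // IH. Qed.

Lemma act_eq g h : act g [::] = act h [::] -> forall x, reduced x -> act g x = act h x.
Proof. by move=> e x rx; rewrite -act_norm // e act_norm. Qed.

(** Makes the number [j] of cancelled letters explicit, for the comparison of the axis with its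
    translates in [lcp_act]. *)
Lemma act_cancel w x : reduced w -> reduced x ->
  exists w1 j, [/\ (j <= size x), w = w1 ++ rev (take j x) & act w x = w1 ++ drop j x].
Proof.
elim: w => [|a w IH] rw rx; first by exists [::], 0; rewrite take0 drop0.
have [|w1 [j [jx ew e]]] := IH _ rx; first by move: rw; rewrite reduced_cons => /andP[].
rewrite /= e; case: w1 ew e => [|b w1] ew e /=; last first.
  exists (a :: b :: w1), j; split=> //; first by rewrite ew.
  by move: rw; rewrite ew /= => /andP[/negPf->].
case E: (drop j x) => [|b y] /=; first by exists [:: a], j; rewrite E ew.
case: eqVneq => [->|_]; last by exists [:: a], j; rewrite E ew.
have jx' : (j < size x) by rewrite ltnNge -subn_eq0 -size_drop E.
exists [::], j.+1; split=> //=; last by rewrite -add1n -drop_drop E /= drop0.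
rewrite (take_nth b) // rev_rcons {1}ew cat0s; congr (_ :: _).
by rewrite -[j]addn0 -nth_drop E.
Qed.

(** Vertices are group elements: multiplying g x = x on the right by the inverse [rev x] leaves g =
    1. *)
Lemma act_free g x : reduced x -> act g x = x -> act g [::] = [::].
Proof.
move=> rx e; have e' : act (g ++ x) [::] = act x [::] by rewrite act_cat act_nil.
have := act_eq e' (x := rev x); rewrite reduced_rev => /(_ rx).
by rewrite act_cat -[rev x]act_nil ?reduced_rev // actVK.
Qed.

Lemma lact_cat a x y : x != [::] -> lact a (x ++ y) = lact a x ++ y.
Proof. by case: x => //= b x _; case: ifP. Qed.

Lemma size_lact_ge a x : (size x).-1 <= size (lact a x).
Proof. by case: x => //= b x; case: ifP => //= _; rewrite leqW. Qed.

Lemma size_lact_le a x : size (lact a x) <= (size x).+1.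
Proof. by case: x => //= b x; case: ifP => //= _; rewrite leqW. Qed.

Lemma size_act_le g x : size (act g x) <= size g + size x.
Proof. elim: g => //= a g IH; apply: leq_trans (size_lact_le _ _) _; by rewrite addSn ltnS. Qed.

Lemma size_act_ge g x : size x - size g <= size (act g x).
Proof.
elim: g => [|a g IH] /=; first by rewrite subn0.
by apply: leq_trans (size_lact_ge _ _); rewrite subnS; lia.
Qed.

(** Each letter of [g] cancels at most one letter, so the cancellation never reaches [y]. *)
Lemma act_prefix g x y : size g < size x -> act g (x ++ y) = act g x ++ y.
Proof.
elim: g => //= a g IH h; rewrite IH 1?ltnW // lact_cat //.
by rewrite -size_eq0; have := size_act_ge g x; lia.
Qed.

Lemma last_act c g x : size g < size x -> last c (act g x) = last c x.
Proof.
elim: g => //= a g IH h; rewrite -IH 1?ltnW //.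
have : 1 < size (act g x) by have := size_act_ge g x; lia.
by case: (act g x) => [|b [|b' y]] //= _; case: ifP.
Qed.

Lemma rmulK x a : reduced x -> rmul (rmul x a) a = x.
Proof. by move=> rx; rewrite /rmul revK lactK ?reduced_rev // revK. Qed.

Lemma rmul_rcons x a : reduced (rcons x a) -> rmul x a = rcons x a.
Proof.
by rewrite -reduced_rev rev_rcons /rmul => h; rewrite lact_cons // rev_cons revK.
Qed.

Lemma rmul_rconsK x a : rmul (rcons x a) a = x.
Proof. by rewrite /rmul rev_rcons /= eqxx revK. Qed.

(** Right multiplication by a letter follows the edge with this label; commuting with it, the left
    action preserves the labels of edges. *)
Lemma lact_rmul b x a : reduced x -> lact b (rmul x a) = rmul (lact b x) a.
Proof.
case/lastP: x => [|x c]; first by rewrite /rmul /= [a == b]eq_sym; case: ifP.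
case: (eqVneq c a) => [-> r|ca].
  rewrite rmul_rconsK; case: x r => [|e x] r /=.
    by rewrite /rmul /=; case: (eqVneq b a) => [->|ba] //=; rewrite eqxx.
  by case: eqVneq => [_|be]; rewrite ?rmul_rconsK // -!rcons_cons rmul_rconsK.
move=> r; have E y : rmul (rcons y c) a = rcons (rcons y c) a.
  by rewrite /rmul rev_rcons /= eq_sym (negPf ca) !rev_cons revK.
rewrite E; case: x r => [|e x] r /=.
  by case: ifP => //= _; rewrite ?[rmul _ _](E [:: b]).
by case: ifP => //= _; rewrite ?E // -!rcons_cons E.
Qed.

Lemma act_rmul g x a : reduced x -> act g (rmul x a) = rmul (act g x) a.
Proof. by move=> rx; elim: g => //= b g ->; rewrite lact_rmul ?act_reduced. Qed.

Lemma reduced_rcons x a : reduced (rcons x a) = (ohead (rev x) != Some a) && reduced x.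
Proof. by rewrite -reduced_rev rev_rcons reduced_cons reduced_rev. Qed.

(** The Gromov product based at the root; [dist] is then the distance in the Cayley tree and
    [lcp_ultra] its 0-hyperbolicity. *)
Fixpoint lcp x y :=
  match x, y with a :: x', b :: y' => if a == b then (lcp x' y').+1 else 0 | _, _ => 0 end.

Definition dist x y := size x + size y - (lcp x y).*2.

Lemma lcpC x y : lcp x y = lcp y x.
Proof. by elim: x y => [|a x IH] [|b y] //=; rewrite IH eq_sym. Qed.

Lemma lcp_lel x y : lcp x y <= size x.
Proof. by elim: x y => [|a x IH] [|b y] //=; case: ifP => //= _; rewrite ltnS. Qed.

Lemma lcp_ler x y : lcp x y <= size y.
Proof. by rewrite lcpC lcp_lel. Qed.

Lemma lcp_geP n x y : (n <= lcp x y) = [&& n <= size x, n <= size y & take n x == take n y].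
Proof.
elim: x y n => [|a x IH] [|b y] [|n] //=; rewrite ?andbF // eqseq_cons.
by case: eqVneq => [_|_] /=; rewrite ?andbF // !ltnS IH.
Qed.

Lemma lcp_ultra x y z : minn (lcp x y) (lcp y z) <= lcp x z.
Proof.
elim: x y z => [|a x IH] [|b y] [|c z] //=; rewrite ?min0n ?minn0 //.
case: (eqVneq a b) => [->|]; rewrite ?min0n //; case: (eqVneq b c) => [_|]; rewrite ?minn0 //.
by rewrite minnSS ltnS.
Qed.

Lemma lcpxx x : lcp x x = size x.
Proof. by elim: x => //= a x ->; rewrite eqxx. Qed.

Lemma dist_sym x y : dist x y = dist y x.
Proof. by rewrite /dist addnC lcpC. Qed.

Lemma dist0l x : dist [::] x = size x.
Proof. by rewrite /dist /= subn0. Qed.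

Lemma distE x y : dist x y + (lcp x y).*2 = size x + size y.
Proof. by rewrite /dist; have := lcp_lel x y; have := lcp_ler x y; lia. Qed.

Lemma dist_eq0 x y : (dist x y == 0) = (x == y).
Proof.
apply/eqP/eqP=> [h|->]; last by have := distE y y; rewrite lcpxx; lia.
have hl := lcp_lel x y; have hr := lcp_ler x y; have e := distE x y.
have : size x <= lcp x y by lia.
rewrite lcp_geP => /and3P[_ hxy /eqP]; rewrite take_size take_oversize //; lia.
Qed.

Lemma dist_lact a x y : reduced x -> reduced y -> dist (lact a x) (lact a y) = dist x y.
Proof.
have lcp0 b z : reduced (b :: z) -> forall x', lcp (b :: x') z = 0.
  by case: z => //= c z /andP[/negPf-> _].
rewrite /dist; case: x => [|b x]; case: y => [|c y]; rewrite /lact.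
- by rewrite /= eqxx.
- move=> _ ry; case: (eqVneq a c) => [->|ac] /=; last by rewrite eqxx /=; lia.
  by rewrite -/(lcp [:: c] y) lcp0 //=; lia.
- move=> rx _; case: (eqVneq a b) => [->|ac] /=; last by rewrite eqxx /=; lia.
  by rewrite lcpC -/(lcp [:: b] x) lcp0 //=; lia.
move=> rx ry; case: (eqVneq a b) => [->|ab]; case: (eqVneq b c) => [bc|bc].
- by rewrite /= bc eqxx /=; lia.
- by rewrite lcpC lcp0 //= (negPf bc) /=; lia.
- by rewrite -bc (negPf ab) /= !eqxx /=; lia.
case: (eqVneq a c) ry => [<-|ac] ry.
  by rewrite lcp0 //= eq_sym (negPf ab) /=; lia.
by rewrite /= eqxx (negPf bc) /=; lia.
Qed.

Lemma dist_act g x y : reduced x -> reduced y -> dist (act g x) (act g y) = dist x y.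
Proof. by move=> rx ry; elim: g => //= a g IH; rewrite dist_lact ?act_reduced. Qed.

End ReducedWords.

(** * The axis of the product of the generators *)

Section Axis.
Variable d : nat.
Local Notation K := d.+3.
Local Notation L := 'I_d.+3.
Implicit Types (a b : L) (x y p q w g : seq L) (t m : int) (n : nat).
Local Open Scope ring_scope.

Lemma natK_eq0 n : ((n%:R : L) == 0) = (K %| n)%N.
Proof. by rewrite (_ : n%:R = inZp n) ?Zp_nat. Qed.

Lemma L1_neq0 : (1 : L) != 0. Proof. by []. Qed.
Lemma L2_neq0 : (2%:R : L) != 0. Proof. by rewrite natK_eq0 gtnNdvd. Qed.
Lemma L2_neq1 : (2%:R : L) != 1. Proof. by rewrite mulr2n -subr_eq0 addrK. Qed.

(* The vertices of the axis of u = r_0 r_1 ... : letters are residues mod K, and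
   u ^ m translates [av t] to [av (m * K + t)]. *)
Definition av t : seq L :=
  match t with Posz n => mkseq (fun i => i%:R) n
             | Negz n => mkseq (fun i => - i.+1%:R) n.+1 end.

(** The axis passes through the root, so its only vertices of length n are [av n] and [av (- n)]. *)
Definition onA x := (x == av (size x)%:Z) || (x == av (- (size x)%:Z)).

Lemma size_av t : size (av t) = `|t|%N.
Proof. by case: t => n; rewrite size_mkseq. Qed.

Lemma avN n : av (- n%:Z) = mkseq (fun i => - i.+1%:R) n.
Proof. by case: n. Qed.

Lemma onA_av t : onA (av t).
Proof. by rewrite /onA size_av; case: t => n; rewrite ?absz_nat ?NegzE ?eqxx ?abszN ?absz_nat ?eqxx ?orbT. Qed.

Lemma onAP x : reflect (exists t, x = av t) (onA x).
Proof.
apply: (iffP idP) => [/orP[] /eqP ->|[t ->]]; last exact: onA_av.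
  by exists (size x)%:Z.
by exists (- (size x)%:Z).
Qed.

Lemma mkseqS T (f : nat -> T) n : mkseq f n.+1 = rcons (mkseq f n) (f n).
Proof. by rewrite /mkseq -addn1 iotaD map_cat cats1. Qed.

Lemma av_pos n : av n.+1%:Z = rcons (av n%:Z) n%:R.
Proof. exact: mkseqS. Qed.

Lemma av_neg n : av (- n.+1%:Z) = rcons (av (- n%:Z)) (- n.+1%:R).
Proof. by rewrite !avN mkseqS. Qed.

Lemma take_pos n k : (n <= k)%N -> take n (av k%:Z) = av n%:Z.
Proof. by move=> h; rewrite /av /mkseq -map_take take_iota (minn_idPl h). Qed.

Lemma take_neg n k : (n <= k)%N -> take n (av (- k%:Z)) = av (- n%:Z).
Proof. by move=> h; rewrite !avN /mkseq -map_take take_iota (minn_idPl h). Qed.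

Lemma onA_take n x : onA x -> onA (take n x).
Proof.
case: (leqP n (size x)) => [h|h]; last by rewrite take_oversize // ltnW.
by move=> /orP[]/eqP->; rewrite ?take_pos ?take_neg // ?size_av ?abszN ?absz_nat // onA_av.
Qed.

Lemma onA_rcons x a : onA (rcons x a) -> onA x.
Proof. by move/(onA_take (size x)); rewrite -cats1 take_size_cat. Qed.

Lemma av_reduced t : reduced (av t).
Proof.
suff H (f : nat -> L) n : (forall i, f i != f i.+1) -> reduced (mkseq f n).
  have S i : (i.+1%:R : L) != i%:R by rewrite -subr_eq0 mulrSr addrAC subrr add0r.
  by case: t => n; apply: H => i; rewrite ?eqr_opp eq_sym S.
move=> hf; elim: n => // n IH; rewrite mkseqS reduced_rcons IH andbT.
case: n {IH} => // n; rewrite mkseqS rev_rcons /=.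
by rewrite (inj_eq (@Some_inj _)).
Qed.

(** The axis edge from [av t] to [av (t + 1)] is labelled by the residue of [t], uniformly on both
    sides of the root. *)
Lemma av_up t : rmul (av t) t%:~R = av (t + 1).
Proof.
case: t => n.
  rewrite -PoszD addn1 av_pos -pmulrn rmul_rcons // -av_pos; exact: av_reduced.
rewrite NegzE (_ : - _ + 1 = - n%:Z); last by lia.
by rewrite av_neg mulrNz -pmulrn rmul_rconsK.
Qed.

Lemma av_down t : rmul (av t) (t - 1)%:~R = av (t - 1).
Proof. by rewrite -[t in LHS](subrK 1) -av_up addrK rmulK // av_reduced. Qed.

Lemma KzE m t : ((m * K%:Z + t)%:~R : L) = t%:~R.
Proof.
rewrite rmorphD rmorphM /= (_ : K%:Z%:~R = 0) ?mulr0 ?add0r //.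
by apply/eqP; rewrite -pmulrn natK_eq0.
Qed.

(** The labels along the axis have period [K] and the left action preserves labels, so the formula
    spreads from the root one edge at a time, in both directions. *)
Lemma act_av m t : act (av (m * K%:Z)) (av t) = av (m * K%:Z + t).
Proof.
set g := av _.
have up s : act g (av s) = av (m * K%:Z + s) -> act g (av (s + 1)) = av (m * K%:Z + (s + 1)).
  by move=> e; rewrite -av_up act_rmul ?av_reduced // e -(KzE m s) av_up addrA.
have dn s : act g (av s) = av (m * K%:Z + s) -> act g (av (s - 1)) = av (m * K%:Z + (s - 1)).
  by move=> e; rewrite -av_down act_rmul ?av_reduced // e -(KzE m (s - 1)) addrA av_down.
elim: t => [|n IH|n IH]; first by rewrite addr0 act_nil ?av_reduced.
  by rewrite (_ : n.+1%:Z = n%:Z + 1); [exact: up|lia].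
by rewrite (_ : - n.+1%:Z = - n%:Z - 1); [exact: dn|lia].
Qed.

Lemma av_pos_neg n : (av n.+1%:Z == av (- n.+1%:Z)) = false.
Proof.
apply/negP; rewrite avN => /eqP/(congr1 (head 0)) /= /eqP.
by rewrite eq_sym oppr_eq0.
Qed.

Lemma onA_child t a : onA (rcons (av t) a) -> (a == t%:~R) || (a == (t - 1)%:~R).
Proof.
rewrite /onA size_rcons size_av av_pos av_neg !eqseq_rcons.
case: t => n; [case: n => [|n]|]; rewrite ?NegzE ?abszN !absz_nat.
- by rewrite /= => /orP[]/eqP->; rewrite ?eqxx ?orbT.
- case/orP=> /andP[e /eqP->]; first by rewrite -pmulrn eqxx.
  by rewrite av_pos_neg in e.
- case/orP=> /andP[e /eqP->]; last first.
    by rewrite (_ : - n.+1%:Z - 1 = - n.+2%:Z) ?mulrNz -?pmulrn ?eqxx ?orbT //; lia.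
  by rewrite eq_sym av_pos_neg in e.
Qed.

Lemma rmul_neq x a b : b != a -> rmul (rcons x b) a = rcons (rcons x b) a.
Proof. by move=> ba; rewrite /rmul rev_rcons /= eq_sym (negPf ba) !rev_cons revK. Qed.

Lemma last_av t b s : av t = rcons s b -> b = t%:~R \/ b = (t - 1)%:~R.
Proof.
case: t => [[|n]|n]; first by case: s.
  by rewrite av_pos => /rcons_inj [_ <-]; right; rewrite intS addrAC subrr add0r -pmulrn.
by rewrite NegzE av_neg => /rcons_inj [_ <-]; left; rewrite mulrNz -pmulrn.
Qed.

(** An edge leaving the axis at [av t] has a label other than the residues of [t] and [t - 1]. These
    do not change when a multiple of [K] is added, so the image edge leaves the axis as well. *)
Lemma offA_act0 m t a : reduced (rcons (av t) a) -> ~~ onA (rcons (av t) a) ->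
  act (av (m * K%:Z)) (rcons (av t) a) = rcons (av (m * K%:Z + t)) a /\
  ~~ onA (rcons (av (m * K%:Z + t)) a).
Proof.
move=> r na; have e : rcons (av t) a = rmul (av t) a by rewrite rmul_rcons.
have a1 : a != t%:~R by apply: contraNneq na => h; rewrite e h av_up onA_av.
have a2 : a != (t - 1)%:~R by apply: contraNneq na => h; rewrite e h av_down onA_av.
rewrite e act_rmul ?av_reduced // act_av; split; last first.
  by apply/negP => /onA_child; rewrite -addrA !KzE (negPf a1) (negPf a2).
case: (lastP (av (m * K%:Z + t))) (@last_av (m * K%:Z + t)) => // s b /(_ _ _ erefl).
rewrite -addrA !KzE => h; rewrite rmul_neq //.
by case: h => ->; rewrite eq_sym.
Qed.

Lemma offA_act m p a : reduced (rcons p a) -> ~~ onA (rcons p a) ->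
  act (av (m * K%:Z)) (rcons p a) = rcons (act (av (m * K%:Z)) p) a /\
  ~~ onA (act (av (m * K%:Z)) (rcons p a)).
Proof.
set u := av _.
elim/last_ind: p a => [|p b IH] a r na.
  have := offA_act0 m (t := 0) r na.
  by rewrite -act_av => -[-> ?].
case: (boolP (onA (rcons p b))) => [/onAP[t e]|nb].
  move: r na; rewrite e => r na; have [-> h] := offA_act0 m r na.
  by rewrite act_av.
move: (r); rewrite reduced_rcons rev_rcons /= (inj_eq (@Some_inj _)) => /andP[ba rb].
have [e h] := IH b rb nb; rewrite -(rmul_rcons r) act_rmul // e rmul_neq //; split=> //.
by apply: contraNN h => /onA_rcons; rewrite -e.
Qed.

(* The distance from [x] to the axis. *)
Definition hang x := count (fun i => ~~ onA (take i x)) (iota 0 (size x).+1).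

Lemma hang_rcons x a : hang (rcons x a) = (hang x + ~~ onA (rcons x a))%N.
Proof.
rewrite /hang size_rcons -[in LHS](addn1 (size x).+1) iotaD count_cat.
congr (_ + _)%N; last by rewrite /= add0n addn0 take_oversize ?size_rcons.
apply: eq_in_count => i; rewrite mem_iota => /andP[_]; rewrite add0n ltnS => h.
by rewrite -cats1 takel_cat.
Qed.

Lemma hang_onA x : (hang x == 0)%N = onA x.
Proof.
elim/last_ind: x => [|x a IH]; first by [].
rewrite hang_rcons addn_eq0 IH eqb0 negbK; apply: andb_idl; exact: onA_rcons.
Qed.

Lemma hang_le x : (hang x <= size x)%N.
Proof. by elim/last_ind: x => // x a; rewrite hang_rcons size_rcons; case: (onA _) => /=; lia. Qed.

Lemma onA_act m x : reduced x -> onA (act (av (m * K%:Z)) x) = onA x.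
Proof.
move=> rx; apply/idP/idP => [|/onAP[t ->]]; last by rewrite act_av onA_av.
by apply: contraLR; case/lastP: x rx => // p a r na; have [] := offA_act m r na.
Qed.

Lemma hang_act m x : reduced x -> hang (act (av (m * K%:Z)) x) = hang x.
Proof.
elim/last_ind: x => [|x a IH] rx; first by rewrite act_nil ?av_reduced //; apply/eqP; rewrite hang_onA onA_av.
case: (boolP (onA (rcons x a))) => h.
  by apply/eqP; have := h; rewrite -hang_onA => /eqP->; rewrite hang_onA onA_act.
have [e h'] := offA_act m rx h; move: (rx); rewrite reduced_rcons => /andP[_ r].
by rewrite hang_rcons e hang_rcons -e h h' IH.
Qed.

End Axis.

(** * Twisting the tree *)

Section Twist.
Variable d : nat.
Local Notation K := d.+3.
Local Notation L := 'I_d.+3.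
Implicit Types (a b : L) (x y p q w g : seq L) (t m : int) (n : nat).
Local Open Scope ring_scope.

(** Membership in the cyclic group generated by [u], whose elements are the axis vertices at
    positions divisible by [K]. *)
Definition inU g := onA (act g [::]) && (K %| size (act g [::]))%N.

Lemma inUP g : reflect (exists m, act g [::] = av d (m * K%:Z)) (inU g).
Proof.
apply: (iffP andP) => [[/orP[]/eqP e] /dvdnP[k hk]|[m ->]].
- by exists k%:Z; rewrite e hk PoszM.
- by exists (- k%:Z); rewrite e hk PoszM mulNr.
by rewrite onA_av size_av abszM absz_nat dvdn_mull.
Qed.

Lemma nth_av t : exists b s : L, s * s = 1 /\
  forall i, (i < `|t|)%N -> nth 0 (av d t) i = b + s *+ i.
Proof.
case: t => n.
  by exists 0, 1; split=> [|i h]; rewrite ?mulr1 // nth_mkseq // add0r.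
exists (-1), (-1); split=> [|i h]; first by rewrite mulrNN mulr1.
by rewrite nth_mkseq // mulNrn -opprD mulrS.
Qed.

Lemma rev_av m : rev (av d (m * K%:Z)) = av d (- m * K%:Z).
Proof.
set u := av _ _; have ru : reduced u by exact: av_reduced.
rewrite -[LHS](actKV u) ?reduced_rev // -[RHS](actKV u) ?av_reduced //; congr act.
by rewrite -[rev u]act_nil ?reduced_rev // actVK // act_av mulNr subrr.
Qed.

(** Translates of the axis by elements outside the group of [u] follow it only briefly. The first
    letter after the cancellation agrees with the axis, an arithmetic progression of step 1 or -1,
    so [size w1] and [j] are congruent mod [K]. If both are positive, the last letter of [w1] equals
    the first cancelled letter of [w], against reducedness; if one of them is zero, [w] is a power
    of [u]. *)
Lemma lcp_act g t : (size (act g [::]) < lcp (act g (av d t)) (av d t))%N -> inU g.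
Proof.
rewrite -(act_norm g (av_reduced d t)); have := act_reduced g (isT : reduced ([::] : seq L)).
rewrite /inU; move: (act g [::] : seq L) => w rw h.
have rt := av_reduced d t; set x := av d t in h rt *.
have [w1 [j [jx ew e]]] : exists (w1 : seq L) j,
  [/\ (j <= size x)%N, w = w1 ++ rev (take j x) & act w x = w1 ++ drop j x] := act_cancel rw rt.
have sw : size w = (size w1 + j)%N by rewrite ew size_cat size_rev size_take_min (minn_idPl jx).
move: (leqnn (size w).+1) => _; move: h; rewrite lcp_geP => /and3P[h1 h2 /eqP h3].
have {}h1 : (size w < size (act w x : seq L))%N := h1; have {}h2 : (size w < size x)%N := h2.
have n1 : (size w1 < size x)%N by lia.
have n2 : (size w1 < (size w).+1)%N by rewrite sw ltnS leq_addr.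
have n2' := ltnW n2.
have tw1 : w1 = take (size w1) x.
  move/(congr1 (take (size w1))): h3; rewrite e !take_takel //.
  by rewrite take_size_cat.
have nn : nth 0 x j = nth 0 x (size w1).
  move/(congr1 (nth 0 ^~ (size w1))): h3; rewrite !nth_take //.
  by rewrite e nth_cat ltnn subnn nth_drop addn0.
have jx' : (j < size x)%N.
  by move: h1; rewrite e size_cat size_drop sw; lia.
have [b [s [ss hs]]] := nth_av t; rewrite size_av in n1 jx'.
move: nn; rewrite (hs _ n1) (hs _ jx') => /addrI nn.
have nj : (j%:R : L) = (size w1)%:R.
  move/(congr1 ( *%R s)): nn.
  by rewrite !mulrnAr ss.
case: (posnP j) => [j0|jp].
  move: nj; rewrite j0 => /esym/eqP; rewrite natK_eq0 => kn.
  by rewrite ew j0 take0 cats0 {1}tw1 onA_take ?onA_av.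
case: (posnP (size w1)) => [n0|np].
  move: nj; rewrite n0 => /eqP; rewrite natK_eq0 => kn.
  have /onAP[t' et] : onA (take j x) by rewrite onA_take // onA_av.
  have sj : `|t'|%N = j by rewrite -(size_av d) -et size_take_min size_av (minn_idPl (ltnW jx')).
  have [m em] : exists m, t' = m * K%:Z.
    case/dvdnP: kn => k hk; case: t' et sj => n _; rewrite ?absz_nat ?NegzE ?abszN ?absz_nat => ->.
      by exists k%:Z; rewrite hk.
    by exists (- k%:Z); rewrite mulNr hk.
  rewrite ew (size0nil n0) cat0s et em rev_av size_av onA_av abszM absz_nat dvdn_mull //.
have sx : size x = `|t|%N by exact: size_av.
have a1 : ((size w1).-1 < `|t|)%N := leq_ltn_trans (leq_pred _) n1.
have a2 : (j.-1 < `|t|)%N := leq_ltn_trans (leq_pred _) jx'.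
have e1 : w1 = rcons (take (size w1).-1 x) (nth 0 x (size w1).-1).
  by rewrite -take_nth ?sx // prednK.
have e2 : take j x = rcons (take j.-1 x) (nth 0 x j.-1) by rewrite -take_nth ?sx // prednK.
have := rw; rewrite ew e2 e1 rev_rcons cat_rcons => /reduced_catr /=; case/andP.
rewrite !hs //; case/negP; apply/eqP; congr (_ + _); apply: (addIr s).
by rewrite -!mulrSr !prednK // nn.
Qed.

Definition flip (b : bool) (e : L) : L := if b then (if e == 1 then 2%:R else if e == 2%:R then 1 else e) else e.

Lemma flipK (b : bool) : involutive (flip b).
Proof.
have n12 := L2_neq1 d.
move=> e; rewrite /flip; case: b => //; case: (eqVneq e 1) => [->|e1].
  by rewrite (negPf n12) eqxx.
by case: (eqVneq e 2%:R) => [->|e2]; rewrite ?eqxx // (negPf e1) (negPf e2).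
Qed.

Lemma flip_eq0 (b : bool) (e : L) : (flip b e == 0) = (e == 0).
Proof.
rewrite /flip; case: b => //; case: (eqVneq e 1) => [->|e1]; first by rewrite (negPf (L2_neq0 d)).
by case: (eqVneq e 2%:R) => [->|//]; rewrite (negPf (L2_neq0 d)).
Qed.

Variable theta : seq L -> bool.

(** The state is a pair of a source word and its image. [theta] is always evaluated at the source,
    which for the inverse map [cstepV] is the word being written. *)
Definition cstep (s : seq L * seq L) a :=
  (rcons s.1 a, rcons s.2 (last 0 s.2 + flip (theta s.1) (a - last 0 s.1))).
Definition cstepV (s : seq L * seq L) a :=
  (rcons s.1 (last 0 s.1 + flip (theta s.1) (a - last 0 s.2)), rcons s.2 a).
Definition twist x := (foldl cstep ([::], [::]) x).2.
Definition twistV x := (foldl cstepV ([::], [::]) x).1.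

Lemma twist1 x : (foldl cstep ([::], [::]) x).1 = x.
Proof. by elim/last_ind: x => // x a IH; rewrite -cats1 foldl_cat /= IH cats1. Qed.

Lemma twistV2 x : (foldl cstepV ([::], [::]) x).2 = x.
Proof. by elim/last_ind: x => // x a IH; rewrite -cats1 foldl_cat /= IH cats1. Qed.

Lemma twist_rcons x a :
  twist (rcons x a) = rcons (twist x) (last 0 (twist x) + flip (theta x) (a - last 0 x)).
Proof. by rewrite /twist -[in LHS]cats1 foldl_cat /= twist1. Qed.

Lemma twistV_rcons x a :
  twistV (rcons x a) = rcons (twistV x) (last 0 (twistV x) + flip (theta (twistV x)) (a - last 0 x)).
Proof. by rewrite /twistV -[in LHS]cats1 foldl_cat /= twistV2. Qed.

Lemma twistK : cancel twist twistV.
Proof.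
elim/last_ind => // x a IH; rewrite twist_rcons twistV_rcons IH; congr rcons.
by rewrite [X in flip _ X]addrC addKr flipK addrC subrK.
Qed.

Lemma twistVK : cancel twistV twist.
Proof.
elim/last_ind => // x a IH; rewrite twistV_rcons twist_rcons IH; congr rcons.
by rewrite [X in flip _ X]addrC addKr flipK addrC subrK.
Qed.

Lemma size_twist x : size (twist x) = size x.
Proof. by elim/last_ind: x => // x a IH; rewrite twist_rcons !size_rcons IH. Qed.

Lemma twist_take n x : twist (take n x) = take n (twist x).
Proof.
elim/last_ind: x => // x a IH; rewrite twist_rcons -!cats1 !take_cat size_twist.
case: ltnP => // h; case: (_ - _)%N => [|k] /=; first by rewrite !cats0.
by rewrite !cats1 twist_rcons.
Qed.

(** [twist] is injective and commutes with [take], hence preserves common prefixes. *)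
Lemma lcp_twist x y : lcp (twist x) (twist y) = lcp x y.
Proof.
apply/eqP; rewrite eqn_leq !lcp_geP !size_twist !lcp_lel !lcp_ler /=.
rewrite -!twist_take !(can_eq twistK).
have := leqnn (lcp x y); rewrite {1}lcp_geP => /and3P[_ _ ->].
have := leqnn (lcp (twist x) (twist y)); rewrite {1}lcp_geP !size_twist -!twist_take => /and3P[-> ->].
by rewrite (can_eq twistK) => ->.
Qed.

Lemma dist_twist x y : dist (twist x) (twist y) = dist x y.
Proof. by rewrite /dist lcp_twist !size_twist. Qed.

Lemma twist_reduced x : theta [::] = false -> reduced x -> reduced (twist x).
Proof.
move=> t0; elim/last_ind: x => // x a IH; rewrite twist_rcons !reduced_rcons.
case/andP=> h /IH->; rewrite andbT; case/lastP: x h {IH} => // x b.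
rewrite !twist_rcons !rev_rcons !last_rcons !(inj_eq (@Some_inj _)) => ba.
by rewrite eq_sym -subr_eq0 addrC addKr flip_eq0 subr_eq0 eq_sym.
Qed.

Lemma reduced_twist x : theta [::] = false -> reduced (twist x) = reduced x.
Proof.
move=> t0; apply/idP/idP; last exact: twist_reduced.
elim/last_ind: x => // x a IH; rewrite twist_rcons !reduced_rcons.
case/andP=> h /IH->; rewrite andbT; case/lastP: x h {IH} => // x b.
rewrite !twist_rcons !rev_rcons !last_rcons !(inj_eq (@Some_inj _)) => ba.
by move: ba; rewrite eq_sym -subr_eq0 addrC addKr flip_eq0 subr_eq0 eq_sym.
Qed.

Hypothesis theta_axis : forall x, onA x -> theta x = false.

Lemma twist_child x a : onA x -> twist x = x -> twist (rcons x a) = rcons x a.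
Proof. by move=> h e; rewrite twist_rcons e theta_axis //= addrC subrK. Qed.

Lemma twist_onA x : onA x -> twist x = x.
Proof.
by elim/last_ind: x => // x a IH h; rewrite twist_child ?IH // (onA_rcons h).
Qed.

Lemma onA_twist x : onA (twist x) = onA x.
Proof.
apply/idP/idP => h; last by rewrite twist_onA.
by have := twist_onA h => /(can_inj twistK) <-.
Qed.

Lemma hang_twist x : hang (twist x) = hang x.
Proof.
rewrite /hang size_twist; apply: eq_count => i /=.
by rewrite -twist_take onA_twist.
Qed.

(** Vertices of the axis and their children are fixed by [twist]. Further away [u ^ m] keeps last
    letters, hence differences, and [theta] takes the same value at both places. *)
Lemma twist_act m : (forall x, reduced x -> theta (act (av d (m * K%:Z)) x) = theta x) ->
  forall x, reduced x -> twist (act (av d (m * K%:Z)) x) = act (av d (m * K%:Z)) (twist x).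
Proof.
move=> hth; have t0 : theta [::] = false by exact: theta_axis.
elim/last_ind => [|x a IH] r; first by rewrite act_nil ?av_reduced // twist_onA ?onA_av.
have rx : reduced x by move: r; rewrite reduced_rcons => /andP[].
case: (boolP (onA x)) => h.
  rewrite (twist_child _ h (twist_onA h)); case/onAP: h r => t -> r.
  case: (boolP (onA (rcons (av d t) a))) => h.
    by rewrite twist_onA // onA_act.
  have [-> _] := offA_act m r h.
  by rewrite act_av twist_child ?onA_av // twist_onA ?onA_av.
have h2 : ~~ onA (rcons x a) by apply: contra h; exact: onA_rcons.
have [-> _] := offA_act m r h2; rewrite !twist_rcons hth // IH //.
have r2 : reduced (twist (rcons x a)) by rewrite reduced_twist.
have h3 : ~~ onA (twist (rcons x a)) by rewrite onA_twist.
move: r2 h3; rewrite twist_rcons => r2 h3; have [-> _] := offA_act m r2 h3.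
congr rcons; congr (_ + flip _ (_ - _)).
  move: h r2 (rx) {IH}; rewrite -onA_twist; case/lastP: x {r h2 h3 rx} => // x b h r2 rx.
  move: h; rewrite twist_rcons => h; move: (rx); rewrite -reduced_twist // twist_rcons => rx'.
  by have [-> _] := offA_act m rx' h; rewrite !last_rcons.
case/lastP: x h rx {r h2 h3 r2 IH} => // x b h rx.
by have [-> _] := offA_act m rx h; rewrite !last_rcons.
Qed.

End Twist.

(** * Prolongation of words by sequences of differences *)

Section Ext.
Variable d : nat.
Local Notation K := d.+3.
Local Notation L := 'I_d.+3.
Implicit Types (a b e : L) (x y p q w g ds : seq L) (t m : int) (n : nat).
Local Open Scope ring_scope.

Local Notation upow m := (av d (m * K%:Z)).

Lemma act_upow m m' x : reduced x -> act (upow m) (act (upow m') x) = act (upow (m + m')) x.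
Proof.
move=> rx; rewrite -act_cat; apply: act_eq => //.
by rewrite act_cat !(act_nil (av_reduced _ _)) act_av mulrDl.
Qed.

Definition ext x ds := foldl (fun y e => rcons y (last 0 y + e)) x ds.

Lemma ext_cat x ds ds' : ext x (ds ++ ds') = ext (ext x ds) ds'.
Proof. exact: foldl_cat. Qed.

Lemma ext_rcons x ds e : ext x (rcons ds e) = rcons (ext x ds) (last 0 (ext x ds) + e).
Proof. by rewrite -cats1 ext_cat. Qed.

Lemma size_ext x ds : size (ext x ds) = (size x + size ds)%N.
Proof. by elim/last_ind: ds => [|ds e IH]; rewrite ?addn0 // ext_rcons !size_rcons IH addnS. Qed.

Lemma ext_inj x x' ds ds' : size ds = size ds' -> ext x ds = ext x' ds' -> x = x' /\ ds = ds'.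
Proof.
elim/last_ind: ds ds' x x' => [|ds e IH] ds' x x'; first by case: ds'.
case/lastP: ds' => [|ds' e']; first by rewrite size_rcons.
rewrite !size_rcons !ext_rcons => -[h] /eqP; rewrite eqseq_rcons => /andP[/eqP h1 /eqP h2].
have [-> h3] := IH _ _ _ h h1; rewrite h3; split=> //; congr rcons.
by move: h2; rewrite h1 => /addrI.
Qed.

Lemma reduced_ext x ds : x != [::] -> reduced x -> all (fun e => e != 0) ds -> reduced (ext x ds).
Proof.
move=> x0 rx; elim/last_ind: ds => // ds e IH; rewrite all_rcons => /andP[e0 /IH r].
rewrite ext_rcons reduced_rcons r andbT.
have : ext x ds != [::] by rewrite -size_eq0 size_ext addn_eq0 negb_and size_eq0 x0.
case/lastP: (ext x ds) => // y b _; rewrite rev_rcons last_rcons /= (inj_eq (@Some_inj _)).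
by rewrite eq_sym addrC -subr_eq0 addrK.
Qed.

Lemma reduced_extl x ds : reduced (ext x ds) -> reduced x.
Proof. by elim/last_ind: ds => // ds e IH; rewrite ext_rcons reduced_rcons => /andP[_ /IH]. Qed.

Lemma act_ext g x ds : (size g < size x)%N -> act g (ext x ds) = ext (act g x) ds.
Proof.
move=> h; elim/last_ind: ds => // ds e IH; rewrite !ext_rcons -IH -cats1.
have h' : (size g < size (ext x ds))%N by rewrite size_ext ltn_addr.
by rewrite act_prefix // cats1 last_act.
Qed.

Lemma hang_ext x ds : ~~ onA x -> hang (ext x ds) = (hang x + size ds)%N.
Proof.
move=> nx; elim/last_ind: ds => [|ds e IH]; first by rewrite addn0.
rewrite ext_rcons hang_rcons IH size_rcons -ext_rcons.
rewrite (_ : ~~ onA _) ?addn1 ?addnS // -hang_onA.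
apply: contra nx; rewrite -hang_onA.
elim/last_ind: (rcons ds e) => // s b IH'; rewrite ext_rcons hang_rcons addn_eq0 => /andP[h _].
exact: IH'.
Qed.

Lemma onA_ext x ds : ~~ onA x -> ~~ onA (ext x ds).
Proof. by move=> nx; rewrite -hang_onA hang_ext // addn_eq0 negb_and hang_onA nx. Qed.

Lemma upow_ext m x ds : reduced (ext x ds) -> ~~ onA x ->
  act (upow m) (ext x ds) = ext (act (upow m) x) ds.
Proof.
move=> + nx; elim/last_ind: ds => // ds e IH; rewrite !ext_rcons => r.
have r' : reduced (ext x ds) by move: r; rewrite reduced_rcons => /andP[].
have h : ~~ onA (rcons (ext x ds) (last 0 (ext x ds) + e)) by rewrite -ext_rcons onA_ext.
have [-> _] := offA_act m r h; rewrite -IH //; congr rcons; congr (_ + _).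
have := onA_ext ds nx; move: r' {r h IH}; case/lastP: (ext x ds) => // y b r' h.
by have [-> _] := offA_act m r' h; rewrite !last_rcons.
Qed.

Lemma twist_ext (th : seq L -> bool) x ds :
  twist th (ext x ds) =
  ext (twist th x) (mkseq (fun j => flip (th (ext x (take j ds))) (nth 0 ds j)) (size ds)).
Proof.
elim/last_ind: ds => // ds e IH; rewrite ext_rcons twist_rcons IH size_rcons mkseqS.
rewrite nth_rcons ltnn eqxx -[take _ (rcons ds e)]/(take _ _).
rewrite (_ : take (size ds) (rcons ds e) = ds); last by rewrite -cats1 take_size_cat.
rewrite [X in X - _]addrC addrK -ext_rcons; congr (ext _ (rcons _ _)).
apply: (eq_from_nth (x0 := 0)); rewrite ?size_mkseq // => i hi.
by rewrite !nth_mkseq // nth_rcons hi -cats1 takel_cat // ltnW.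
Qed.

(** The inverse reads [theta] on the word that it produces, so the new differences [ds'] are only
    described implicitly. *)
Lemma twistV_ext (th : seq L -> bool) x ds :
  exists ds', size ds' = size ds /\ twistV th (ext x ds) = ext (twistV th x) ds' /\
  forall j, (j < size ds)%N -> nth 0 ds j = flip (th (ext (twistV th x) (take j ds'))) (nth 0 ds' j).
Proof.
elim/last_ind: ds => [|ds e [ds' [sz [IH h]]]]; first by exists [::].
rewrite ext_rcons twistV_rcons [X in X - _]addrC addrK.
set f := flip _ e; exists (rcons ds' f); split; first by rewrite !size_rcons sz.
split; first by rewrite ext_rcons IH.
move=> j; rewrite size_rcons ltnS leq_eqVlt => /orP[/eqP->|hj].
  by rewrite !nth_rcons sz ltnn eqxx -sz -cats1 take_size_cat // -IH /f flipK.
by rewrite !nth_rcons sz hj -cats1 takel_cat ?sz 1?ltnW //; exact: h.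
Qed.

End Ext.

(** * Alternating walks, deep starting points and markers *)

Section Generic.
Variable d : nat.
Local Notation K := d.+3.
Local Notation L := 'I_d.+3.
Implicit Types (a b e : L) (x y p q w g ds : seq L) (t m : int) (n i j k R : nat).
Local Open Scope ring_scope.
Implicit Types (th : seq L -> bool) (s : bool) (gs : seq (seq L)).
Variable N : int.

Local Notation upow m := (av d (m * K%:Z)).

(** What is needed for c_theta to fix the axis pointwise and to commute with [u]. *)
Definition tame th :=
  (forall x, onA x -> th x = false) /\
  (forall m x, reduced x -> th (act (upow m) x) = th x).

Definition cc th s x : seq L :=
  if s then act (upow N) (twist th x) else twistV th (act (upow (- N)) x).

Lemma reduced_upow m : reduced (upow m). Proof. exact: av_reduced. Qed.

Lemma upowK m x : reduced x -> act (upow (- m)) (act (upow m) x) = x.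
Proof. by move=> rx; rewrite act_upow // addNr. Qed.

Section Tame.
Variable th : seq L -> bool.
Hypothesis tth : tame th.

Lemma reduced_twistV x : reduced x -> reduced (twistV th x).
Proof. by move=> rx; rewrite -(reduced_twist (theta := th)) ?twistVK // tth.1. Qed.

Lemma cc_reduced s x : reduced x -> reduced (cc th s x).
Proof.
move=> rx; case: s; rewrite /cc; first by rewrite act_reduced // reduced_twist // tth.1.
by rewrite reduced_twistV // act_reduced.
Qed.

Lemma ccK s x : reduced x -> cc th (~~ s) (cc th s x) = x.
Proof.
move=> rx; case: s; rewrite /cc /=; first by rewrite upowK ?twistK // reduced_twist // tth.1.
by rewrite twistVK act_upow // addrN.
Qed.

Lemma cc_inj s x y : reduced x -> reduced y -> cc th s x = cc th s y -> x = y.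
Proof. by move=> rx ry e; rewrite -(ccK s rx) e ccK. Qed.

Lemma cc_act s m x : reduced x -> cc th s (act (upow m) x) = act (upow m) (cc th s x).
Proof.
have [h1 h2] := tth.
have T z : reduced z -> cc th true (act (upow m) z) = act (upow m) (cc th true z).
  move=> rz; rewrite /cc twist_act // ?act_upow ?reduced_twist ?h1 // => [|y ry].
    by rewrite addrC.
  by rewrite h2.
case: s => [|rx]; first exact: T.
apply: (@cc_inj true); rewrite ?act_reduced ?cc_reduced ?act_reduced //.
by rewrite T ?cc_reduced // !(ccK false) ?act_reduced.
Qed.

Lemma hang_twistV x : hang (twistV th x) = hang x.
Proof. by rewrite -[in RHS](twistVK th x) hang_twist //; exact: tth.1. Qed.

Lemma hang_cc s x : reduced x -> hang (cc th s x) = hang x.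
Proof.
move=> rx; case: s; rewrite /cc; last by rewrite hang_twistV hang_act.
by rewrite hang_act ?hang_twist ?reduced_twist //; exact: tth.1 || exact: (tth.1 _ (onA_av d 0)).
Qed.

Lemma dist_cc s x y : reduced x -> reduced y -> dist (cc th s x) (cc th s y) = dist x y.
Proof.
have T z w : reduced z -> reduced w -> dist (cc th true z) (cc th true w) = dist z w.
  by move=> rz rw; rewrite /cc dist_act ?dist_twist // reduced_twist ?tth.1.
move=> rx ry; case: s; first exact: T.
by rewrite -T ?cc_reduced // !(ccK false).
Qed.

Lemma cc_av s t : cc th s (av d t) = av d ((if s then N else - N) * K%:Z + t).
Proof.
have h := tth.1; case: s; rewrite /cc; first by rewrite twist_onA ?onA_av // act_av.
by rewrite act_av; apply: (can_inj (twistK th)); rewrite twistVK twist_onA // onA_av.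
Qed.

(** Beyond the support of [th] no difference is exchanged, and off the axis [u ^ N] keeps the
    differences. *)
Lemma cc_ext R s x ds : (forall y, th y -> (hang y < R)%N) -> (R <= hang x)%N -> (0 < hang x)%N ->
  reduced (ext x ds) -> cc th s (ext x ds) = ext (cc th s x) ds.
Proof.
move=> sup hR h0 r; have rx := reduced_extl r.
have nA : ~~ onA x by rewrite -hang_onA -lt0n.
have F y es : (R <= hang y)%N -> ~~ onA y -> th (ext y es) = false.
  move=> hy ny; apply/negP => /sup; rewrite hang_ext //; lia.
have T y es : (R <= hang y)%N -> ~~ onA y -> twist th (ext y es) = ext (twist th y) es.
  move=> hy ny; rewrite twist_ext; congr ext.
  by apply: (eq_from_nth (x0 := 0)); rewrite ?size_mkseq // => i hi; rewrite nth_mkseq // F.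
have t0 : th [::] = false := tth.1 _ (onA_av d 0).
case: s; rewrite /cc.
  by rewrite T // upow_ext // ?onA_twist //; [rewrite -T // reduced_twist|exact: tth.1].
rewrite upow_ext //; apply: (can_inj (twistK th)); rewrite twistVK T ?twistVK //.
  by rewrite hang_twistV hang_act.
by rewrite -hang_onA hang_twistV hang_act // -lt0n.
Qed.

End Tame.

(** The alternating product of the [n] first g_i, each preceded by c or its inverse, applied to [x]
    with g_0 acting first; [s] is the sign of the first exponent. *)
Fixpoint runi th s gs x n : seq L :=
  if n is n'.+1 then act (nth [::] gs n') (cc th (s (+) odd n') (runi th s gs x n')) else x.

Lemma runi_reduced th s gs x n : tame th -> reduced x -> reduced (runi th s gs x n).
Proof. by move=> tt rx; elim: n => //= n IH; rewrite act_reduced // cc_reduced. Qed.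

Lemma runi_cons th s g gs x n : runi th s (g :: gs) x n.+1 = runi th (~~ s) gs (act g (cc th s x)) n.
Proof.
elim: n => [|n IH]; first by rewrite /= addbF.
by rewrite [RHS]/= -IH /= addbN addNb.
Qed.

(** At every step the vertex is outside the support of [th], and too long for g_i to cancel it: both
    maps then commute with prolongation. *)
Definition deep th s gs R x := forall i, (i < size gs)%N ->
  (R + size (nth [::] gs i) < hang (runi th s gs x i))%N.

(** Strict alternation of 1 and 2. Differences along a ray of the axis are constant, so two
    consecutive entries already force a word off the axis. *)
Definition altp (ds : seq L) := all (fun e : L => (e == 1) || (e == 2%:R)) ds && reduced ds.

Lemma altp_ex n : exists2 t, altp t & size t = n.
Proof.
have n12 := L2_neq1 d.
suff [t [a [h1 h2 h3]]] : exists (t : seq L) a, [/\ altp (a :: t), size t = n & (a == 1) || (a == 2%:R)].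
  exists t => //; move: h1; rewrite /altp /= => /andP[/andP[_ ->]] /=.
  by case: t h2 => //= b t _ /andP[].
elim: n => [|n [t [a [h1 h2 h3]]]]; first by exists [::], 1; split; rewrite /altp /= ?eqxx.
case/orP: h3 h1 => /eqP-> h1; [exists (1 :: t), 2%:R|exists (2%:R :: t), 1];
  by split; rewrite ?eqxx ?orbT //=; rewrite ?h2 //; move: h1;
   rewrite /altp /= !eqxx ?orbT /= ?n12 // eq_sym n12.
Qed.

Lemma altp_drop n (t : seq L) : altp t -> altp (drop n t).
Proof.
rewrite /altp -{1 2}(cat_take_drop n t) all_cat => /andP[/andP[_ ->]].
exact: reduced_catr.
Qed.

Lemma altp_offA z a b : z != [::] -> (a == 1) || (a == 2%:R) -> (b == 1) || (b == 2%:R) ->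
  a != b -> ~~ onA (ext z [:: a; b]).
Proof.
case/lastP: z => // z l _ _ _; apply: contra => /onAP[t] /=; rewrite !last_rcons => e.
have [c [s [ss h]]] := nth_av d t.
have st : `|t|%N = (size z).+3 by rewrite -(size_av d) -e !size_rcons.
have E i : (i < (size z).+3)%N -> nth 0 (rcons (rcons (rcons z l) (l + a)) (l + a + b)) i = c + s *+ i.
  by rewrite e -st; exact: h.
have := E _ (leqnn _); rewrite nth_rcons !size_rcons ltnn eqxx.
have := E (size z).+1 (leqnSn _); rewrite !nth_rcons !size_rcons leqnn ltnn eqxx.
have := E (size z) (leq_addl 2 _); rewrite !nth_rcons !size_rcons leqnSn leqnn ltnn eqxx.
rewrite !mulrSr !addrA => <- /addrI -> /addrI ->; exact: eqxx.
Qed.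

End Generic.

Section GenericStep.
Variable d : nat.
Local Notation K := d.+3.
Local Notation L := 'I_d.+3.
Implicit Types (a b e : L) (x y p q w g z ds : seq L) (m : int) (n i j k R : nat).
Local Open Scope ring_scope.
Implicit Types (th : seq L -> bool) (s : bool) (gs : seq (seq L)).
Variable N : int.
Local Notation upow m := (av d (m * K%:Z)).
Local Notation cc := (cc N).
Local Notation runi := (runi N).

Definition supported th R := forall y, th y -> (hang y < R)%N.

Lemma altp_neq0 (t : seq L) : altp t -> all (fun e => e != 0) t.
Proof.
case/andP=> h _; apply: sub_all h => e /orP[]/eqP->; [exact: L1_neq0|exact: L2_neq0].
Qed.

Lemma hang_take n x : (hang (take n x) <= hang x)%N.
Proof.
rewrite -{2}(cat_take_drop n x); elim/last_ind: (drop n x) => [|s a IH]; first by rewrite cats0.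
by rewrite -rcons_cat hang_rcons (leq_trans IH) // leq_addr.
Qed.

(** The bound is uniform in the start [z], which is what the induction uses: the first step only
    changes an initial part, and the remaining differences prolong another nonempty word. *)
Lemma deep_ex th R : tame th -> supported th R -> forall gs s, exists H, forall z (t : seq L),
  z != [::] -> reduced z -> altp t -> (H <= size t)%N -> deep N th s gs R (ext z t).
Proof.
move=> tt sup; elim=> [|g gs IH] s; first by exists 0%N.
(* Two differences leave the axis, [R + size g + 1] more secure the margin of this step, and [H] are
   left for the next ones. *)
have [H hH] := IH (~~ s); exists (R + size g + 3 + H)%N => z t z0 rz at_ szt.
pose n := (R + size g + 3)%N; have nt : (n <= size t)%N by rewrite /n; lia.
have at1 : altp (take n t).
  move: at_; rewrite /altp -{1 2}(cat_take_drop n t) all_cat => /andP[/andP[-> _]].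
  exact: reduced_catl.
have at2 : altp (drop n t) by exact: altp_drop.
pose x1 := ext z (take n t).
have rx : reduced (ext z t) by rewrite reduced_ext // altp_neq0.
have h1 : (R + size g < hang x1)%N.
  rewrite /x1; have : size (take n t) = (R + size g).+3 by rewrite size_takel // /n; lia.
  case: (take n t) at1 => [|a [|b t1]] //= /andP[/= /and3P[ha hb _] /andP[ab _]] [st].
  have oA := altp_offA z0 ha hb ab.
  have := hang_ext t1 oA; move: oA; rewrite -hang_onA -lt0n /= => h0 ->; rewrite st.
  exact: leq_addl.
have e : ext z t = ext x1 (drop n t) by rewrite -ext_cat cat_take_drop.
have x1n : ~~ onA x1 by rewrite -hang_onA -lt0n; lia.
have rx1 : reduced x1 by move: rx; rewrite e => /reduced_extl.
have sc : (size g < size (cc th s x1))%N.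
  by apply: leq_trans (hang_le _); rewrite hang_cc //; lia.
case=> [_|i hi].
  by rewrite [runi _ _ _ _ _]/= e hang_ext //= -/n; apply: leq_trans h1 (leq_addr _ _).
rewrite runi_cons e (cc_ext N tt s sup) -?e //; [|lia|lia].
rewrite act_ext //; apply: hH => //; rewrite ?act_reduced ?cc_reduced //.
  by rewrite -size_eq0 -lt0n; apply: leq_trans (size_act_ge _ _); rewrite subn_gt0.
by rewrite size_drop /n; lia.
Qed.

Lemma take_ext x ds n : take (size x + n) (ext x ds) = ext x (take n ds).
Proof.
have P y es : take (size y) (ext y es) = y.
  elim/last_ind: es => [|es e IH]; first by rewrite take_size.
  by rewrite ext_rcons -cats1 takel_cat // size_ext leq_addr.
case: (leqP n (size ds)) => h.
  by rewrite -{1}(cat_take_drop n ds) ext_cat -{1}(size_takel h) -size_ext P.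
by rewrite !take_oversize // ?size_ext ?leq_add2l // ltnW.
Qed.

Lemma take_ext_le x ds n : (n <= size x)%N -> take n (ext x ds) = take n x.
Proof. by move=> h; rewrite -(take_takel _ h) -[size x]addn0 take_ext take0. Qed.

Lemma twist_eq th th' x : (forall n, th (take n x) = th' (take n x)) -> twist th x = twist th' x.
Proof.
elim/last_ind: x => // x a IH h; rewrite !twist_rcons IH => [|n].
  by have := h (size x); rewrite -cats1 take_size_cat // => ->.
case: (leqP n (size x)) => hn; first by have := h n; rewrite -cats1 takel_cat.
by have := h (size x); rewrite -cats1 take_size_cat // take_oversize // ltnW.
Qed.

(** Two occurrences shifted by at most [k] would put the final 2 of one marker in the place of a 1
    of the other. *)
Lemma marker k p p' y y' : (size y <= size y')%N -> (size y' <= k)%N ->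
  ext (ext p (rcons (nseq k 1) 2%:R)) y = ext (ext p' (rcons (nseq k 1) 2%:R)) y' ->
  p = p' /\ y = y'.
Proof.
move=> h1 h2; set mk := rcons _ _.
have {1}-> : y' = take (size y' - size y) y' ++ drop (size y' - size y) y' by rewrite cat_take_drop.
rewrite ext_cat => /ext_inj[|]; first by rewrite size_drop; lia.
case: (posnP (size y' - size y)) => [->|e0 e1 _].
  by rewrite take0 drop0 => e1 ->; have [] := @ext_inj d p p' mk mk erefl e1.
set n := (size y' - size y)%N in e0 e1 *.
have nk : (n <= k)%N by rewrite /n; lia.
have mkE : mk = nseq (k - n) 1 ++ rcons (nseq n 1) 2%:R.
  by rewrite /mk -{1}(subnK nk) nseqD rcons_cat.
have : ext (ext p (nseq (k - n) 1)) (rcons (nseq n 1) 2%:R) =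
    ext (ext p' (nseq k 1)) (2%:R :: take n y').
  by rewrite -ext_cat -mkE e1 /mk ext_rcons.
case/ext_inj; first by rewrite size_rcons size_nseq /= size_takel // /n leq_subr.
rewrite -(prednK e0) /= => _ /(congr1 (head 0)) /= /eqP; by rewrite eq_sym (negPf (L2_neq1 d)).
Qed.

End GenericStep.

(** * One genericity step: new marks that make a given word move a vertex *)

Section GenericStep.
Variable d : nat.
Local Notation K := d.+3.
Local Notation L := 'I_d.+3.
Implicit Types (a b e : L) (x p q w g z y ds : seq L) (m : int) (n i j R : nat).
Local Open Scope ring_scope.
Variable N : int.
Local Notation upow m := (av d (m * K%:Z)).

Variables (th : seq L -> bool) (R : nat) (s : bool) (gs : seq (seq L)) (x0 : seq L).
Hypotheses (tth : tame th) (sup : supported th R) (x0_deep : deep N th s gs R x0).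
Hypotheses (rx0 : reduced x0) (x0n : x0 != [::]) (gsU : all (fun g => ~~ inU g) gs) (gs0 : (0 < size gs)%N).

Let k := size gs.
Let sg i := s (+) odd i.
Let st i := runi N th s gs x0 i.
(** The vertex around which [th] is read at step [i]: the argument of c, but the value of its
    inverse. *)
Let src0 i := if sg i then st i else cc N th false (st i).

Lemma st_red i : reduced (st i). Proof. exact: runi_reduced. Qed.

Lemma src0_red i : reduced (src0 i).
Proof. by rewrite /src0; case: sg; rewrite ?cc_reduced // st_red. Qed.

Lemma hang_src0 i : hang (src0 i) = hang (st i).
Proof. by rewrite /src0; case: sg; rewrite // hang_cc // st_red. Qed.

Lemma hang_st i : (i < k)%N -> (R < hang (st i))%N.
Proof. by move=> hi; have := x0_deep hi; rewrite -/(st i); lia. Qed.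

(** Otherwise g_i and a power of [u] would agree at some vertex, and by freeness g_i would be this
    power. Consecutive steps therefore never read each other's marks. *)
Lemma src0_sim i m : (i.+1 < k)%N -> act (upow m) (src0 i) <> src0 i.+1.
Proof.
move=> hi; have gi : ~~ inU (nth [::] gs i) by rewrite (allP gsU) // mem_nth // ltnW.
suff H x : reduced x -> act (upow m) x <> act (nth [::] gs i) x.
  have stS : st i.+1 = act (nth [::] gs i) (cc N th (sg i) (st i)) by [].
  rewrite /src0 stS /sg [odd i.+1]/= addbN; case: (s (+) odd i) => e.
    apply: (H (cc N th true (st i))); first by rewrite cc_reduced // st_red.
    rewrite -(cc_act N tth true m (st_red i)) e.
    by rewrite (ccK N tth false) // act_reduced // cc_reduced // st_red.
  by apply: (H (cc N th false (st i))) e; rewrite cc_reduced // st_red.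
move=> rx e; move/negP: gi; apply; apply/inUP; exists (- - m).
have := act_free (g := rev (nth [::] gs i) ++ upow m) rx.
rewrite act_cat e actKV // => /(_ erefl); rewrite act_cat act_nil ?reduced_upow // => h.
by rewrite opprK -[upow m](actVK (nth [::] gs i)) ?reduced_upow // h.
Qed.

(** Larger than each [hang (src0 i)], so that prefixes of sources are too shallow to be new marks,
    and than the length [k.+1] of the words read behind the marker. *)
Let lm := (\max_(i < k) hang (src0 i) + k.+2)%N.
Let mk : seq L := rcons (nseq lm 1) 2%:R.
Let src i := ext (src0 i) mk.

Lemma hang_src0_lm i : (i < k)%N -> (hang (src0 i) < lm)%N.
Proof.
move=> hi; have := @leq_bigmax _ (fun i : 'I_k => hang (src0 i)) (Ordinal hi).
by rewrite /lm /=; lia.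
Qed.

Lemma src0_offA i : (i < k)%N -> ~~ onA (src0 i).
Proof. by move=> hi; rewrite -hang_onA hang_src0; have := hang_st hi; lia. Qed.

Lemma mk_neq0 : all (fun e => e != 0) mk.
Proof. by rewrite all_rcons all_nseq L2_neq0 /= orbT. Qed.

Lemma src0_neq0 i : (i < k)%N -> src0 i != [::].
Proof. by move=> hi; apply: contraNneq (src0_offA hi) => ->. Qed.

Lemma src_red i : (i < k)%N -> reduced (src i).
Proof. by move=> hi; rewrite reduced_ext ?src0_red ?src0_neq0 ?mk_neq0. Qed.

(** The marks of step [i] lie [i.+1] letters behind the marker and only after a difference 2: a 2 in
    position [i] thus makes step [i] exchange 1 and 2 in position [i.+1]. Whole orbits of [u] are
    added to keep the set tame. *)
Definition th1 x := th x || `[< exists i m y, [/\ (i < k)%N, size y = i.+1, last 0 y = 2%:R,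
  reduced (ext (src i) y) & x = act (upow m) (ext (src i) y)] >].

Lemma th1P x : th x = false -> reflect (exists i m y, [/\ (i < k)%N, size y = i.+1, last 0 y = 2%:R,
  reduced (ext (src i) y) & x = act (upow m) (ext (src i) y)]) (th1 x).
Proof. by move=> h; rewrite /th1 h; exact: asboolP. Qed.

Lemma hang_new i m y : (i < k)%N -> reduced (ext (src i) y) ->
  hang (act (upow m) (ext (src i) y)) = (hang (src0 i) + lm.+1 + size y)%N.
Proof.
move=> hi r; rewrite hang_act // !hang_ext ?src0_offA ?onA_ext ?src0_offA //.
by rewrite size_rcons size_nseq.
Qed.

Lemma th1_low x : (hang x < R)%N -> th1 x = th x.
Proof.
move=> hx; case E: (th x); first by rewrite /th1 E.
apply/(th1P E) => -[i [m [y [hi _ _ r e]]]]; move: hx; rewrite e hang_new // hang_src0.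
by have := hang_st hi; lia.
Qed.

Lemma th1_tame : tame th1.
Proof.
split=> [x xA|m x rx]; rewrite /th1.
  rewrite tth.1 //=; apply/asboolP => -[i [m [y [hi _ _ r e]]]].
  by move: xA; rewrite e onA_act // (negPf (onA_ext _ (onA_ext _ (src0_offA hi)))).
rewrite tth.2 //; congr orb; apply: asbool_equiv_eq; split=> -[i [m' [y [hi h1 h2 r e]]]].
  exists i, (- m + m'), y; split=> //.
  by rewrite -(upowK m rx) e act_upow.
by exists i, (m + m'), y; split=> //; rewrite e act_upow.
Qed.

(** A new mark hangs by [hang (src0 i) + lm.+1 + i.+1], which is less than [3 * lm]. *)
Let R1 := (R + 3 * lm)%N.

Lemma th1_supported : supported th1 R1.
Proof.
move=> x /orP[/sup|/asboolP[i [m [y [hi h1 _ r e]]]]]; first by rewrite /R1; lia.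
by rewrite e hang_new // h1; have := hang_src0_lm hi; rewrite /R1 /lm; lia.
Qed.

Lemma new_eq i j m y y' : (i < k)%N -> (j < k)%N -> (size y <= lm)%N -> (size y' <= lm)%N ->
  reduced (ext (src j) y) -> act (upow m) (ext (src j) y) = ext (src i) y' ->
  act (upow m) (src0 j) = src0 i /\ y = y'.
Proof.
move=> hi hj sy sy' r; have r1 := reduced_extl r.
rewrite upow_ext // ?onA_ext ?src0_offA // [act _ (src j)]upow_ext // ?src0_offA // => e.
case: (leqP (size y) (size y')) => h; first exact: marker h sy' e.
by have [-> ->] := marker (ltnW h) sy (esym e).
Qed.

(** A new mark ends with a 2 that comes after a complete marker. Prefixes of the source are too
    close to the axis, prefixes ending inside the marker end with 1, and after the full marker
    nothing follows. *)
Lemma th1_prefix i n : (i < k)%N -> th1 (take n (src i)) = th (take n (src i)).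
Proof.
move=> hi; case E: (th _); first by rewrite /th1 E.
apply/(th1P E) => -[j [m [y [hj h1 h2 r e]]]].
case: (leqP n (size (src0 i))) => hn.
  have := hang_take n (src0 i); rewrite -(take_ext_le mk hn) -/(src i) e hang_new //.
  by have := hang_src0_lm hi; lia.
have e1 : take n (src i) = ext (src0 i) (take (n - size (src0 i)) mk).
  by rewrite -take_ext subnKC // ltnW.
have {}hn : (0 < n - size (src0 i))%N by rewrite subn_gt0.
case: (ltnP lm (n - size (src0 i))) => hl.
  move: e1; rewrite [take _ mk]take_oversize ?size_rcons ?size_nseq //.
  rewrite e -/(src i) -[src i]/(ext (src i) [::]) => /new_eq[] //; first by rewrite h1 /lm; lia.
  by move=> _ y0; move: h1; rewrite y0.
move: e1; rewrite /mk -cats1 takel_cat ?size_nseq // take_nseq //.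
case/lastP: y h1 h2 r e => // y b; rewrite last_rcons => h1 -> r e.
have hy : ~~ onA (src j) by rewrite onA_ext // src0_offA.
rewrite e upow_ext // -(prednK hn) -[_.-1.+1]addn1 nseqD -cats1 !ext_cat => /ext_inj[//|_].
by move/(congr1 (head 0)) => /= /eqP; rewrite (negPf (L2_neq1 d)).
Qed.

Lemma th1_src i (y : seq L) : (i < k)%N -> (size y <= k.+1)%N -> reduced (ext (src i) y) ->
  reflect (exists j m, [/\ (j < k)%N, size y = j.+1, last 0 y = 2%:R & act (upow m) (src0 j) = src0 i])
    (th1 (ext (src i) y)).
Proof.
move=> hi sy r; have hs := hang_st hi; have E : th (ext (src i) y) = false.
  apply/negP => /sup; rewrite !hang_ext ?onA_ext ?src0_offA // hang_src0; lia.
have slm : (size y <= lm)%N by rewrite /lm; lia.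
apply: (iffP (th1P E)) => [[j [m [y' [hj h1 h2 r' e]]]]|[j [m [hj h1 h2 e]]]].
  have [|h3 h4] := new_eq hi hj _ slm r' (esym e); first by rewrite h1 /lm; lia.
  by exists j, m; rewrite -h4.
have ei : src i = act (upow m) (src j) by rewrite upow_ext ?src_red ?src0_offA // e.
have ej : ext (src j) y = act (upow (- m)) (ext (src i) y).
  by rewrite upow_ext ?onA_ext ?src0_offA // ei upowK // src_red.
have rj : reduced (ext (src j) y) by rewrite ej act_reduced.
by exists j, m, y; split=> //; rewrite ej act_upow // addrN.
Qed.

(** An arbitrary later stage: the conclusion has to survive all further additions of marks. *)
Variable th2 : seq L -> bool.
Hypotheses (tth2 : tame th2) (th2E : forall x, (hang x < R1)%N -> th2 x = th1 x).

Lemma th2_src i n : (i < k)%N -> th2 (take n (src i)) = th (take n (src i)).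
Proof.
move=> hi; rewrite th2E ?th1_prefix //; apply: leq_ltn_trans (hang_take _ _) _.
rewrite hang_ext ?src0_offA // size_rcons size_nseq.
by have := hang_src0_lm hi; rewrite /R1; lia.
Qed.

Lemma src_st i : (i < k)%N -> src i = if sg i then ext (st i) mk else cc N th false (ext (st i) mk).
Proof.
move=> hi; rewrite /src /src0; case: (sg i) => //; have hs := hang_st hi.
rewrite (cc_ext N tth _ sup) //; [lia|lia|].
have h := hang_src0 i; rewrite reduced_ext ?st_red ?mk_neq0 //.
by apply: contraTneq (hang_st hi) => ->.
Qed.

Lemma st_mk_red i : (i < k)%N -> reduced (ext (st i) mk).
Proof.
move=> hi; rewrite reduced_ext ?st_red ?mk_neq0 //.
by apply: contraTneq (hang_st hi) => ->.
Qed.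

Lemma cc2_base i : (i < k)%N -> cc N th2 (sg i) (ext (st i) mk) = cc N th (sg i) (ext (st i) mk).
Proof.
move=> hi; have := src_st hi; case: (sg i) => e.
  by rewrite /cc -e (twist_eq (th' := th)) // => n; exact: th2_src.
rewrite -e; apply: (cc_inj tth2 (s := true) (N := N)); rewrite ?cc_reduced ?src_red ?st_mk_red //.
rewrite (ccK N tth2 false) ?st_mk_red // /cc (twist_eq (th' := th)) => [|n]; last exact: th2_src.
by rewrite -/(cc N th true (src i)) e (ccK N tth false) // st_mk_red.
Qed.

Lemma th2_flip i (y : seq L) j : (i < k)%N -> (j <= size y)%N -> (size y <= k.+1)%N ->
  reduced (ext (src i) y) ->
  reflect (exists j' m, [/\ (j' < k)%N, j = j'.+1, nth 0 y j' = 2%:R & act (upow m) (src0 j') = src0 i])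
    (th2 (ext (src i) (take j y))).
Proof.
move=> hi hj hy r; rewrite th2E; last first.
  rewrite !hang_ext ?onA_ext ?src0_offA // size_takel // size_rcons size_nseq.
  by have := hang_src0_lm hi; rewrite /R1 /lm; lia.
have r' : reduced (ext (src i) (take j y)).
  by move: r; rewrite -{1}(cat_take_drop j y) ext_cat => /reduced_extl.
have sj : size (take j y) = j by rewrite size_takel.
apply: (iffP (th1_src hi _ r')) => [|[j' [m [h1 h2]]]|[j' [m [h1 h2 h3 h4]]]].
- by rewrite sj (leq_trans hj).
- move=> h3 h4; have {}h2 : j = j'.+1 := etrans (esym sj) h2.
  exists j', m; split=> //.
  by rewrite -h3 -nth_last sj h2 nth_take.
- by exists j', m; split; rewrite // ?sj // -nth_last sj h2 nth_take.
Qed.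

(** Nothing is required before position [i], since marks of other steps in the same orbit may change
    these entries. *)
Definition cursor i (y : seq L) := [/\ size y = k.+1, nth 0 y i = 2%:R &
  forall j, (i < j < k.+1)%N -> nth 0 y j = 1].

Lemma flipT2 : flip true (1 : L) = 2%:R. Proof. by rewrite /flip eqxx. Qed.

(** The 2 in position [i] marks the prefix of length [i.+1], so the next 1 becomes 2; the longer
    prefixes end with 1 and are unmarked. *)
Lemma cursor_fwd i (y y1 : seq L) : (i < k)%N -> reduced (ext (src i) y) -> cursor i y -> size y1 = size y ->
  (forall j, (j < size y)%N -> nth 0 y1 j = flip (th2 (ext (src i) (take j y))) (nth 0 y j)) ->
  cursor i.+1 y1.
Proof.
move=> hi r [h1 h2 h3] sy h; have ik : (i < k.+1)%N := leqW hi; split; first by rewrite sy.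
  rewrite h ?h1 // h3 ?leqnn //.
  rewrite (_ : th2 _ = true) ?flipT2 //; apply/th2_flip => //; rewrite ?h1 //.
  by exists i, 0; split.
move=> j /andP[hj hk]; rewrite h ?h1 // h3 ?(ltnW hj) //.
rewrite (_ : th2 _ = false) //; apply/negP => /th2_flip -[] //; rewrite ?h1 // 1?ltnW //.
move=> j' [m [a1 a2 a3 _]]; move: a3; rewrite h3; last by rewrite -ltnS -a2 hj ltnW.
by move/eqP; rewrite eq_sym (negPf (L2_neq1 d)).
Qed.

(** The marks are now read on the unknown word [y1]. A change in position [i] or [i.+2] would be due
    to marks of step [i - 1] or [i + 1], which [src0_sim] excludes; so the 2 survives in position
    [i], creates one in position [i.+1], and 1s follow. *)
Lemma cursor_bwd i (y y1 : seq L) : (i < k)%N -> reduced (ext (src i) y1) -> cursor i y -> size y1 = size y ->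
  (forall j, (j < size y)%N -> nth 0 y j = flip (th2 (ext (src i) (take j y1))) (nth 0 y1 j)) ->
  cursor i.+1 y1.
Proof.
move=> hi r [h1 h2 h3] sy h; have ik : (i < k.+1)%N := leqW hi.
have F j : (j < k.+1)%N -> nth 0 y1 j = flip (th2 (ext (src i) (take j y1))) (nth 0 y j).
  by move=> hj; rewrite h ?h1 // flipK.
have y1i : nth 0 y1 i = 2%:R.
  rewrite F ?h2 1?ltnW // (_ : th2 _ = false) //; apply/negP => /th2_flip -[] //; rewrite ?sy ?h1 //.
    by rewrite ltnW // ltnW.
  move=> j [m [a1 a2 _ a3]]; apply: (@src0_sim j (- - m)); rewrite -?a2 ?opprK //.
have y1S : nth 0 y1 i.+1 = 2%:R.
  rewrite F // h3 ?leqnn // (_ : th2 _ = true) ?flipT2 //.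
  by apply/th2_flip => //; rewrite ?sy ?h1 // ; exists i, 0; split.
split; rewrite ?sy //.
move=> j /andP[]; elim: j => // j IH; rewrite ltnS leq_eqVlt => /orP[/eqP<-|hj] hk.
  rewrite F // h3 ?hk ?andbT // (_ : th2 _ = false) //.
  apply/negP => /th2_flip -[] //; rewrite ?sy ?h1 // 1?ltnW //.
  move=> j' [m [a1 [a2] _ a3]]; rewrite -a2 in a1 a3.
  by apply: (@src0_sim i (- m)) => //; rewrite -a3 upowK ?src0_red.
rewrite F // h3 ?hk ?andbT 1?ltnW // 1?ltnW // (_ : th2 _ = false) //.
apply/negP => /th2_flip -[] //; rewrite ?sy ?h1 // 1?ltnW //.
move=> j' [m [a1 [a2] a3 _]]; move: a3; rewrite -a2 IH // 1?ltnW //.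
Qed.

Let v := ext (ext x0 mk) (2%:R :: nseq k 1).

Lemma v_red : reduced v.
Proof. by rewrite /v -ext_cat reduced_ext // all_cat mk_neq0 /= all_nseq orbT. Qed.

Lemma runi_v i : (i <= k)%N -> exists2 y, cursor i y & runi N th2 s gs v i = ext (ext (st i) mk) y.
Proof.
elim: i => [_|i IH hi].
  exists (2%:R :: nseq k 1) => //; split=> [||j /andP[]] //=; first by rewrite size_nseq.
  by case: j => //= j _ hj; rewrite nth_nseq -ltnS hj.
have [y cy e] := IH (ltnW hi); have rr := runi_reduced N s gs i tth2 v_red.
rewrite /= e; rewrite e in rr; rewrite -/(sg i).
have hs := hang_st hi; have nA : ~~ onA (ext (st i) mk).
  by rewrite onA_ext // -hang_onA; lia.
have [y1 cy1 e1] : exists2 y1, cursor i.+1 y1 & cc N th2 (sg i) (ext (ext (st i) mk) y)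
    = ext (cc N th2 (sg i) (ext (st i) mk)) y1.
  have := src_st hi; have := cc2_base hi; case: (sg i) => eb es; rewrite /cc.
    rewrite twist_ext; set y1 := mkseq _ _; exists y1.
      apply: (@cursor_fwd i y) => //; rewrite ?es ?size_mkseq // => j hj.
      by rewrite nth_mkseq.
    rewrite upow_ext //; last by rewrite onA_twist //; exact: tth2.1.
    by rewrite -twist_ext reduced_twist // (tth2.1 _ (onA_av d 0)).
  rewrite upow_ext //.
  have [y1 [sy [ey h]]] := twistV_ext th2 (act (upow (- N)) (ext (st i) mk)) y.
  have es' : src i = twistV th2 (act (upow (- N)) (ext (st i) mk)).
    by rewrite -/(cc N th2 false _) eb.
  exists y1; last by rewrite ey.
  apply: (@cursor_bwd i y) => //; last by rewrite es'.
  rewrite es' -ey; apply: reduced_twistV => //.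
  by rewrite -upow_ext // act_reduced.
exists y1 => //; rewrite e1 cc2_base // (cc_ext N tth _ sup) ?st_mk_red //; [|lia|lia].
rewrite -!ext_cat act_ext //; apply: leq_trans (hang_le _); rewrite hang_cc ?st_red //.
by have := x0_deep hi; rewrite -/(st i); lia.
Qed.

(** The walk brings a 2 to position [k] behind the marker, where [v] has a 1. *)
Lemma runi_v_neq : runi N th2 s gs v k <> v.
Proof.
have [y [h1 h2 _] ->] := runi_v (leqnn k).
case/ext_inj; first by rewrite h1 /= size_nseq.
have E n : (0 < n)%N -> nth 0 (2%:R :: nseq n 1 : seq L) n = 1.
  by case: n => // n _; rewrite -[LHS]/(nth 0 (nseq n.+1 1) n) nth_nseq ltnSn.
by move=> _ ey; move: h2; rewrite ey E.
Qed.

End GenericStep.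

(** * Limit of the genericity steps *)

Section GenericTwist.
Variables (d : nat) (N : int).
Local Notation L := 'I_d.+3.
Implicit Types (x : seq L) (th : seq L -> bool) (gs : seq (seq L)).

Definition regular gs := (0 < size gs) && all (fun g => ~~ inU g) gs.

Definition separated th R s gs := exists2 v, reduced v & forall th2, tame th2 ->
  (forall x, hang x < R -> th2 x = th x) -> runi N th2 s gs v (size gs) <> v.

Lemma generic_step th R (n : nat) (sgs : bool * seq (seq L)) : tame th -> supported th R ->
  exists th' R', [/\ tame th', supported th' R', n <= R',
    R <= R' /\ forall x, hang x < R -> th' x = th x
    & regular sgs.2 -> separated th' R' sgs.1 sgs.2].
Proof.
case: sgs => s gs tt sup; case: (boolP (regular gs)) => [/andP[gs0 gsU]|nr]; last first.
  exists th, (maxn R n); split=> //; rewrite ?leq_maxr ?leq_maxl //.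
  by move=> x /sup h; rewrite leq_max h.
have [H hH] := deep_ex N tt sup gs s; have [t at_ st] := altp_ex d H.
pose x0 : seq L := ext [:: 0%R] t.
have dp : deep N th s gs R x0 by apply: hH; rewrite ?st.
have rx : reduced x0 by rewrite /x0 reduced_ext // altp_neq0.
have x0n : x0 != [::] by rewrite -size_eq0 size_ext.
set th' := th1 N th s gs x0; have tt' : tame th' by apply: th1_tame; eassumption.
have [R1 [sup1 R1R sep]] : exists R1, [/\ supported th' R1, R <= R1 & separated th' R1 s gs].
  eexists; split; [apply: th1_supported; eassumption|exact: leq_addr|].
  eexists; last first.
    by move=> th2 tt2 e; apply: (runi_v_neq tt sup dp rx x0n gsU gs0 tt2); exact: e.
  by apply: v_red; eassumption.
exists th', (maxn R1 n); split=> //.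
- by move=> x /sup1 h; rewrite leq_max h.
- exact: leq_maxr.
- split=> [|x hx]; first by rewrite leq_max R1R.
  by apply: th1_low hx; eassumption.
move=> _; have [v rv hv] := sep; exists v => // th2 tt2 e; apply: hv => // x hx.
by apply: e; rewrite leq_max hx.
Qed.

Theorem generic_twist : exists2 th : seq L -> bool, tame th &
  forall s gs, regular gs -> exists2 v, reduced v & runi N th s gs v (size gs) <> v.
Proof.
pose P (p : (seq L -> bool) * nat) := tame p.1 /\ supported p.1 p.2.
pose Q n (p p' : (seq L -> bool) * nat) := [/\ P p', n <= p'.2,
    p.2 <= p'.2 /\ forall x, hang x < p.2 -> p'.1 x = p.1 x
    & forall s gs, unpickle n = Some (s, gs) -> regular gs -> separated p'.1 p'.2 s gs].
have step n p : exists p', P p -> Q n p p'.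
  case: (pselect (P p)) => [[h1 h2]|np]; last by exists p.
  case E: (unpickle n : option (bool * seq (seq L))) => [sgs|].
    have [th' [R' [a1 a2 a3 a4 a5]]] := generic_step n sgs h1 h2.
    by exists (th', R') => _; split=> // s gs; rewrite E => -[e]; rewrite e in a5.
  have [th' [R' [a1 a2 a3 a4 _]]] := generic_step n (true, [::]) h1 h2.
  by exists (th', R') => _; split=> // s gs; rewrite E.
pose F n p := projT1 (cid (step n p)).
pose seqp := fix seqp n := if n is n'.+1 then F n' (seqp n') else (fun=> false, 0).
have P0 : P (seqp 0) by split=> //=; split.
have FQ n : P (seqp n) -> Q n (seqp n) (seqp n.+1) := projT2 (cid (step n (seqp n))).
have Pn n : P (seqp n) by elim: n => // n /FQ[].
have Qn n := FQ n (Pn n).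
have mono n m : n <= m -> (seqp n).2 <= (seqp m).2 /\
    forall x, hang x < (seqp n).2 -> (seqp m).1 x = (seqp n).1 x.
  elim: m => [|m IH]; first by rewrite leqn0 => /eqP->.
  rewrite leq_eqVlt => /orP[/eqP->//|]; rewrite ltnS => /IH[h1 h2].
  have [_ _ [h3 h4] _] := Qn m; split=> [|x hx]; first exact: leq_trans h3.
  by rewrite h4 ?h2 // (leq_trans hx).
(* Stage [n.+1] has radius at least [n], so stage [(hang x).+2] already covers [x] and its value
   there is final. *)
pose th x := (seqp (hang x).+2).1 x.
have thE n x : hang x < (seqp n).2 -> th x = (seqp n).1 x.
  rewrite /th => hx; case: (leqP n (hang x).+2) => h.
    by have [_ h2] := mono _ _ h; exact: h2.
  have [_ h2] := mono _ _ (ltnW h); rewrite h2 //.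
  by have [_ h1 _ _] := Qn (hang x).+1.
have tth : tame th.
  split=> [x xA|m x rx]; first exact: (Pn _).1.1.
  by rewrite /th hang_act //; exact: (Pn _).1.2.
exists th => // s gs rg; have [_ _ _ /(_ s gs)] := Qn (pickle (s, gs)).
rewrite pickleK => /(_ erefl rg)[v rv hv]; exists v => //; apply: hv => // x hx.
exact: thE.
Qed.

End GenericTwist.

(** * Alternating products have no bounded orbit *)

Section Growth.
Variables (d : nat) (N : int).
Local Notation K := d.+3.
Local Notation L := 'I_d.+3.
Implicit Types (x y z v : seq L) (gs : seq (seq L)).

Lemma dist_triangle x y z : dist x z <= dist x y + dist y z.
Proof.
have := lcp_ultra x y z; have := lcp_ler x y; have := lcp_lel y z.
have := distE x y; have := distE y z; have := distE x z.
by rewrite geq_min => e1 e2 e3 h1 h2 /orP[] h; lia.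
Qed.

Let dE (x y : seq L) : dist x y + (lcp x y).*2 = size x + size y := distE x y.
Let lL (x y : seq L) : lcp x y <= size x := lcp_lel x y.
Let d0 (x : seq L) : dist [::] x = size x := dist0l x.

Variable th : seq L -> bool.
Hypothesis tth : tame th.

Lemma runi_cat s gs gs' x n : runi N th s (gs ++ gs') x (size gs + n) =
  runi N th (s (+) odd (size gs)) gs' (runi N th s gs x (size gs)) n.
Proof.
elim: n => [|n IH].
  have H m : m <= size gs -> runi N th s (gs ++ gs') x m = runi N th s gs x m.
    by elim: m => //= m IH h; rewrite IH 1?ltnW // nth_cat h.
  by rewrite addn0 /= H.
by rewrite addnS /= IH nth_cat ltnNge leq_addr /= addKn oddD addbA.
Qed.

Variables (s : bool) (G : nat).
Hypothesis NG : 3 * G < `|N|%N * K.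

Section List.
Variable gs : seq (seq L).
Hypotheses (gsU : all (fun g => ~~ inU g) gs) (gsG : all (fun g => size g <= G) gs).

Let sg i := s (+) odd i.
Let g_ i := nth [::] gs i.
Let P i := cc N th (sg i) [::].
(** The vertex that step [i] sends to the root; the length of the image of [x] is its distance to
    [back i]. *)
Let back i := cc N th (~~ sg i) (act (rev (g_ i)) [::]).
Let v_ i := runi N th s gs [::] i.

Lemma size_g i : size (g_ i) <= G.
Proof.
case: (ltnP i (size gs)) => h; last by rewrite /g_ nth_default.
exact: (allP gsG) (mem_nth _ h).
Qed.

Lemma size_gx (g : seq L) : size (act g [::] : seq L) <= size g.
Proof. by have := size_act_le g [::]; rewrite addn0. Qed.

Lemma cc_nil b : cc N th b [::] = av d ((if b then N else - N) * K%:Z)%R.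
Proof. by have := cc_av N tth b 0%R; rewrite addr0. Qed.

Lemma size_cc_nil b : size (cc N th b [::]) = `|N|%N * K.
Proof. by rewrite cc_nil size_av abszM; case: b; rewrite ?abszN. Qed.

Lemma back_red i : reduced (back i).
Proof. by rewrite cc_reduced // act_reduced. Qed.

Lemma dist_step i x : reduced x -> size (act (g_ i) (cc N th (sg i) x) : seq L) = dist (back i) x.
Proof.
move=> rx; rewrite -(dist_cc N tth (sg i)) ?back_red // /back.
have := ccK N tth (~~ sg i) (x := act (rev (g_ i)) [::]); rewrite negbK => ->; last exact: act_reduced.
rewrite -(dist_act (g_ i)) ?act_reduced ?cc_reduced //.
by rewrite actVK // d0.
Qed.

Lemma size_back i : size (back i) = size (act (g_ i) (P i) : seq L).
Proof. by rewrite dist_step // dist_sym d0. Qed.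

Lemma back_P i : (`|N|%N * K - G <= lcp (back i) (cc N th (~~ sg i) [::]))%N.
Proof.
have := dE (back i) (cc N th (~~ sg i) [::]).
rewrite size_cc_nil /back dist_cc ?act_reduced // dist_sym d0.
have := lL (back i) (cc N th (~~ sg i) [::]).
have := size_gx (rev (g_ i)); rewrite size_rev; have := size_g i; rewrite /back; lia.
Qed.

Lemma size_back_ge i : `|N|%N * K - G <= size (back i).
Proof. exact: leq_trans (back_P i) (lL _ _). Qed.

(** As the signs alternate, [back i.+1] follows the axis towards [P i] for [|N| * K - G] letters,
    whereas by [lcp_act] the image of [P i] under g_i leaves this ray after at most [G] letters. *)
Lemma lcp_back i : i < size gs -> lcp (back i.+1) (act (g_ i) (P i)) <= G.
Proof.
move=> hi; have := lcp_ultra (cc N th (~~ sg i.+1) [::]) (back i.+1) (act (g_ i) (P i)).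
rewrite lcpC; have := back_P i.+1; have -> : ~~ sg i.+1 = sg i by rewrite /sg /= addbN negbK.
rewrite -/(P i) => h1; rewrite geq_min => h2.
have h3 : lcp (P i) (act (g_ i) (P i)) <= G.
  rewrite leqNgt lcpC /P cc_nil; apply/negP => h3.
  have := (allP gsU) _ (mem_nth [::] hi); rewrite -/(g_ i); case/negP.
  by apply: (@lcp_act _ _ ((if sg i then N else - N) * K%:Z)%R); apply: leq_trans h3; rewrite ltnS (leq_trans (size_gx _)) ?size_g.
by case/orP: h2 => h2; lia.
Qed.

(** Ping-pong. The bound on the common prefix gives a gain of at least [|N| * K - 3 * G] in length.
    The new vertex then shares more than [G] letters with the image of the root under step [n], so
    [lcp_back] and ultrametricity restore the bound. *)
Lemma runi_growth n : n <= size gs -> n <= size (v_ n) /\ lcp (back n) (v_ n) <= G.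
Proof.
elim: n => [|n IH hn]; first by rewrite lcpC.
have [h1 h2] := IH (ltnW hn); have rv : reduced (v_ n) by exact: runi_reduced.
have e : size (v_ n.+1) = dist (back n) (v_ n) by rewrite -dist_step.
have h3 := size_back_ge n; have h4 := dE (back n) (v_ n).
split; first by rewrite e; lia.
have h5 : dist (act (g_ n) (P n)) (v_ n.+1) = size (v_ n).
  by rewrite /v_ /= -/(sg n) -/(g_ n) dist_act ?dist_cc ?cc_reduced // d0.
have h6 := dE (act (g_ n) (P n)) (v_ n.+1); rewrite h5 -size_back e in h6.
have := lcp_back hn; have := lcp_ultra (back n.+1) (v_ n.+1) (act (g_ n) (P n)).
by rewrite geq_min [lcp (v_ _) _]lcpC => /orP[] h7 h8; lia.
Qed.

End List.

(** Stated for the square, so as to exclude fixed vertices and exchanged pairs at once; even length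
    makes the signs of consecutive copies of [gs] fit together. *)
Theorem no_bounded_orbit gs v : regular gs -> ~~ odd (size gs) -> all (fun g => size g <= G) gs ->
  reduced v -> runi N th s gs (runi N th s gs v (size gs)) (size gs) <> v.
Proof.
case/andP=> gs0 gsU ev gsG rv; pose f x := runi N th s gs x (size gs) => e.
have fr x : reduced x -> reduced (f x) by exact: runi_reduced.
have itE n x : iter n f x = runi N th s (flatten (nseq n gs)) x (n * size gs).
  elim: n x => // n IH x; rewrite iterSr IH /= mulSn runi_cat (negPf ev) addbF //.
have fd x y : reduced x -> reduced y -> dist (f x) (f y) = dist x y.
  move=> rx ry; rewrite /f; elim: (size gs) => //= n IH.
  by rewrite dist_act ?dist_cc ?cc_reduced ?runi_reduced.
have itd n x y : reduced x -> reduced y ->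
    [/\ reduced (iter n f x), reduced (iter n f y) & dist (iter n f x) (iter n f y) = dist x y].
  move=> rx ry; elim: n => //= n [h1 h2 h3]; split; [exact: fr|exact: fr|by rewrite fd].
have fixv n : iter (n * 2) f v = v by elim: n => // n IH; rewrite mulSn iterD IH.
(* An iterate fixing [v] keeps the root within [2 * size v] of itself, while growth takes it at
   least [2 * n] away. *)
pose n := (size v).+1; have := itd (n * 2) [::] v isT rv; rewrite fixv => -[rn _ dn].
have := dist_triangle [::] v (iter (n * 2) f [::]).
rewrite [dist v _]dist_sym dn !d0 itE.
have sz : size (flatten (nseq (n * 2) gs)) = (n * 2 * size gs)%N.
  by rewrite size_flatten /shape map_nseq sumn_nseq mulnC.
have [|||h _] := @runi_growth (flatten (nseq (n * 2) gs)) _ _ (n * 2 * size gs).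
- by apply/allP => g /flattenP[l /nseqP[-> _]]; exact: (allP gsU).
- by apply/allP => g /flattenP[l /nseqP[-> _]]; exact: (allP gsG).
- by rewrite sz.
rewrite /n in h *; nia.
Qed.

End Growth.

(** * The amalgam and its action *)

Section Models.
Variable d : nat.
Local Notation K := d.+3.
Local Notation L := 'I_d.+3.
Implicit Types (a : L) (g : seq L) (p h : seq (bool * seq L)).

Section Eval.
Variables (Z : Type) (rho : bool -> L -> Z -> Z).

Definition evf b g z := foldr (rho b) z g.
Definition evp p z := foldr (fun q => evf q.1 q.2) z p.

(* An action on [Z] of the amalgam of two copies of W along u. *)
Definition model := (forall b a, involutive (rho b a)) /\
  forall z, evf false (av d K%:Z) z = evf true (av d K%:Z) z.

Lemma evf_cat b g g' z : evf b (g ++ g') z = evf b g (evf b g' z).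
Proof. exact: foldr_cat. Qed.

Lemma evp_cat p p' z : evp (p ++ p') z = evp p (evp p' z).
Proof. exact: foldr_cat. Qed.

Hypothesis mod : model.

Lemma evf_rev b g : cancel (evf b g) (evf b (rev g)).
Proof.
move=> z; elim: g z => //= a g IH z.
by rewrite rev_cons -cats1 evf_cat /= mod.1 IH.
Qed.

Lemma evf_revV b g : cancel (evf b (rev g)) (evf b g).
Proof. by move=> z; rewrite -{1}[g]revK evf_rev. Qed.

Lemma evf_act b g z : evf b (act g [::]) z = evf b g z.
Proof.
elim: g => //= a g <-; case: (act g [::]) => //= a' x.
by case: eqVneq => //= ->; rewrite mod.1.
Qed.

Lemma evf_upow m z : evf false (av d (m * K%:Z)%R) z = evf true (av d (m * K%:Z)%R) z.
Proof.
have nat_case n z' : evf false (av d (n%:Z * K%:Z)%R) z' = evf true (av d (n%:Z * K%:Z)%R) z'.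
  elim: n z' => [|n IH] z'; first by rewrite mul0r.
  have e : av d (n.+1%:Z * K%:Z)%R = act (av d K%:Z ++ av d (n%:Z * K%:Z)%R) [::].
    rewrite act_cat (act_nil (av_reduced _ _)).
    by have := act_av d 1 (n%:Z * K%:Z)%R; rewrite mul1r => ->; congr (av d _); lia.
  by rewrite e !evf_act !evf_cat IH mod.2.
case: m => n; first exact: nat_case.
rewrite NegzE -rev_av; set g := av _ _.
by apply: (can_inj (evf_rev false g)); rewrite evf_revV nat_case evf_revV.
Qed.

Lemma evf_inU g b z : inU g -> evf b g z = evf (~~ b) g z.
Proof.
by move=> /inUP[m e]; rewrite -evf_act -[RHS]evf_act e; case: b; rewrite evf_upow.
Qed.

Lemma evp_inj p : injective (evp p).
Proof.
elim: p => [|q p IH] z z' //= /(can_inj (evf_rev _ _)); exact: IH.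
Qed.

Lemma evp_surj p z : exists z', evp p z' = z.
Proof.
elim: p z => [|q p IH] z; first by exists z.
by have [z' e] := IH (evf q.1 (rev q.2) z); exists z'; rewrite /= e evf_revV.
Qed.

End Eval.

Definition alternating p := sorted (fun q q' => q.1 != q'.1) p.

(** Cyclically reduced words: the powers of an alternating word of even length are again
    alternating. *)
Definition normal p := size p <= 1 \/
  [/\ alternating p, all (fun q => ~~ inU q.2) p, ~~ odd (size p) & 0 < size p].

(** Conjugacy in the amalgam, expressed through all its actions by one and the same [h]. *)
Definition conjugate p p' := exists h, forall Z (rho : bool -> L -> Z -> Z), model rho ->
  forall z, evp rho p (evp rho h z) = evp rho h (evp rho p' z).

Lemma conjugate_trans p p' p'' : conjugate p p' -> conjugate p' p'' -> conjugate p p''.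
Proof.
move=> [h e] [h' e']; exists (h ++ h') => Z rho mod z.
by rewrite !evp_cat e // e'.
Qed.

Lemma conjugate_eq p p' : (forall Z (rho : bool -> L -> Z -> Z), model rho ->
  forall z, evp rho p z = evp rho p' z) -> conjugate p p'.
Proof. by move=> e; exists [::] => Z rho mod z; rewrite /= e. Qed.

Lemma not_alternating p : ~~ alternating p ->
  exists p1 q q' p2, p = p1 ++ q :: q' :: p2 /\ q.1 = q'.1.
Proof.
elim: p => //= q [|q' p] //= IH; case: eqVneq => [e _|_ /IH]; first by exists [::], q, q', p.
by move=> [p1 [r [r' [p2 [-> e]]]]]; exists (q :: p1), r, r', p2.
Qed.

(** Every defect is turned into two neighbouring syllables of one factor, whose merging shortens the
    word: a syllable in the group of [u] may change factor, and an odd alternating word is rotated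
    until its two ends, which lie in the same factor, meet. *)
Lemma normal_form p : exists2 p', conjugate p p' & normal p'.
Proof.
have [n] := ubnP (size p); elim: n p => // n IH p sp.
have merge p' : conjugate p p' -> size p' = size p -> ~~ alternating p' ->
    exists2 p'', conjugate p p'' & normal p''.
  move=> c s' /not_alternating[p1 [q [q' [p2 [e eq]]]]].
  have [|p'' c' nf] := IH (p1 ++ (q.1, q.2 ++ q'.2) :: p2).
    by move: sp; rewrite -s' e !size_cat /= !addnS.
  exists p'' => //; apply: (conjugate_trans c); apply: conjugate_trans c'.
  by apply: conjugate_eq => Z rho mod z; rewrite e !evp_cat /= eq evf_cat.
case: (leqP (size p) 1) => [s1|s2]; first by exists p; [exact: conjugate_eq|left].
case: (boolP (alternating p)) => [al|]; last by apply: merge => //; exact: conjugate_eq.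
case: (boolP (all (fun q => ~~ inU q.2) p)) => [aU|/allPn[q qp /negPn qU]].
  case: (boolP (odd (size p))) => [od|ev]; last first.
    by exists p; [exact: conjugate_eq|right; split=> //; lia].
  case: p {IH sp aU} al s2 od merge => //= q p al s2 od /(_ (p ++ [:: q])); apply.
  - by exists [:: q] => Z rho mod z; rewrite evp_cat.
  - by rewrite size_cat addn1.
  case: p al s2 od => // q' p /= /andP[e al] _ od; rewrite cat_path /= andbT.
  rewrite negb_and; apply/orP; right; rewrite negbK.
  suff -> : (last q' p).1 = q'.1 (+) odd (size p).
    by move: e od; case: (odd _) => //=; case: q.1; case: q'.1.
  elim: p q' al {e od} => [|r p IHp] q' /=; first by rewrite addbF.
  by case/andP=> h /IHp ->; move: h; case: (odd _); case: q'.1; case: r.1.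
case/splitPr: qp al s2 merge => p1 p2 al s2 /(_ (p1 ++ (~~ q.1, q.2) :: p2)); apply.
- apply: conjugate_eq => Z rho mod z; rewrite !evp_cat /=; congr (evp _ _ _).
  exact: evf_inU.
- by rewrite !size_cat.
move: al s2; case: p2 => [|r p2]; last first.
  move=> /cat_sorted2[_ /= /andP[h _]] _; apply/negP => /cat_sorted2[_ /= /andP[h' _]].
  by move: h h'; case: q.1; case: r.1.
case/lastP: p1 => // p1 l; rewrite /alternating cat_rcons => /cat_sorted2[_ /=].
rewrite andbT => h _; apply/negP; rewrite cat_rcons => /cat_sorted2[_ /=].
by move: h; case: l.1; case: q.1.
Qed.

End Models.

(** * The Cayley tree as a simplicial tree *)

Section Tree.
Variable d : nat.
Local Notation K := d.+3.
Local Notation L := 'I_d.+3.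

Definition vtx := {x : seq L | reduced x}.
Definition vadj (u v : vtx) := dist (val u) (val v) == 1.

Lemma vadj_sym : symmetric vadj.
Proof. by move=> u v; rewrite /vadj dist_sym. Qed.

Lemma vadj_irr : irreflexive vadj.
Proof. by move=> u; rewrite /vadj (eqP (_ : dist (val u) (val u) == 0)) ?dist_eq0. Qed.

Lemma dist_down (x y : seq L) : dist x y = 1 -> size y <= size x -> y = take (size x).-1 x.
Proof.
move=> h1 h2; have := distE x y; have hr := lcp_ler x y; rewrite h1 => e.
have arith n m k : 1 + k.*2 = n + m -> m <= n -> k <= m -> m <= k /\ n.-1 = m by lia.
have [ly sy] := arith _ _ _ e h2 hr.
by move: ly; rewrite lcp_geP sy => /and3P[_ _ /eqP->]; rewrite take_size.
Qed.

Definition root : vtx := exist _ [::] isT.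

Lemma parent_path (u : vtx) : exists2 p, path vadj u p & last u p = root.
Proof.
case: u => x; elim/last_ind: x => [|x a IH] r; first by exists [::] => //; exact: val_inj.
have rx : reduced x by move: r; rewrite reduced_rcons => /andP[].
have [p h1 h2] := IH rx; exists (exist _ x rx :: p) => //=; rewrite h1 andbT.
rewrite /vadj /= /dist size_rcons; have -> : lcp (rcons x a) x = size x.
  apply/eqP; rewrite eqn_leq lcp_ler /= lcp_geP size_rcons leqnSn leqnn /=.
  by rewrite -cats1 take_size_cat // take_size.
by rewrite -addnn addSn subSnn.
Qed.

Lemma path_sym (u : vtx) p : path vadj u p -> exists2 q, path vadj (last u p) q & last (last u p) q = u.
Proof.
elim: p u => [|v p IH] u /=; first by exists [::].
case/andP=> h /IH[q h1 h2]; exists (rcons q u); last by rewrite last_rcons.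
by rewrite rcons_path h1 h2 vadj_sym.
Qed.

Lemma vtx_connected (u v : vtx) : exists2 p, path vadj u p & last u p = v.
Proof.
have [p h1 h2] := parent_path u; have [q h3 h4] := parent_path v.
have [q' h5 h6] := path_sym h3; rewrite h4 in h5 h6.
by exists (p ++ q'); rewrite ?cat_path ?last_cat ?h1 h2.
Qed.

(** Both neighbours of a longest vertex of a cycle would be its parent. *)
Lemma vtx_acyclic (c : seq vtx) : 2 < size c -> ~ ucycle vadj c.
Proof.
move=> sc uc; have [x xc xmax] : exists2 x, x \in c & forall y, y \in c -> size (val y) <= size (val x).
  case: c sc {uc} => // a c _; elim: c a => [|b c IH] a.
    by exists a; rewrite ?mem_head // => y; rewrite inE => /eqP->.
  have [x xc xm] := IH b; case: (leqP (size (val x)) (size (val a))) => h.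
    exists a; first exact: mem_head.
    by move=> y; rewrite inE => /orP[/eqP->//|/xm h']; apply: leq_trans h.
  exists x; first by rewrite inE xc orbT.
  by move=> y; rewrite inE => /orP[/eqP->|/xm //]; exact: ltnW.
have [i p e] := rot_to xc; have uc' : ucycle vadj (x :: p) by rewrite -e rot_ucycle.
have sp : 1 < size p by move: sc; rewrite -(size_rot i) e.
have pm y : y \in p -> size (val y) <= size (val x).
  by move=> yp; apply: xmax; rewrite -(mem_rot i) e inE yp orbT.
case: p sp pm uc' {e} => // y; case/lastP => // p z _ pm /andP[].
rewrite -rcons_cons /= !rcons_path last_rcons => /and3P[h1 _ /eqP h2] /and3P[_ yz _].
have e1 : val y = take (size (val x)).-1 (val x).
  by apply: dist_down; [exact/eqP|rewrite pm ?mem_head].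
have e2 : val z = take (size (val x)).-1 (val x).
  by apply: dist_down; [rewrite dist_sym|rewrite pm // !inE mem_rcons mem_head orbT].
by move: yz; rewrite mem_rcons inE (val_inj (etrans e1 (esym e2))) eqxx.
Qed.

Definition word_tree : simplicial_tree :=
  SimplicialTree vadj_sym vadj_irr (inhabits root) vtx_connected vtx_acyclic.

Lemma vadj_cases (u v : vtx) : vadj u v ->
  val v \in take (size (val u)).-1 (val u) :: [seq rcons (val u) a | a <- enum L].
Proof.
move/eqP=> h; rewrite inE; case: (leqP (size (val v)) (size (val u))) => hs.
  by rewrite (dist_down h hs) eqxx.
have := dist_down (etrans (dist_sym _ _) h) (ltnW hs).
move: hs; case: v h => v rv /=; case/lastP: v rv => // v a rv h _.
rewrite size_rcons -cats1 take_size_cat // => ->; apply/orP; right.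
by rewrite cats1; apply/mapP; exists a; rewrite ?mem_enum.
Qed.

Lemma word_tree_locally_finite : locally_finite word_tree.
Proof.
move=> u /=.
pose s := take (size (val u)).-1 (val u) :: [seq rcons (val u) a | a <- enum L].
apply: (sub_finite_set (B := [set` pmap insub s])) => [v /= /vadj_cases h|]; last exact: finite_seq.
by have : v \in pmap insub s by rewrite mem_pmap_sub.
Qed.

End Tree.

(** * The action of the amalgam on the tree *)

Section TreeModel.
Variable d : nat.
Local Notation K := d.+3.
Local Notation L := 'I_d.+3.
Local Notation vtx := (vtx d).
Implicit Types (u v w : vtx) (x y : seq L) (g : seq L) (p : seq (bool * seq L)).

Local Arguments cc : simpl never.

Definition vact g v : vtx := exist _ (act g (val v)) (act_reduced g (valP v)).

Lemma odd_size_lact (a : L) x : odd (size (lact a x)) = ~~ odd (size x).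
Proof. by case: x => //= b x; case: ifP => //= _; rewrite negbK. Qed.

Lemma odd_size_act g x : odd (size (act g x)) = odd (size g) (+) odd (size x).
Proof. by elim: g => //= a g IH; rewrite odd_size_lact IH addNb. Qed.

Lemma odd_vadj u v : vadj u v -> odd (size (val u)) = ~~ odd (size (val v)).
Proof.
move=> /eqP h; have := distE (val u) (val v); rewrite h => /(congr1 odd).
by rewrite !oddD odd_double addbF /=; case: (odd _); case: (odd _).
Qed.

Lemma even_invariant (W : set (word_tree d)) : is_subtree W ->
  (forall a v, W v -> W (vact [:: a; ord0] v)) -> (forall a v, W v -> W (vact [:: ord0; a] v)) ->
  W = setT.
Proof.
move=> [[v0 Wv0] conn] h1 h2.
have E n (g : seq L) v : size g = n.*2 -> W v -> W (vact g v).
  elim: n g v => [|n IH] [|a [|b g]] // v; first by move=> _ Wv; congr (W _): Wv; exact: val_inj.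
  rewrite doubleS => -[sg] Wv; have := h1 a _ (h2 b _ (IH g v sg Wv)).
  congr (W _); apply: val_inj => /=.
  by rewrite (lactK ord0) // lact_reduced // act_reduced // (valP v).
have sub v w : W v -> odd (size (val w)) = odd (size (val v)) -> W w.
  move=> Wv e; have /E/(_ Wv) : size (val w ++ rev (val v)) = (size (val w ++ rev (val v)))./2.*2.
    by rewrite -[LHS]odd_double_half size_cat size_rev oddD e addbb add0n.
  congr (W _); apply: val_inj; rewrite /= act_cat.
  have rv := valP v; have rw := valP w; rewrite -{2}(act_nil rv) actKV //= act_nil //.
(* An even word moves [v0] inside [W] by freeness, and the first step of the path in [W] to its
   image changes the parity. *)
have [w [Ww hw]] : exists w, W w /\ odd (size (val w)) <> odd (size (val v0)).
  pose w := vact [:: ord0; ord_max] v0; have Ww : W w by exact: h2.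
  have [p [pp lp hp]] := conn _ _ Wv0 Ww; case: p pp lp hp => [_ e _|a p /= /andP[ha _] _ hp].
    have e2 : act [:: ord0; ord_max] (val v0) = val v0 := esym (congr1 val e).
    by have := act_free (valP v0) e2.
  exists a; split; first by apply: hp; rewrite mem_head.
  by rewrite (odd_vadj ha); case: (odd _).
apply/seteqP; split=> // v _.
case: (eqVneq (odd (size (val v))) (odd (size (val v0)))) => [e|e]; first exact: sub e.
by apply: (sub w) => //; move: e hw; case: (odd _); case: (odd _); case: (odd _).
Qed.

Variable N : int.
Variable th : seq L -> bool.
Hypothesis tth : tame th.

Definition cv s v : vtx := exist _ (cc N th s (val v)) (cc_reduced N tth s (valP v)).

Definition tree_rho (b : bool) (a : L) v : vtx :=
  if b then cv true (vact [:: a] (cv false v)) else vact [:: a] v.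

Lemma cvK s : cancel (cv s) (cv (~~ s)).
Proof. by move=> v; apply: val_inj; exact: (ccK N tth s (valP v)). Qed.

Lemma evf_tree b g v : evf tree_rho b g v = if b then cv true (vact g (cv false v)) else vact g v.
Proof.
have v0 w : vact [::] w = w by exact: val_inj.
have vS a g' w : vact [:: a] (vact g' w) = vact (a :: g') w by exact: val_inj.
elim: g => [|a g IH]; first by case: b; rewrite v0 // (cvK false).
rewrite [LHS]/= IH /tree_rho; case: b {IH}; last exact: vS.
by rewrite (cvK true) vS.
Qed.

Lemma tree_model : model tree_rho.
Proof.
have vinv a w : vact [:: a] (vact [:: a] w) = w.
  by apply: val_inj; exact: (lactK a (valP w)).
split=> [[] a v|v]; rewrite ?/tree_rho ?vinv //.
  by rewrite (cvK true) vinv (cvK false).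
rewrite !evf_tree -[Posz K]mul1r; apply: val_inj.
rewrite -[RHS]/(cc N th true (act (av d (1 * Posz K)%R) (cc N th false (val v)))).
by rewrite -(cc_act N tth false 1 (valP v)) (ccK N tth false) // act_reduced // (valP v).
Qed.

Lemma vadj_cv s u v : vadj (cv s u) (cv s v) = vadj u v.
Proof. by rewrite /vadj (dist_cc N tth s (valP u) (valP v)). Qed.

Lemma vadj_vact g u v : vadj (vact g u) (vact g v) = vadj u v.
Proof. by rewrite /vadj (dist_act g (valP u) (valP v)). Qed.

Lemma tree_rho_adj b a u v : vadj (tree_rho b a u) (tree_rho b a v) = vadj u v.
Proof. by case: b; rewrite /tree_rho ?vadj_cv vadj_vact ?vadj_cv. Qed.

Lemma evp_adj p u v : vadj (evp tree_rho p u) (evp tree_rho p v) = vadj u v.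
Proof.
elim: p => //= q p IH; rewrite -IH; move: (evp _ _ u) (evp _ _ v).
by elim: (q.2) => //= a g IHg u' v'; rewrite tree_rho_adj IHg.
Qed.

Lemma runi_rcons s gs g x : runi N th s (rcons gs g) x (size gs).+1 =
  act g (cc N th (s (+) odd (size gs)) (runi N th s gs x (size gs))).
Proof. by have := runi_cat N th s gs [:: g] x 1; rewrite cats1 addn1 /= addbF. Qed.

(** Reversed because the last syllable acts first, whereas [runi] begins with the head of its
    list. *)
Definition syllables p := rev [seq r.2 | r <- p].

Lemma last_alternating q p : alternating (q :: p) -> (last q p).1 = q.1 (+) odd (size p).
Proof.
rewrite /alternating /=; elim: p q => [|r p IHp] q /=; first by rewrite addbF.
by case/andP=> h /IHp ->; move: h; case: (odd _); case: q.1; case: r.1.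
Qed.

(* An alternating word of syllables acts, up to powers of c at both ends, as the
   walk [runi]. *)
Lemma evp_runi q p v : alternating (q :: p) ->
  val (evp tree_rho (q :: p) v) =
    (if q.1 then cc N th true else id)
      (runi N th (~~ (last q p).1) (syllables (q :: p)) (val (if (last q p).1 then v else cv false v))
         (size p).+1).
Proof.
elim: p q => [|r p IH] q al.
  case: q {al} => b g; have -> : evp tree_rho [:: (b, g)] v = evf tree_rho b g v by [].
  rewrite evf_tree; case: b => //=.
  by rewrite (ccK N tth false) //; exact: (valP v).
have al' : alternating (r :: p) by case/andP: al.
have qr : q.1 != r.1 by case/andP: al.
have e := IH r al'; set gs := syllables (r :: p) in e *.
have -> : syllables (q :: r :: p) = rcons gs q.2 by rewrite /syllables map_cons rev_cons.
have sz : (size p).+1 = size gs by rewrite size_rev size_map.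
rewrite [last q _]/= [size (r :: p)]/= sz in e *; rewrite runi_rcons -sz.
have -> : ~~ (last r p).1 (+) odd (size p).+1 = r.1.
  by rewrite (last_alternating al') /=; case: r.1; case: (odd _).
rewrite sz; move: e; set y := runi _ _ _ _ _ _; set X := evp _ (r :: p) v => e.
rewrite -[evp _ _ v]/(evf tree_rho q.1 q.2 X) evf_tree.
by move: qr e; case: q.1; case: r.1 => //= _ ->.
Qed.

End TreeModel.

(** * Words of the amalgam without fixed points *)

Section Amalgam.
Variable d : nat.
Local Notation K := d.+3.
Local Notation L := 'I_d.+3.
Local Notation vtx := (vtx d).
Implicit Types (u v w : vtx) (p : seq (bool * seq L)).

Definition trivial_word p := forall Z (rho : bool -> L -> Z -> Z), model rho -> forall z, evp rho p z = z.
Definition parity p := odd (sumn [seq size q.2 | q <- p]).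

(** Parity is itself a model: each letter acts on [bool] by negation. *)
Lemma parity_conjugate p p' : conjugate p p' -> parity p = parity p'.
Proof.
have E r b : evp (fun _ (_ : L) => negb) r b = b (+) parity r.
  elim: r => [|q r IH]; first by rewrite addbF.
  rewrite [LHS]/= IH /parity /= oddD; elim: q.2 => //= a g ->; by case: (odd _); case: (odd _); case: b {IH}.
case=> h H; have := H bool (fun _ _ => negb) _ false; rewrite !E => H'.
have -> : parity p = parity h (+) (parity h (+) parity p) by case: (parity h); case: (parity p).
have m : model (fun (_ : bool) (_ : L) => negb) by split=> // b a z; rewrite negbK.
by have := H' m; rewrite /=; case: (parity h); case: (parity p); case: (parity p').
Qed.

Lemma trivial_conjugate p p' : conjugate p p' -> trivial_word p' -> trivial_word p.
Proof.
move=> [h e] t Z rho mod z; have [z' <-] := evp_surj mod h z.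
by rewrite e // t.
Qed.

Lemma trivial_small p : size p <= 1 -> ~ trivial_word p -> exists b g, p = [:: (b, g)] /\ act g [::] <> [::].
Proof.
case: p => [_ nt|[b g] [|//] _ nt]; first by exfalso; apply: nt.
exists b, g; split=> // e; apply: nt => Z rho mod z.
by have := evf_act mod b g z; rewrite e => h; exact: esym h.
Qed.

Section TheModel.
Variables (N : int) (th : seq L -> bool).
Hypothesis tth : tame th.
Local Notation rho := (tree_rho N tth).

(** Each factor acts freely on vertices, the second as a conjugate of the first, and even words
    respect the colouring of the vertices by parity of length, which adjacent vertices do not
    share. *)
Lemma small_fixpoint b g u v : ~~ odd (size g) -> act g [::] <> [::] -> u = v \/ vadj u v ->
  evp rho [:: (b, g)] u = v -> evp rho [:: (b, g)] v <> u.
Proof.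
move=> ev ng uv; have H (x y : vtx) : x = y \/ vadj x y -> vact g x = y -> vact g y <> x.
  move=> [<-|xy] e1 e2; first by apply: ng; apply: (act_free (valP x)); exact: (congr1 val e1).
  have := odd_vadj xy; rewrite -(congr1 val e1) /= odd_size_act (negPf ev) /=.
  by case: (odd _).
have E x : evp rho [:: (b, g)] x = if b then cv N tth true (vact g (cv N tth false x)) else vact g x.
  by rewrite -evf_tree.
rewrite !E; case: b {E}; last exact: H.
move=> e1 e2; apply: (H (cv N tth false u) (cv N tth false v)).
- by case: uv => [->|uv]; [left|right; rewrite vadj_cv].
- by rewrite -e1 (cvK N tth true).
- by rewrite -e2 (cvK N tth true).
Qed.

Lemma normal_regular q p : normal (q :: p) -> 0 < size p ->
  [/\ regular (syllables (q :: p)), ~~ odd (size (syllables (q :: p))) & (last q p).1 = ~~ q.1].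
Proof.
case=> [|[al aU od _]] sp; first by case: p sp.
have sz : size (syllables (q :: p)) = size (q :: p) by rewrite size_rev size_map.
rewrite sz /regular sz all_rev all_map aU; split=> //.
by rewrite (last_alternating al); move: od => /=; case: (odd _); case: q.1.
Qed.

(** For a word whose end syllables lie in different factors, this change of base point absorbs the
    powers of c at both ends and leaves a plain walk. *)
Definition base (b : bool) v := if b then cv N tth false v else v.

Lemma base_surj b x : reduced x -> exists v, val (base b v) = x.
Proof.
move=> rx; pose w : vtx := exist _ x rx.
by case: b; [exists (cv N tth true w); rewrite /base (cvK N tth true)|exists w].
Qed.

Lemma evp_base q p v : normal (q :: p) -> 0 < size p ->
  val (base q.1 (evp rho (q :: p) v)) =
  runi N th q.1 (syllables (q :: p)) (val (base q.1 v)) (size (syllables (q :: p))).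
Proof.
move=> nf sp; have [rg od el] := normal_regular nf sp.
have al : alternating (q :: p) by case: nf => [|[]] //; case: p sp {rg od el}.
have sz : size (syllables (q :: p)) = (size p).+1 by rewrite size_rev size_map.
have := evp_runi N tth v al; rewrite el negbK sz; case: q.1 => // e.
have rr := runi_reduced N true (syllables (q :: p)) (size p).+1 tth (valP (cv N tth false v)).
rewrite -[LHS]/(cc N th false (val (evp rho (q :: p) v))) e.
exact: (ccK N tth true rr).
Qed.

Lemma normal_nontrivial q p : normal (q :: p) -> 0 < size p ->
  (forall s gs, regular gs -> exists2 v, reduced v & runi N th s gs v (size gs) <> v) ->
  exists v, evp rho (q :: p) v <> v.
Proof.
move=> nf sp gen; have [rg _ _] := normal_regular nf sp.
have [x rx ne] := gen q.1 _ rg; have [v e] := base_surj q.1 rx.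
by exists v => e'; apply: ne; rewrite -e -evp_base // e'.
Qed.

Lemma normal_fixpoint G q p u v : normal (q :: p) -> 0 < size p -> 3 * G < `|N|%N * K ->
  all (fun r => size r.2 <= G) (q :: p) -> evp rho (q :: p) u = v -> evp rho (q :: p) v <> u.
Proof.
move=> nf sp NG hG e1 e2; have [rg od _] := normal_regular nf sp.
have gG : all (fun g => size g <= G) (syllables (q :: p)) by rewrite all_rev all_map.
apply: (no_bounded_orbit tth NG rg od gG (s := q.1) (valP (base q.1 u))).
by rewrite -!evp_base // e1 e2.
Qed.

End TheModel.

(** The last clause excludes fixed vertices ([u = v]) and inverted edges together. The words [ps]
    enter the construction only through the size of [N]. *)
Theorem amalgam_action (ps : seq (seq (bool * seq L))) : exists rho : bool -> L -> vtx -> vtx,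
  [/\ model rho,
      forall b a u v, vadj (rho b a u) (rho b a v) = vadj u v,
      forall a v, rho false a v = vact [:: a] v,
      forall p, ~~ parity p -> (forall v, evp rho p v = v) -> trivial_word p
    & forall p, p \in ps -> ~~ parity p -> ~ trivial_word p ->
      forall u v, u = v \/ vadj u v -> evp rho p u = v -> evp rho p v <> u].
Proof.
pose nf p := projT1 (cid2 (normal_form p)).
have nf1 p : conjugate p (nf p) by rewrite /nf; case: cid2.
have nf2 p : normal (nf p) by rewrite /nf; case: cid2.
pose G := \sum_(p <- ps) \sum_(q <- nf p) size q.2.
have hG p : p \in ps -> all (fun q => size q.2 <= G) (nf p).
  move=> pin; apply/allP => q qin; rewrite /G (big_rem p) //= (big_rem q) //=.
  by rewrite -addnA leq_addr.
pose N : int := Posz (3 * G).+1.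
have NG : 3 * G < `|N|%N * K by rewrite absz_nat; apply: leq_trans (leq_pmulr _ _).
have [th tth gen] := generic_twist d N.
exists (tree_rho N tth); have mod := tree_model N tth; split=> //.
- exact: tree_rho_adj.
- move=> p ep fx; apply: (trivial_conjugate (nf1 p)).
  have [h hE] := nf1 p.
  have fx' v : evp (tree_rho N tth) (nf p) v = v.
    by apply: (evp_inj mod (p := h)); rewrite -hE.
  have := nf2 p; rewrite (parity_conjugate (nf1 p)) in ep.
  case E: (nf p) => [|q p'] nfp; first by [].
  case: (posnP (size p')) => [s0|sp].
    apply: contrapT => /trivial_small[|b [g [e ng]]]; first by rewrite /= s0.
    rewrite -E in e; rewrite e in ep fx'; move: ep; rewrite /parity /= addn0 => ep.
    exact: (@small_fixpoint N th tth b g (root d) (root d) ep ng (or_introl erefl) (fx' _) (fx' _)).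
  have [v] := normal_nontrivial tth nfp sp gen.
  by case; rewrite -E fx'.
move=> p pin ep nt u v uv e1 e2; have [h hE] := nf1 p.
have [u' eu] := evp_surj mod h u; have [v' ev] := evp_surj mod h v.
have e1' : evp (tree_rho N tth) (nf p) u' = v' by apply: (evp_inj mod (p := h)); rewrite -hE // eu ev.
have e2' : evp (tree_rho N tth) (nf p) v' = u' by apply: (evp_inj mod (p := h)); rewrite -hE // eu ev.
have uv' : u' = v' \/ vadj u' v'.
  case: uv => uv; last by right; rewrite -(evp_adj N tth h) eu ev.
  by left; apply: (evp_inj mod (p := h)); rewrite eu ev.
have nt' : ~ trivial_word (nf p) by move=> t; apply: nt; exact: trivial_conjugate (nf1 p) t.
rewrite (parity_conjugate (nf1 p)) in ep; have := nf2 p; have := hG p pin.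
case E: (nf p) => [|q p'] hGp nfp; first by apply: nt'; rewrite E.
rewrite E in e1' e2' nt'; case: (posnP (size p')) => [s0|sp].
  have [|b [g [e ng]]] := trivial_small _ nt'; first by rewrite /= s0.
  rewrite E e in ep; rewrite e in e1' e2'; move: ep; rewrite /parity /= addn0 => ep.
  exact: (small_fixpoint ep ng uv' e1' e2').
exact: (normal_fixpoint nfp sp NG hGp e1' e2').
Qed.

End Amalgam.

Ltac group_nf :=
  rewrite ?(invgM, invgK, invg1, mul1g, mulg1, =^~ mulgA, mulKg, mulKVg, mulVg, mulgV).

(** * Surface groups as even words of the amalgam *)

Section Nielsen.
Local Open Scope group_scope.
Implicit Types (G H : groupType).

Definition gprod G (x : seq G) : G := foldr mulg 1 x.
Definition comm_prod G (l : seq (G * G)) : G :=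
  foldr (fun p z => p.1 * p.2 * p.1^-1 * p.2^-1 * z) 1 l.
Definition inv_seq G (x : seq G) := [seq y^-1 | y <- x].
(** The relator of a polygon whose opposite sides are identified; its central symmetry, which
    inverts all letters, is the hyperelliptic involution. *)
Definition opp_prod G (x : seq G) : G := gprod x * gprod (inv_seq x).

(* One handle is split off the relation x1 x2 P x1^-1 x2^-1 P' (P' the product
   of the inverses of the letters of P): it equals [a, b] times the same kind of
   relation on the conjugated inverses of P. *)
Fixpoint niel G n (x : seq G) : seq (G * G) :=
  if n is n'.+1 then
    if x is x1 :: x2 :: s then
      let p := gprod s in let q := gprod (inv_seq s) in
      let y := x2 * p in let k := q^-1 * y in
      (k * y^-1 * k^-1, k * (q * x1) * k^-1) :: niel n' [seq k * z^-1 * k^-1 | z <- s]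
    else [::]
  else [::].

(** Inverse of [niel]: in its notation the product of the tail is k q k^-1 and the inverse of the
    first entry is k q, whence the formula for [k]. *)
Fixpoint lein G n (l : seq (G * G)) : seq G :=
  if n is n'.+1 then
    if l is ab :: l' then
      let s' := lein n' l' in let k := (gprod s')^-1 * ab.1^-1 in
      let s := [seq k^-1 * z^-1 * k | z <- s'] in
      let p := gprod s in let q := gprod (inv_seq s) in
      (q^-1 * (k^-1 * ab.2 * k)) :: (k^-1 * ab.1^-1 * k * p^-1) :: s
    else [::]
  else [::].

Lemma gprod_cat G (x y : seq G) : gprod (x ++ y) = gprod x * gprod y.
Proof. by elim: x => [|a x IH] /=; rewrite ?mul1g // IH mulgA. Qed.

Lemma gprod_conj G (k : G) (s : seq G) : gprod [seq k * z * k^-1 | z <- s] = k * gprod s * k^-1.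
Proof. by elim: s => [|a s IH] /=; rewrite ?mulg1 ?mulgV // IH !mulgA mulgKV. Qed.

Lemma gprod_conjV G (k : G) (s : seq G) :
  gprod [seq k * z^-1 * k^-1 | z <- s] = k * gprod (inv_seq s) * k^-1.
Proof. by rewrite -gprod_conj /inv_seq -map_comp. Qed.

Lemma inv_conjV G (k : G) (s : seq G) :
  inv_seq [seq k * z^-1 * k^-1 | z <- s] = [seq k * z * k^-1 | z <- s].
Proof. by rewrite /inv_seq -map_comp; apply: eq_map => z /=; rewrite !invgM !invgK mulgA. Qed.

Lemma size_niel G n (x : seq G) : size x = n.*2 -> size (niel n x) = n.
Proof. by elim: n x => // n IH [|x1 [|x2 s]] //= [sz]; rewrite IH // size_map. Qed.

Lemma size_lein G n (l : seq (G * G)) : size l = n -> size (lein n l) = n.*2.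
Proof. by elim: n l => // n IH [|ab l] //= [sz]; rewrite size_map IH. Qed.

Lemma niel_prod G n (x : seq G) : size x = n.*2 -> comm_prod (niel n x) = opp_prod x.
Proof.
elim: n x => [|n IH] [|x1 [|x2 s]] //=; first by rewrite /opp_prod /= mulg1.
case=> sz; rewrite IH ?size_map // /opp_prod inv_conjV gprod_conj gprod_conjV /=.
set p := gprod s; set q := gprod (inv_seq s); set y := x2 * p; set k := q^-1 * y.
by rewrite /k /y; clearbody p q; group_nf.
Qed.

Lemma niel_lein G n (l : seq (G * G)) : size l = n -> niel n (lein n l) = l.
Proof.
elim: n l => [|n IH] [|[a b] l] //= [sz].
set s' := lein n l; set k := (gprod s')^-1 * a^-1.
have e1 : gprod [seq k^-1 * z^-1 * k | z <- s'] = k^-1 * gprod (inv_seq s') * k.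
  by have := gprod_conjV k^-1 s'; rewrite invgK.
have e2 : inv_seq [seq k^-1 * z^-1 * k | z <- s'] = [seq k^-1 * z * k | z <- s'].
  by rewrite /inv_seq -map_comp; apply: eq_map => z /=; group_nf.
have e3 : gprod [seq k^-1 * z * k | z <- s'] = k^-1 * gprod s' * k.
  by have := gprod_conj k^-1 s'; rewrite invgK.
have gs' : gprod s' = a^-1 * k^-1 by rewrite /k; group_nf.
rewrite e1 e2 e3 gs'; clearbody k; move: (gprod (inv_seq s')) => r.
have ek : (k^-1 * (a^-1 * k^-1) * k)^-1 * (k^-1 * a^-1 * k * (k^-1 * r * k)^-1 * (k^-1 * r * k)) = k.
  by group_nf.
rewrite ek; congr ((_, _) :: _); [by group_nf|by group_nf|].
by rewrite -map_comp (eq_map (g := id)) ?map_id ?IH // => z /=; group_nf.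
Qed.

Lemma lein_niel G n (x : seq G) : size x = n.*2 -> lein n (niel n x) = x.
Proof.
elim: n x => [|n IH] [|x1 [|x2 s]] //= [sz].
rewrite IH ?size_map // gprod_conjV.
set p := gprod s; set q := gprod (inv_seq s); set k := q^-1 * (x2 * p).
have ek : (k * q * k^-1)^-1 * (k * (x2 * p)^-1 * k^-1)^-1 = k.
  have -> : x2 * p = q * k by rewrite /k; group_nf.
  by clearbody k; group_nf.
rewrite ek; have es : [seq k^-1 * z^-1 * k | z <- [seq k * z^-1 * k^-1 | z <- s]] = s.
  by clearbody k; rewrite -map_comp (eq_map (g := id)) ?map_id // => z /=; group_nf.
by rewrite es -/p -/q; clearbody k p q; congr [:: _, _ & _]; group_nf.
Qed.

Section Morphism.
Variables (G H : groupType) (f : G -> H).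
Hypothesis fM : {morph f : x y / x * y}.

Lemma morph1 : f 1 = 1.
Proof. by apply: (mulgI (f 1)); rewrite -fM !mulg1. Qed.

Lemma morphV x : f x^-1 = (f x)^-1.
Proof. by apply: (mulgI (f x)); rewrite -fM !mulgV morph1. Qed.

Lemma morph_gprod (x : seq G) : f (gprod x) = gprod (map f x).
Proof. by elim: x => [|a x IH] /=; rewrite ?morph1 // fM IH. Qed.

Lemma morph_inv_seq (x : seq G) : map f (inv_seq x) = inv_seq (map f x).
Proof. by rewrite /inv_seq -!map_comp; apply: eq_map => z /=; rewrite morphV. Qed.

Lemma morph_lein n (l : seq (G * G)) :
  map f (lein n l) = lein n [seq (f ab.1, f ab.2) | ab <- l].
Proof.
elim: n l => // n IH [|ab l] //=; rewrite -IH.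
set s' := lein n l; rewrite -morph_gprod; set k := (gprod s')^-1 * ab.1^-1.
have -> : (f (gprod s'))^-1 * (f ab.1)^-1 = f k by rewrite /k fM !morphV.
clearbody k.
have es : [seq (f k)^-1 * z^-1 * f k | z <- map f s'] = map f [seq k^-1 * z^-1 * k | z <- s'].
  by rewrite -!map_comp; apply: eq_map => z /=; rewrite !fM !morphV.
by rewrite es -morph_inv_seq -!morph_gprod !fM !morphV.
Qed.

End Morphism.

Lemma opp_prod_inv G (x : seq G) : opp_prod x = 1 -> opp_prod (inv_seq x) = 1.
Proof.
rewrite /opp_prod => h; have -> : inv_seq (inv_seq x) = x.
  by rewrite /inv_seq -map_comp (eq_map (g := id)) ?map_id // => z /=; rewrite invgK.
by apply: (mulgI (gprod x)); rewrite mulgA h mul1g mulg1.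
Qed.

End Nielsen.

(** * The group of bijections of a set *)

Section Bijections.
Variable Z : Type.

Record bij := Bij { fw : Z -> Z; bw : Z -> Z; fwK : cancel fw bw; bwK : cancel bw fw }.

Lemma bij_eq (f h : bij) : (forall z, fw f z = fw h z) -> f = h.
Proof.
case: f h => [f f' fK f'K] [h h' hK h'K] /= e; have ef : f = h by exact: funext.
subst h; have e' : f' = h'.
  by apply: funext => z; rewrite -[z in LHS]h'K fK.
subst h'; congr Bij; exact: Prop_irrelevance.
Qed.

Definition bij1 : bij := @Bij id id (fun _ => erefl) (fun _ => erefl).
Definition bijV f := Bij (bwK f) (fwK f).
Definition bijM f h : bij :=
  @Bij (fw f \o fw h) (bw h \o bw f) (can_comp (fwK f) (fwK h)) (can_comp (bwK h) (bwK f)).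

HB.instance Definition _ := gen_eqMixin bij.
HB.instance Definition _ := gen_choiceMixin bij.

Fact bijA : associative bijM. Proof. by move=> f h k; exact: bij_eq. Qed.
Fact bij1g : left_id bij1 bijM. Proof. by move=> f; exact: bij_eq. Qed.
Fact bijg1 : right_id bij1 bijM. Proof. by move=> f; exact: bij_eq. Qed.
Fact bijVg : left_inverse bij1 bijV bijM. Proof. by move=> f; apply: bij_eq => z /=; exact: fwK. Qed.
Fact bijgV : right_inverse bij1 bijV bijM. Proof. by move=> f; apply: bij_eq => z /=; exact: bwK. Qed.

HB.instance Definition _ := isGroup.Build bij bijA bij1g bijg1 bijVg bijgV.

Lemma fwM (f h : bij) z : fw (f * h)%g z = fw f (fw h z). Proof. by []. Qed.
Lemma fw1 z : fw (1%g : bij) z = z. Proof. by []. Qed.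
Lemma fwV (f : bij) z : fw (f^-1)%g z = bw f z. Proof. by []. Qed.

End Bijections.

(* A chain of 2K involutions whose product is trivial is folded in the middle
   into a model. *)
Section Chain.
Variables (d : nat) (Z : Type).
Local Notation K := d.+3.
Local Notation L := 'I_d.+3.

Definition unfold_chain (rho : bool -> L -> Z -> Z) (j : nat) : Z -> Z :=
  if j < K then rho false (inord j) else rho true (inord (K.*2.-1 - j)).

Definition letter_of j : bool * seq L := if j < K then (false, [:: inord j]) else (true, [:: inord (K.*2.-1 - j)]).

Lemma evp_letter (rho : bool -> L -> Z -> Z) j p z :
  evp rho (letter_of j :: p) z = unfold_chain rho j (evp rho p z).
Proof. by rewrite /letter_of /unfold_chain; case: ifP. Qed.

Lemma size_letter j : size (letter_of j).2 = 1.
Proof. by rewrite /letter_of; case: ifP. Qed.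

(** The second half is read backwards: r_0 ... r_(K-1) is the inverse of r_K ... r_(2K-1), that is
    r_(2K-1) ... r_K. *)
Definition fold_chain (r : nat -> Z -> Z) (b : bool) (a : L) : Z -> Z :=
  if b then r (K.*2.-1 - a) else r a.

Definition chain_prod (r : nat -> Z -> Z) (s : seq nat) z := foldr r z s.

Lemma unfold_fold r j : j < K.*2 -> unfold_chain (fold_chain r) j = r j.
Proof.
move=> hj; rewrite /unfold_chain /fold_chain; case: ltnP => h; rewrite inordK //; last by lia.
by congr r; lia.
Qed.

Lemma val_natL i : i < K -> (i%:R%R : L) = i :> nat.
Proof. by move=> h; rewrite Zp_nat /= modn_small. Qed.

Lemma chain_rev r s z : (forall j, j \in s -> involutive (r j)) -> chain_prod r s (chain_prod r (rev s) z) = z.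
Proof.
elim: s z => // j s IH z h; rewrite rev_cons -cats1 [LHS]/= /chain_prod foldr_cat /=.
by rewrite -/(chain_prod _ _ _) -/(chain_prod _ _ _) IH ?h ?mem_head // => i hi; apply: h; rewrite inE hi orbT.
Qed.

Lemma evf_unfold (rho : bool -> L -> Z -> Z) b z : evf rho b (av d (Posz K)) z =
  chain_prod (unfold_chain rho) (if b then rev (iota K K) else iota 0 K) z.
Proof.
have E i : i < K -> (i%:R%R : L) = inord i by move=> h; apply: ord_inj; rewrite val_natL // inordK.
have H (f : nat -> nat) : (forall i, i < K -> unfold_chain rho (f i) = rho b (inord i)) ->
    evf rho b (av d (Posz K)) z = chain_prod (unfold_chain rho) (map f (iota 0 K)) z.
  move=> hf; rewrite /av /mkseq /evf /chain_prod.
  have : all (fun i => i < K) (iota 0 K) by apply/allP => i; rewrite mem_iota.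
  by elim: (iota 0 K) => //= i s IH /andP[hi /IH ->]; rewrite hf // E.
case: b H => H.
  rewrite (H (fun i => K.*2.-1 - i)) => [|i hi].
    congr chain_prod; apply: (@eq_from_nth _ 0); rewrite ?size_map ?size_rev ?size_iota // => i hi.
    by rewrite (nth_map 0) ?size_iota // nth_rev ?size_iota // !nth_iota //; lia.
  by rewrite /unfold_chain; case: ltnP => h; [lia|congr (rho true (inord _)); lia].
rewrite (H id) ?map_id // => i hi.
by rewrite /unfold_chain hi.
Qed.

Lemma iota_halves : iota 0 K.*2 = iota 0 K ++ iota K K.
Proof. by rewrite -addnn iotaD. Qed.

Lemma fold_model r : (forall j, j < K.*2 -> involutive (r j)) ->
  (forall z, chain_prod r (iota 0 K.*2) z = z) -> model (fold_chain r).
Proof.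
move=> inv1 rel; split=> [b a|z].
  by rewrite /fold_chain; case: b; apply: inv1; have := ltn_ord a; lia.
have E s z' : (forall j, j \in s -> j < K.*2) ->
    chain_prod (unfold_chain (fold_chain r)) s z' = chain_prod r s z'.
  by elim: s => //= j s IH h; rewrite unfold_fold ?h ?mem_head // IH // => i hi; apply: h; rewrite inE hi orbT.
rewrite !evf_unfold !E; last 2 first.
- by move=> j; rewrite mem_rev mem_iota; lia.
- by move=> j; rewrite mem_iota; lia.
rewrite -[RHS]rel iota_halves /chain_prod foldr_cat -!/(chain_prod _ _ _) chain_rev //.
by move=> j; rewrite mem_iota => hj; apply: inv1; lia.
Qed.

Lemma unfold_inv rho j : model rho -> involutive (unfold_chain rho j).
Proof. by move=> [h _]; rewrite /unfold_chain; case: ifP => _; exact: h. Qed.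

Lemma unfold_rel rho z : model rho -> chain_prod (unfold_chain rho) (iota 0 K.*2) z = z.
Proof.
move=> mod; rewrite iota_halves /chain_prod foldr_cat -!/(chain_prod _ _ _).
have := mod.2 (chain_prod (unfold_chain rho) (iota K K) z); rewrite !evf_unfold => ->.
rewrite -{2}[iota K K]revK chain_rev // => j _; exact: unfold_inv.
Qed.

End Chain.

(** * Even products in a chain of involutions *)

Section ChainGroup.
Local Open Scope group_scope.

Lemma gprod_take (G : groupType) (x : seq G) n : gprod (take n.+1 x) = gprod (take n x) * nth 1 x n.
Proof.
case: (ltnP n (size x)) => h; last by rewrite !take_oversize ?nth_default ?mulg1 // ltnW.
by rewrite (take_nth 1) // -cats1 gprod_cat /= mulg1.
Qed.

Lemma gprod_mkseq (G : groupType) (f : nat -> G) n : gprod (mkseq f n.+1) = gprod (mkseq f n) * f n.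
Proof. by rewrite mkseqS -cats1 gprod_cat /= mulg1. Qed.

Variables (G : groupType) (R : nat -> G) (n : nat).
Hypothesis RR : forall j, R j * R j = 1.
Hypothesis Rrel : gprod (mkseq R n.*2.+2) = 1.

(** The alternating order makes products telescope: (R_0 R_1)(R_2 R_0)(R_0 R_3) = R_0 R_1 R_2
    R_3. *)
Definition chain_gen j := if odd j then R j.+1 * R 0 else R 0 * R j.+1.

Lemma chain_gen_prod k : gprod (mkseq chain_gen k.*2.+1) = gprod (mkseq R k.*2.+2).
Proof.
elim: k => [|k IH]; first by rewrite /= mulg1 mulg1.
rewrite doubleS (gprod_mkseq chain_gen) (gprod_mkseq chain_gen) IH !(gprod_mkseq R).
by rewrite /chain_gen /= odd_double /= -!mulgA [R 0 * (R 0 * _)]mulgA RR mul1g.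
Qed.

Lemma chain_gen_inv j : (chain_gen j)^-1 = if odd j then R 0 * R j.+1 else R j.+1 * R 0.
Proof.
have V i : (R i)^-1 = R i by apply: (mulgI (R i)); rewrite mulgV RR.
by rewrite /chain_gen; case: ifP => _; rewrite invgM !V.
Qed.

Lemma chain_gen_prodV k : gprod (mkseq (fun j => (chain_gen j)^-1) k.*2.+1) =
  R 0 * gprod (mkseq R k.*2.+2) * R 0.
Proof.
elim: k => [|k IH]; first by rewrite /= chain_gen_inv /= !mulg1 !mulgA RR mul1g.
rewrite doubleS 2!(gprod_mkseq (fun j => (chain_gen j)^-1)) IH !(gprod_mkseq R).
by rewrite !chain_gen_inv /= odd_double /= -!mulgA [R 0 * (R 0 * _)]mulgA RR mul1g.
Qed.

Lemma chain_gen_last : gprod (mkseq chain_gen n.*2) = (chain_gen n.*2)^-1.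
Proof.
by apply: (mulIg (chain_gen n.*2)); rewrite -gprod_mkseq chain_gen_prod Rrel mulVg.
Qed.

Lemma chain_gen_opp : opp_prod (mkseq chain_gen n.*2) = 1.
Proof.
rewrite /opp_prod chain_gen_last; apply: (mulgI (chain_gen n.*2)); rewrite mulKVg mulg1.
apply: (mulIg (chain_gen n.*2)^-1); rewrite mulgV.
have -> : inv_seq (mkseq chain_gen n.*2) = mkseq (fun j => (chain_gen j)^-1) n.*2.
  by rewrite /inv_seq /mkseq -map_comp.
by rewrite -gprod_mkseq chain_gen_prodV Rrel mulg1 RR.
Qed.

End ChainGroup.

(* [S] has the presentation < l | comm_prod l >. *)
Definition surface_presentation (S : groupType) (l : seq (S * S)) : Prop :=
  [/\ comm_prod l = 1%g,
      forall P : S -> Prop, P 1%g -> (forall a b, P a -> P b -> P (a * b)%g) ->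
        (forall a, P a -> P a^-1%g) -> (forall ab, ab \in l -> P ab.1 /\ P ab.2) -> forall a, P a
    & forall (G : groupType) (l' : seq (G * G)), size l' = size l -> comm_prod l' = 1%g ->
        exists2 f : S -> G, {morph f : a b / (a * b)%g} & [seq (f ab.1, f ab.2) | ab <- l] = l'].

(** * Surface groups acting through the amalgam *)

Section SurfaceGroup.
Variables (d : nat) (S : groupType) (l : seq (S * S)).
Hypotheses (sl : size l = d.+2) (pres : surface_presentation l).
Local Notation K := d.+3.
Local Notation L := 'I_d.+3.
Local Notation n := d.+2.
Local Notation vtx := (vtx d).

Let x := lein n l.

Lemma size_x : size x = n.*2. Proof. exact: size_lein. Qed.

Lemma opp_x : opp_prod x = 1%g.
Proof. by case: pres => h _ _; rewrite -(niel_prod size_x) niel_lein. Qed.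

Lemma gen_x (P : S -> Prop) : P 1%g -> (forall a b, P a -> P b -> P (a * b)%g) ->
  (forall a, P a -> P a^-1%g) -> (forall j, j < n.*2 -> P (nth 1%g x j)) -> forall a, P a.
Proof.
move=> P1 PM PV Px; case: pres => _ gen _; apply: gen => //.
have Pprod y : (forall z, z \in y -> P z) -> P (gprod y).
  elim: y => //= z y IH h; apply: PM; first by apply: h; rewrite mem_head.
  by apply: IH => w hw; apply: h; rewrite inE hw orbT.
have Pinv y : (forall z, z \in y -> P z) -> forall z, z \in inv_seq y -> P z.
  by move=> h z /mapP[w wy ->]; apply/PV/h.
have Pn k y : (forall z, z \in y -> P z) -> forall ab, ab \in niel k y -> P ab.1 /\ P ab.2.
  elim: k y => // k IH [|x1 [|x2 s]] // h ab; rewrite [niel _ _]/= inE.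
  have h1 : P x1 by apply: h; rewrite mem_head.
  have h2 : P x2 by apply: h; rewrite !inE eqxx orbT.
  have hs z : z \in s -> P z by move=> hz; apply: h; rewrite !inE hz !orbT.
  have hp := Pprod _ hs; have hq := Pprod _ (Pinv _ hs).
  have hk : P ((gprod (inv_seq s))^-1 * (x2 * gprod s))%g := PM _ _ (PV _ hq) (PM _ _ h2 hp).
  case/orP=> [/eqP->/=|].
    split; first exact: (PM _ _ (PM _ _ hk (PV _ (PM _ _ h2 hp))) (PV _ hk)).
    exact: (PM _ _ (PM _ _ hk (PM _ _ hq h1)) (PV _ hk)).
  by apply: IH => z /mapP[w ws ->]; exact: (PM _ _ (PM _ _ hk (PV _ (hs _ ws))) (PV _ hk)).
rewrite -(niel_lein sl); apply: Pn => z /(nthP 1%g)[j]; rewrite size_x => hj <-.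
exact: Px.
Qed.

Lemma univ_x (G : groupType) (y : seq G) : size y = n.*2 -> opp_prod y = 1%g ->
  exists2 f : S -> G, {morph f : a b / (a * b)%g} & map f x = y.
Proof.
move=> sy oy; case: pres => _ _ univ.
have [|//|f fM e] := univ G (niel n y); first by rewrite size_niel.
  by rewrite niel_prod.
by exists f => //; rewrite morph_lein // e lein_niel.
Qed.

(** Inverting the letters replaces the relator by a conjugate, so the universal property supplies
    the morphism. *)
Lemma hyperelliptic : exists iota : S -> S, [/\ {morph iota : a b / (a * b)%g}, involutive iota
  & map iota x = inv_seq x].
Proof.
have [|f fM e] := univ_x (y := inv_seq x) _ (opp_prod_inv opp_x); first by rewrite size_map size_x.
exists f; split=> //; apply: gen_x => [|a b ha hb|a ha|j hj].
- by rewrite !(morph1 fM).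
- by rewrite !fM ha hb.
- by rewrite !(morphV fM) ha.
have ej : f (nth 1%g x j) = (nth 1%g x j)^-1%g.
  by rewrite -(nth_map 1%g 1%g f) ?size_x // e (nth_map 1%g) ?size_x.
by rewrite ej (morphV fM) ej invgK.
Qed.

(** The extra letter makes the total product trivial: [iota] and its composites with these 2g + 1
    elements or their inverses are the 2g + 2 involutions of the chain. *)
Let xx := rcons x (gprod x)^-1%g.

Lemma nth_xx j : j < n.*2 -> nth 1%g xx j = nth 1%g x j.
Proof. by move=> h; rewrite nth_rcons size_x h. Qed.

Section Word.
Variable iota : S -> S.
Hypotheses (iM : {morph iota : a b / (a * b)%g}) (iK : involutive iota) (ix : map iota x = inv_seq x).

Lemma iota_x j : j < n.*2 -> iota (nth 1%g x j) = (nth 1%g x j)^-1%g.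
Proof. by move=> h; rewrite -(nth_map 1%g 1%g iota) ?size_x // ix (nth_map 1%g) ?size_x. Qed.

Lemma iota_xx j : iota (nth 1%g xx j) = (nth 1%g xx j)^-1%g.
Proof.
case: (ltngtP j (size x)) => h.
- by rewrite size_x in h; rewrite nth_xx // iota_x.
- by rewrite nth_default ?size_rcons // (morph1 iM) invg1.
rewrite nth_rcons h ltnn eqxx (morphV iM) invgK (morph_gprod iM) ix.
by apply: (mulIg (gprod (inv_seq x))); rewrite mulVg; exact: esym opp_x.
Qed.

(** Acting on the set [S], these generate the semidirect product of [S] with [iota]. In the
    resulting model an element of [S] acts by translation, so a word that is trivial in all models
    represents 1. *)
Definition refl j (s : S) : S :=
  if j is j'.+1 then ((if odd j' then nth 1 xx j' else (nth 1 xx j')^-1) * iota s)%g else iota s.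

Lemma reflK j : involutive (refl j).
Proof.
case: j => [|j] s /=; first exact: iK.
case: (odd j); rewrite iM iK ?(morphV iM) iota_xx ?invgK ?mulKVg //; by rewrite mulKg.
Qed.

Lemma refl_prod k s : chain_prod refl (seq.iota 0 k.*2.+2) s = (gprod (take k.*2.+1 xx) * s)%g.
Proof.
elim: k s => [|k IH] s.
  by rewrite gprod_take take0 /= !mul1g iM iK (morphV iM) iota_xx invgK.
have -> : seq.iota 0 k.+1.*2.+2 = seq.iota 0 k.*2.+2 ++ [:: k.*2.+2; k.*2.+3].
  by rewrite doubleS -[k.*2.+4]addn2 iotaD.
rewrite /chain_prod foldr_cat -/(chain_prod _ _ _) IH doubleS !gprod_take /= odd_double /=.
by rewrite iM iK (morphV iM) iota_xx invgK !mulgA.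
Qed.

Lemma refl_model : model (fold_chain (d := d) refl).
Proof.
apply: fold_model => [j _|z]; first exact: reflK.
have -> : K.*2 = n.*2.+2 by rewrite doubleS.
rewrite refl_prod take_oversize ?size_rcons ?size_x // /xx -cats1 gprod_cat /= mulg1 mulgV.
exact: mul1g.
Qed.

Definition chain_bij (rho : bool -> L -> vtx -> vtx) (mod : model rho) j : bij vtx :=
  Bij (unfold_inv j mod) (unfold_inv j mod).

(* The even word [p] represents [gamma], in [S] and in every model. *)
Definition represents p (gamma : S) := [/\ ~~ parity p,
  forall s, evp (fold_chain refl) p s = (gamma * s)%g
  & forall rho (mod : model rho) (f : S -> bij vtx), {morph f : a b / (a * b)%g} ->
      (forall j, j < n.*2 -> f (nth 1%g x j) = chain_gen (chain_bij mod) j) ->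
      forall v, fw (f gamma) v = evp rho p v].

Lemma represents1 : represents [::] 1%g.
Proof. by split=> [//|s|rho mod f fM _ v]; rewrite ?mul1g // (morph1 fM). Qed.

Lemma representsM p q a b : represents p a -> represents q b -> represents (p ++ q) (a * b)%g.
Proof.
move=> [p1 p2 p3] [q1 q2 q3]; split=> [|s|rho mod f fM h v].
- by move: p1 q1; rewrite /parity map_cat sumn_cat oddD; case: (odd _).
- by rewrite evp_cat q2 p2 mulgA.
- by rewrite evp_cat -(q3 _ mod f fM h) -(p3 _ mod f fM h) fM.
Qed.

Lemma ltn_chain j : j < n.*2 -> j.+1 < K.*2. Proof. by lia. Qed.

Lemma represents_x j : j < n.*2 ->
  represents (if odd j then [:: letter_of d j.+1; letter_of d 0] else [:: letter_of d 0; letter_of d j.+1])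
    (nth 1%g x j) /\
  represents (if odd j then [:: letter_of d 0; letter_of d j.+1] else [:: letter_of d j.+1; letter_of d 0])
    (nth 1%g x j)^-1%g.
Proof.
move=> hj; have hj' := ltn_chain hj.
have Sx : evp (fold_chain refl) (if odd j then [:: letter_of d j.+1; letter_of d 0]
      else [:: letter_of d 0; letter_of d j.+1]) =1 mulg (nth 1%g x j).
  move=> s; case E: (odd j); rewrite !evp_letter !unfold_fold //= E nth_xx //.
    by rewrite iK.
  by rewrite iM iK (morphV iM) iota_x // invgK.
have SxV : evp (fold_chain refl) (if odd j then [:: letter_of d 0; letter_of d j.+1]
      else [:: letter_of d j.+1; letter_of d 0]) =1 mulg (nth 1%g x j)^-1%g.
  move=> s; case E: (odd j); rewrite !evp_letter !unfold_fold //= E nth_xx //.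
    by rewrite iM iK iota_x.
  by rewrite iK.
have par a b : ~~ parity [:: letter_of d a; letter_of d b] by rewrite /parity /= !size_letter.
split; split=> [|//|rho mod f fM h v].
- by case: ifP.
- by rewrite h // /chain_gen; case: ifP => _; rewrite !evp_letter.
- by case: ifP.
have RR i : (chain_bij mod i * chain_bij mod i = 1)%g by apply: bij_eq => w; exact: (unfold_inv i mod).
by rewrite (morphV fM) h // chain_gen_inv //; case: ifP => _; rewrite !evp_letter.
Qed.

Lemma represented gamma : exists p, represents p gamma.
Proof.
suff [] : (exists p, represents p gamma) /\ (exists p, represents p gamma^-1%g) by [].
apply: (gen_x (P := fun a => (exists p, represents p a) /\ (exists p, represents p a^-1%g))).
- by rewrite invg1; split; exists [::]; exact: represents1.
- move=> a b [[p hp] [p' hp']] [[q hq] [q' hq']]; rewrite invgM.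
  by split; [exists (p ++ q)|exists (q' ++ p')]; exact: representsM.
- by move=> a [h1 h2]; rewrite invgK.
- by move=> j /represents_x[h1 h2]; split; eexists; eassumption.
Qed.

Lemma represents_trivial p gamma : represents p gamma -> trivial_word p -> gamma = 1%g.
Proof.
by move=> [_ h _] t; have := h 1%g; rewrite (t _ _ refl_model) mulg1.
Qed.

End Word.

Theorem surface_group_action m (gamma : 'I_m -> S) : (forall i, gamma i <> 1%g) ->
  exists (T : simplicial_tree) (rho : tree_action S T),
    [/\ locally_finite T, minimal_action rho, faithful_action rho
      & forall i, loxodromic rho (gamma i)].
Proof.
move=> gam1; have [iota [iM iK ix]] := hyperelliptic.
have rep a := cid (represented iM iK ix a).
pose ps := [seq projT1 (rep (gamma i)) | i <- enum 'I_m].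
have [rho [mod rho_adj rho_act rho_faith rho_lox]] := amalgam_action ps.
pose R := chain_bij mod.
have RR i : (R i * R i = 1)%g by apply: bij_eq => w; exact: (unfold_inv i mod).
have Rrel : gprod (mkseq R n.*2.+2) = 1%g.
  apply: bij_eq => v; rewrite fw1 -[RHS](unfold_rel v mod) doubleS.
  by rewrite /mkseq; elim: (seq.iota 0 _) => //= j s <-.
have [|f fM ef] := univ_x _ (chain_gen_opp RR Rrel); first by rewrite size_mkseq.
have fx j : j < n.*2 -> f (nth 1%g x j) = chain_gen (chain_bij mod) j.
  by move=> h; rewrite -(nth_map 1%g 1%g f) ?size_x // ef nth_mkseq.
have fE a v : fw (f a) v = evp rho (projT1 (rep a)) v by case: (projT2 (rep a)) => _ _ h; exact: h.
have f1 v : fw (f 1%g) v = v by rewrite (morph1 fM).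
have fMv a b v : fw (f (a * b)%g) v = fw (f a) (fw (f b) v) by rewrite fM.
have fadj a u v : vadj (fw (f a) u) (fw (f a) v) = vadj u v.
  rewrite !fE; elim: (projT1 (rep a)) => //= q p IH; rewrite -IH.
  by elim: q.2 => //= b g IHg; rewrite rho_adj.
exists (word_tree d), (@TreeAction S (word_tree d) (fun a v => fw (f a) v) f1 fMv fadj).
split.
- exact: word_tree_locally_finite.
(* For [a] nonzero, r_0 r_a is the image of the generator number [a - 1] or of its inverse,
   according to the parity in [chain_gen]. *)
- move=> W sW invW; have xa (a : L) : exists s, forall v, fw (f s) v = vact [:: ord0; a] v.
    have R0 v : fw (R 0) v = vact [:: ord0] v.
      by rewrite /= /unfold_chain /= rho_act; congr vact; congr [:: _]; apply: ord_inj; rewrite inordK.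
    have Ra v : fw (R a) v = vact [:: a] v.
      by rewrite /= /unfold_chain ltn_ord rho_act inord_val.
    have vv (b b' : L) v : vact [:: b] (vact [:: b'] v) = vact [:: b; b'] v by exact: val_inj.
    case E: (val a) => [|j].
      exists 1%g => v; rewrite f1; have -> : a = ord0 by exact: ord_inj.
      by apply: val_inj; rewrite /= lactK // (valP v).
    have hj : j < n.*2 by have := ltn_ord a; rewrite -[nat_of_ord a]/(val a) E; lia.
    have ga : chain_gen R j = if odd j then (R a * R 0)%g else (R 0 * R a)%g.
      by rewrite /chain_gen -E.
    case: (boolP (odd j)) ga => oj ga.
      exists (nth 1%g x j)^-1%g => v; rewrite (morphV fM) fx // chain_gen_inv // oj -E fwM.
      by rewrite Ra R0 vv.
    by exists (nth 1%g x j) => v; rewrite fx // ga fwM Ra R0 vv.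
  have vV (b b' : L) v : vact [:: b'; b] (vact [:: b; b'] v) = v.
    by apply: val_inj; rewrite /= (lactK b) ?lact_reduced ?(valP v) // lactK // (valP v).
  apply: even_invariant => // a v Wv; have [s es] := xa a; last by rewrite -es; exact: invW.
  have -> : vact [:: a; ord0] v = fw (f s^-1%g) v.
    by rewrite (morphV fM) fwV -[in RHS](vV a ord0 v) -es fwK.
  exact: invW.
- move=> a fa; apply: (represents_trivial iM iK ix (projT2 (rep a))).
  by apply: rho_faith => [|v]; [case: (projT2 (rep a))|rewrite -fE; exact: fa].
move=> i ell; have pin : projT1 (rep (gamma i)) \in ps.
  by apply/mapP; exists i; rewrite ?mem_enum.
have ev : ~~ parity (projT1 (rep (gamma i))) by case: (projT2 (rep (gamma i))).
have nt : ~ trivial_word (projT1 (rep (gamma i))).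
  by move/(represents_trivial iM iK ix (projT2 (rep (gamma i)))); exact: gam1.
case: ell => [[v]|[u [v [uv]]]] /=; rewrite !fE.
  by move=> e; apply: (rho_lox _ pin ev nt v v) => //; left.
by move=> e1 e2; apply: (rho_lox _ pin ev nt u v) => //; right.
Qed.

End SurfaceGroup.

Local Open Scope classical_set_scope.
Local Open Scope ring_scope.

(** * Geometry of the disc *)

Section Plane.
Variable R : realType.
Implicit Types (u v w p : R * R) (r s t : R).

Definition eunorm p : R := Num.sqrt (p.1 ^+ 2 + p.2 ^+ 2).
Definition eudist u v : R := eunorm (u.1 - v.1, u.2 - v.2).
Definition dotp u v : R := u.1 * v.1 + u.2 * v.2.
Definition segm v u r : R * R :=
  ((1 - r) * v.1 + r * u.1, (1 - r) * v.2 + r * u.2).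

Lemma eunorm_ge0 p : 0 <= eunorm p. Proof. exact: sqrtr_ge0. Qed.

Lemma sqr_eunorm p : eunorm p ^+ 2 = p.1 ^+ 2 + p.2 ^+ 2.
Proof. by rewrite sqr_sqrtr // addr_ge0 // sqr_ge0. Qed.

Lemma closed_discE p : closed_disc p <-> eunorm p <= 1.
Proof.
rewrite /closed_disc /= -sqr_eunorm; split => h; last first.
  by rewrite expr_le1 // eunorm_ge0.
by rewrite -(expr_le1 (n := 2)) // eunorm_ge0.
Qed.

Lemma eunorm1E p : eunorm p = 1 <-> p.1 ^+ 2 + p.2 ^+ 2 = 1.
Proof.
rewrite -sqr_eunorm; split => [->|/eqP]; first by rewrite expr1n.
by rewrite sqrf_eq1 => /orP[/eqP//|/eqP h]; have := eunorm_ge0 p; lra.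
Qed.

Lemma dotp_le u v : dotp u v <= eunorm u * eunorm v.
Proof.
have [h|h] := leP (dotp u v) 0.
  by apply: le_trans h _; rewrite mulr_ge0 ?eunorm_ge0.
rewrite -(ler_pXn2r (n := 2)) ?nnegrE ?mulr_ge0 ?eunorm_ge0 ?(ltW h) //.
rewrite exprMn !sqr_eunorm /dotp.
rewrite -subr_ge0.
have -> : (u.1 ^+ 2 + u.2 ^+ 2) * (v.1 ^+ 2 + v.2 ^+ 2) -
   (u.1 * v.1 + u.2 * v.2) ^+ 2 = (u.1 * v.2 - u.2 * v.1) ^+ 2 by ring.
exact: sqr_ge0.
Qed.

Lemma eunormD u v : eunorm (u.1 + v.1, u.2 + v.2) <= eunorm u + eunorm v.
Proof.
rewrite -(ler_pXn2r (n := 2)) ?nnegrE ?addr_ge0 ?eunorm_ge0 //.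
rewrite sqrrD !sqr_eunorm /=; have := dotp_le u v; rewrite /dotp; nra.
Qed.

Lemma eunormZ r p : eunorm (r * p.1, r * p.2) = `|r| * eunorm p.
Proof.
rewrite /eunorm /= !exprMn -mulrDr sqrtrM ?sqr_ge0 //.
by rewrite sqrtr_sqr.
Qed.

Lemma eudist_ge0 u v : 0 <= eudist u v. Proof. exact: eunorm_ge0. Qed.

Lemma eudistC u v : eudist u v = eudist v u.
Proof. by rewrite /eudist /eunorm /=; congr Num.sqrt; ring. Qed.

Lemma eudistxx u : eudist u u = 0.
Proof. by rewrite /eudist /eunorm /= !subrr expr0n /= addr0 sqrtr0. Qed.

Lemma eudist_triangle u v w : eudist u w <= eudist u v + eudist v w.
Proof.
have := eunormD (u.1 - v.1, u.2 - v.2) (v.1 - w.1, v.2 - w.2) => /=.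
by rewrite /eudist !(addrA, addrNK, subrK).
Qed.

Lemma eudist_eq0 u v : eudist u v = 0 -> u = v.
Proof.
case: u v => [a b] [c d] /= /(congr1 (fun x => x ^+ 2)).
rewrite sqr_eunorm /= expr0n /= => /eqP.
rewrite paddr_eq0 ?sqr_ge0 // !sqrf_eq0 !subr_eq0.
by case/andP => /eqP -> /eqP ->.
Qed.

Lemma eunorm_dist u : eudist u (0, 0) = eunorm u.
Proof. by rewrite /eudist /= !subr0; case: u. Qed.

Lemma eunorm_le_dist u v : eunorm u <= eudist u v + eunorm v.
Proof. by rewrite -!eunorm_dist eudist_triangle. Qed.

Lemma norm_le_eudist u v : `|u - v| <= eudist u v.
Proof.
rewrite prod_normE /= ge_max -!sqrtr_sqr.
by rewrite !ler_sqrt ?sqr_ge0 ?addr_ge0 ?sqr_ge0 //= ?lerDl ?lerDr ?sqr_ge0.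
Qed.

Lemma segm0 v u : segm v u 0 = v.
Proof. by rewrite /segm subr0 !mul1r !mul0r !addr0; case: v. Qed.

Lemma segm1 v u : segm v u 1 = u.
Proof. by rewrite /segm subrr !mul1r !mul0r !add0r; case: u. Qed.

Lemma segm_disc v u r : closed_disc v -> closed_disc u -> 0 <= r <= 1 ->
  closed_disc (segm v u r).
Proof.
rewrite !closed_discE => hv hu /andP[r0 r1].
have := eunormD ((1 - r) * v.1, (1 - r) * v.2) (r * u.1, r * u.2).
rewrite !eunormZ /= !ger0_norm ?subr_ge0 // => /le_trans; apply.
nra.
Qed.

Lemma eudist_segm v u r : 0 <= r <= 1 ->
  eudist (segm v u r) u = (1 - r) * eudist v u.
Proof.
move=> /andP[r0 r1]; rewrite -[X in X * _]ger0_norm ?subr_ge0 // -eunormZ.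
by rewrite /eudist /segm /=; congr eunorm; congr pair; ring.
Qed.

Lemma sqrt_comp_cont (T : topologicalType) (f : T -> R) :
  continuous f -> continuous (fun x => Num.sqrt (f x)).
Proof. by move=> h x; exact: (@cvg_comp _ _ _ f Num.sqrt _ _ _ (h x) (@sqrt_continuous R (f x))). Qed.

Lemma eunorm_cont : continuous eunorm.
Proof.
apply: sqrt_comp_cont => p.
apply: cvgD; rewrite expr2; apply: cvgM;
  (exact: cvg_fst || exact: cvg_snd).
Qed.

Lemma pair_cont (T U V : topologicalType) (f : T -> U) (h : T -> V) :
  continuous f -> continuous h -> continuous (fun x => (f x, h x)).
Proof. by move=> cf ch x; apply: cvg_pair; [exact: cf|exact: ch]. Qed.

Lemma eudist_cont u : continuous (eudist ^~ u).
Proof.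
move=> p; have h : continuous (fun v : R * R => (v.1 - u.1, v.2 - u.2)).
  by apply: pair_cont => {}p; apply: cvgB;
    (exact: cvg_fst || exact: cvg_snd || exact: cvg_cst).
exact: (@cvg_comp _ _ _ _ eunorm _ _ _ (h p) (@eunorm_cont _)).
Qed.

Lemma eunorm1_disc p : eunorm p = 1 -> closed_disc p.
Proof. by rewrite closed_discE => ->. Qed.

Lemma closed_closed_disc : closed (@closed_disc R).
Proof.
have -> : @closed_disc R = @eunorm @^-1` [set x | x <= 1].
  by apply/seteqP; split => p; rewrite closed_discE.
exact: (proj1 (continuous_closedP _) eunorm_cont _ (@closed_le R 1)).
Qed.

Lemma compact_closed_disc : compact (@closed_disc R).
Proof.
have h : compact (`[(-1 : R), 1]%classic `*` `[(-1 : R), 1]%classic).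
  by apply: compact_setX; exact: segment_compact.
refine (subclosed_compact closed_closed_disc h _).
move=> p; rewrite /closed_disc /= => hp.
rewrite /setX /= !in_itv /=; move: (p.1) (p.2) hp => a b hp.
by split; apply/andP; split; nra.
Qed.

End Plane.

(** * The boundary circle and the sides of the polygon *)

Section Circle.
Variable R : realType.

Lemma unit_angle (p : R * R) : eunorm p = 1 ->
  exists x, - pi < x <= pi /\ p = (cos x, sin x).
Proof.
case: p => a c /eunorm1E /= h.
have ha : -1 <= a <= 1 by apply/andP; split; nra.
have ac : cos (acos a) = a by rewrite acosK.
have sa : sin (acos a) = `|c|.
  by rewrite sin_acos // -sqrtr_sqr; congr Num.sqrt; rewrite -h; ring.
have [c0|c0] := leP 0 c.
  exists (acos a); rewrite acos_lepi // andbT; split.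
    by apply: lt_le_trans (acos_ge0 ha); rewrite oppr_lt0 pi_gt0.
  by rewrite ac sa ger0_norm.
exists (- acos a); rewrite cosN sinN ac sa ltr0_norm // opprK.
split => //; rewrite ltrN2.
have -> : - acos a <= pi.
  by apply: le_trans (pi_ge0 R); rewrite oppr_le0 acos_ge0.
rewrite andbT acos_ltpi //.
by apply/andP; split; nra.
Qed.

Variable g : nat.
Hypothesis hg : (0 < g)%N.
Local Notation bp := (@boundary_point R g).
Local Notation M := ((4 * g)%:R : R).

Lemma M_gt0 : 0 < M. Proof. by rewrite ltr0n muln_gt0. Qed.
Lemma M_ge4 : 4 <= M. Proof. by rewrite (ler_nat R 4) leq_pmulr. Qed.

Definition angle (s : R) : R := 2 * pi * s / M.

Lemma angleD s t : angle (s + t) = angle s + angle t.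
Proof. by rewrite /angle mulrDr mulrDl. Qed.
Lemma angleN s : angle (- s) = - angle s.
Proof. by rewrite /angle mulrN mulNr. Qed.
Lemma angleK s : angle (s * M / (2 * pi)) = s.
Proof.
rewrite /angle; have := pi_gt0 R; have := M_gt0; move: (pi : R) M => x y x0 y0.
by field; rewrite !gt_eqF.
Qed.
Lemma angleM : angle M = pi *+ 2.
Proof. by rewrite /angle mulfK ?gt_eqF ?M_gt0 // mulr_natl. Qed.

Lemma bpE s : bp s = (cos (angle s), sin (angle s)). Proof. by []. Qed.

Lemma bp_norm s : eunorm (bp s) = 1.
Proof. by apply/eunorm1E; rewrite /= cos2Dsin2. Qed.

Lemma bp_disc s : closed_disc (bp s).
Proof. by apply: eunorm1_disc; exact: bp_norm. Qed.

Lemma bp_period s : bp (s + M) = bp s.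
Proof. by rewrite !bpE angleD angleM cosD2pi sinD2pi. Qed.

Lemma bp_periodn s n : bp (s + M * n%:R) = bp s.
Proof.
elim: n => [|n IH]; first by rewrite mulr0 addr0.
by rewrite -natr1 mulrDr mulr1 addrA bp_period.
Qed.

Lemma angle_le s t : (angle s <= angle t) = (s <= t).
Proof.
rewrite /angle ler_pM2r ?invr_gt0 ?M_gt0 // ler_pM2l //.
by rewrite mulr_gt0 ?pi_gt0.
Qed.

Lemma angle_lt s t : (angle s < angle t) = (s < t).
Proof. by rewrite !ltNge angle_le. Qed.

Lemma angle0 : angle 0 = 0. Proof. by rewrite /angle mulr0 mul0r. Qed.

Lemma bp_surj p : eunorm p = 1 -> exists s, 0 <= s < M /\ p = bp s.
Proof.
case/unit_angle => x [/andP[x0 x1] ->].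
have [h|h] := leP 0 x.
  exists (x * M / (2 * pi)); rewrite bpE angleK; split=> //.
  rewrite -angle_le -angle_lt angleK angle0 h angleM /= mulr2n.
  have := pi_gt0 R; lra.
exists (x * M / (2 * pi) + M).
rewrite bp_period bpE angleK; split=> //.
rewrite -angle_le -angle_lt angleD angleK angle0 angleM /= mulr2n.
have := pi_gt0 R; lra.
Qed.

Lemma dotp_bp s t : dotp (bp s) (bp t) = cos (angle (s - t)).
Proof. by rewrite /dotp !bpE /= angleD angleN cosB. Qed.

Lemma bp_inj s t : 0 <= s < M -> 0 <= t < M -> bp s = bp t -> s = t.
Proof.
wlog st : s t / s <= t => [hw hs ht e|].
  by have [/hw|/ltW/hw] := leP s t; [exact|move=> h; symmetry; exact: h].
move=> /andP[s0 s1] /andP[t0 t1] e.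
have : cos (angle (t - s)) = 1.
  by rewrite -dotp_bp e /dotp -!expr2 -sqr_eunorm bp_norm expr1n.
set x := angle (t - s).
have -> : x = (x / 2) *+ 2 by rewrite -mulr_natr mulfVK.
rewrite cos_mulr2n cos2sin2 => h.
have s2 : sin (x / 2) = 0.
  by apply/eqP; rewrite -sqrf_eq0; apply/eqP; move: h; rewrite mulr2n; lra.
have x0 : 0 <= x by rewrite -angle0 angle_le subr_ge0.
have x1 : x < pi *+ 2 by rewrite -angleM angle_lt; lra.
have : ~~ (0 < x / 2).
  apply/negP => h1; suff : 0 < sin (x / 2) by rewrite s2 ltxx.
  by apply: sin_gt0_pi; rewrite h1 /= ltr_pdivrMr // mulr_natr.
rewrite -leNgt => h1; have : x <= 0 by lra.
by rewrite -angle0 angle_le subr_le0 => h2; apply/eqP; rewrite eq_le st.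
Qed.

Definition side (k : nat) : set (R * R) :=
  [set p | exists2 t, t \in `[0, 1] & p = bp (k%:R + t)].

Definition half : R := 2^-1.

Lemma cos_half_gt0 : 0 < cos (angle half).
Proof.
apply: cos_gt0_pihalf.
have h : 0 < angle half by rewrite -angle0 angle_lt invr_gt0.
have := pi_gt0 R => p0.
apply/andP; split; first by lra.
rewrite /angle /half ltr_pdivrMr ?M_gt0 //; have := M_ge4; nra.
Qed.

Lemma cos_mono x y : `|x| <= pi -> `|y| <= pi ->
  (cos x <= cos y) = (`|y| <= `|x| :> R).
Proof.
move=> hx hy; rewrite -(cos_norm x) -(cos_norm y).
by rewrite !leNgt ltr_cos // in_itv /= ?hx ?hy normr_ge0.
Qed.

Lemma norm_angle s t : (`|angle s| <= angle t) = (`|s| <= t).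
Proof. by rewrite !ler_norml -angleN !angle_le. Qed.

Lemma half_le_pi : angle half <= pi.
Proof.
have := pi_gt0 R => p0.
rewrite /angle /half ler_pdivrMr ?M_gt0 //; have := M_ge4; nra.
Qed.

(** A side is the cap of the circle cut off by a half-plane centred at its midpoint; closedness of
    the side and its stability under [slide] are read off this description. *)
Lemma sideE k p : side k p <->
  eunorm p = 1 /\ cos (angle half) <= dotp p (bp (k%:R + half)).
Proof.
have hh : 0 <= angle half by rewrite -angle0 angle_le invr_ge0.
split => [[t]|[np hp]].
  rewrite in_itv /= => ht ->; split; first exact: bp_norm.
  rewrite dotp_bp.
  have ht' : `|angle (k%:R + t - (k%:R + half))| <= angle half.
    by rewrite norm_angle ler_norml /half; lra.
  rewrite cos_mono ?(ger0_norm hh) ?half_le_pi //.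
  exact: le_trans ht' half_le_pi.
have [s [_ ps]] := bp_surj np.
move: hp; rewrite ps dotp_bp; set s' := s - _ => hp.
have /unit_angle [x [/andP[x0 x1] ex]] := bp_norm s'.
case: ex => ec es.
have hx : `|x| <= angle half.
  move: hp; rewrite -[X in _ <= X]/(bp s').1 [X in _ <= X]ec.
  rewrite cos_mono; first by rewrite (ger0_norm hh).
    by rewrite ger0_norm // half_le_pi.
  by rewrite ler_norml x1 ltW.
have sE : s = (k%:R + half) + s' by rewrite /s'; ring.
exists (half + x * M / (2 * pi)).
  rewrite in_itv /=.
  suff : `|x * M / (2 * pi)| <= half by rewrite ler_norml /half; lra.
  by rewrite -norm_angle angleK.
rewrite addrA sE !bpE !(angleD _ s') !(angleD (_ + half)) angleK.
by rewrite cosD sinD [cos (angle s')]ec [sin (angle s')]es -cosD -sinD.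
Qed.

Lemma side_closed k : closed (side k).
Proof.
have -> : side k = (@eunorm R @^-1` [set 1]) `&`
   ((fun p => dotp p (bp (k%:R + half))) @^-1` [set x | cos (angle half) <= x]).
  by apply/seteqP; split => p; rewrite sideE.
apply: closedI.
  exact: (proj1 (continuous_closedP _) (@eunorm_cont R) _ (@closed_eq R 1)).
have h : continuous (fun p => dotp p (bp (k%:R + half))).
  move=> p; apply: cvgD; apply: cvgM;
  (exact: cvg_fst || exact: cvg_snd || exact: cvg_cst).
exact: (proj1 (continuous_closedP _) h _ (@closed_ge R _)).
Qed.

End Circle.

(** * Reflections and deformations of the disc *)

Section Deformation.
Variables (R : realType) (g : nat).
Hypothesis hg : (0 < g)%N.
Local Notation bp := (@boundary_point R g).
Local Notation angle := (@angle R g).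
Local Notation side := (@side R g).
Implicit Types (u v w p : R * R) (r s t : R).

(** The reflection in the line through the origin and [bp (c / 2)]. *)
Definition mirror (c : R) p : R * R :=
  (cos (angle c) * p.1 + sin (angle c) * p.2,
   sin (angle c) * p.1 - cos (angle c) * p.2).

Lemma mirror_bp c s : mirror c (bp s) = bp (c - s).
Proof. by rewrite /mirror !bpE /= angleD angleN cosB sinB; congr pair; ring. Qed.

Lemma mirror_norm c p : eunorm (mirror c p) = eunorm p.
Proof.
rewrite /eunorm /mirror /=; congr Num.sqrt.
have := cos2Dsin2 (angle c); move: (cos _) (sin _) => x y h.
transitivity ((x ^+ 2 + y ^+ 2) * (p.1 ^+ 2 + p.2 ^+ 2)); first by ring.
by rewrite h mul1r.
Qed.

Lemma mirror_dist c u v : eudist (mirror c u) (mirror c v) = eudist u v.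
Proof.
rewrite /eudist -[RHS](mirror_norm c); congr eunorm.
by rewrite /mirror /=; congr pair; ring.
Qed.

Definition rescale r p : R * R := (r / eunorm p * p.1, r / eunorm p * p.2).

(* On the circle the straight segment is pushed back radially, so that the
   deformation of a side into one of its points stays in that side. *)
Definition slide v u r : R * R :=
  if eunorm u == 1 then
    rescale ((1 - r) * eunorm v + r * eunorm u) (segm v u r)
  else segm v u r.

Lemma eunorm_rescale r p : p != (0, 0) -> 0 <= r -> eunorm (rescale r p) = r.
Proof.
move=> p0 r0; have h : eunorm p != 0.
  by apply: contra_neq p0 => h; apply: eudist_eq0; rewrite eunorm_dist.
by rewrite eunormZ ger0_norm ?divr_ge0 ?eunorm_ge0 // divfK.
Qed.

Lemma rescale_id p : rescale (eunorm p) p = p.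
Proof.
have [h|h] := eqVneq (eunorm p) 0.
  have -> : p = (0, 0) by apply: eudist_eq0; rewrite eunorm_dist.
  by rewrite /rescale !mulr0.
by rewrite /rescale divff // !mul1r; case: p h.
Qed.

Lemma slide0 v u : slide v u 0 = v.
Proof. by rewrite /slide segm0 subr0 mul1r mul0r addr0 rescale_id if_same. Qed.

Lemma slide1 v u : slide v u 1 = u.
Proof. by rewrite /slide segm1 subrr mul1r mul0r add0r rescale_id if_same. Qed.

Lemma rescale_disc r p : 0 <= r <= 1 -> closed_disc (rescale r p).
Proof.
move=> /andP[r0 r1].
have [->|p0] := eqVneq p (0, 0).
  by rewrite /rescale !mulr0 /closed_disc /= expr0n /= addr0.
by rewrite closed_discE eunorm_rescale.
Qed.

Lemma slide_disc v u r : closed_disc v -> closed_disc u -> 0 <= r <= 1 ->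
  closed_disc (slide v u r).
Proof.
move=> hv hu hr; rewrite /slide; case: eqP => _; last exact: segm_disc.
apply: rescale_disc; move/closed_discE: hv; move/closed_discE: hu.
have := eunorm_ge0 u; have := eunorm_ge0 v; nra.
Qed.

Lemma mirror_slide c v u r :
  slide (mirror c v) (mirror c u) r = mirror c (slide v u r).
Proof.
have h : segm (mirror c v) (mirror c u) r = mirror c (segm v u r).
  by rewrite /segm /mirror /=; congr pair; ring.
rewrite /slide !mirror_norm h; case: eqP => // _.
by rewrite /rescale mirror_norm /mirror /=; congr pair; ring.
Qed.

(** The segment stays in the half-plane of the cap and in the disc, and rescaling to norm 1 can only
    increase its positive scalar product with the midpoint. *)
Lemma slide_side k v u r : side k v -> side k u -> 0 <= r <= 1 ->
  side k (slide v u r).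
Proof.
rewrite !sideE // => -[nv hv] [nu hu] hr; rewrite /slide nu nv eqxx !mulr1.
rewrite subrK.
have c0 := cos_half_gt0 R hg; set c := cos _ in c0 hv hu *.
set m := bp _ in hv hu *.
have hm : c <= dotp (segm v u r) m.
  have -> : dotp (segm v u r) m = (1 - r) * dotp v m + r * dotp u m.
    by rewrite /dotp /segm /=; ring.
  nra.
have s0 : segm v u r != (0, 0).
  by apply/eqP => h; move: hm; rewrite h /dotp /=; lra.
have n1 := eunorm_rescale s0 ler01; split=> //.
have n0 : 0 < eunorm (segm v u r).
  rewrite lt_def eunorm_ge0 andbT.
  by apply: contra_neq s0 => h; apply: eudist_eq0; rewrite eunorm_dist.
have n2 : eunorm (segm v u r) <= 1.
  by apply/closed_discE/segm_disc => //; exact: eunorm1_disc.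
have -> : dotp (rescale 1 (segm v u r)) m =
    dotp (segm v u r) m / eunorm (segm v u r).
  by rewrite /dotp /rescale /=; ring.
by rewrite ler_pdivlMr //; nra.
Qed.

Lemma rescale_cont (T : topologicalType) (f : T -> R) (h : T -> R * R) (x : T) :
  {for x, continuous f} -> {for x, continuous h} -> eunorm (h x) != 0 ->
  {for x, continuous (fun y => rescale (f y) (h y))}.
Proof.
move=> cf ch hx.
have c1 : h y @[y --> x] --> h x by [].
have cn : eunorm (h y) @[y --> x] --> eunorm (h x).
  exact: (@cvg_comp _ _ _ h (@eunorm R) _ _ _ ch (@eunorm_cont R _)).
have ck : f y / eunorm (h y) @[y --> x] --> f x / eunorm (h x).
  by apply: cvgM; [exact: cf|apply: cvgV].
have c2 : (h y).1 @[y --> x] --> (h x).1.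
  exact: (@cvg_comp _ _ _ h fst _ _ _ ch cvg_fst).
have c3 : (h y).2 @[y --> x] --> (h x).2.
  exact: (@cvg_comp _ _ _ h snd _ _ _ ch cvg_snd).
exact: (cvg_pair (cvgM ck c2) (cvgM ck c3)).
Qed.

Lemma segm_cont u : continuous (fun z : (R * R) * R => segm z.1 u z.2).
Proof.
have c1 : continuous (fun z : (R * R) * R => z.1) by move=> z; exact: cvg_fst.
have c2 : continuous (fun z : (R * R) * R => z.2) by move=> z; exact: cvg_snd.
have c11 : continuous (fun z : (R * R) * R => z.1.1).
  move=> z; exact: (@cvg_comp _ _ _ _ fst _ _ _ (c1 z) cvg_fst).
have c12 : continuous (fun z : (R * R) * R => z.1.2).
  move=> z; exact: (@cvg_comp _ _ _ _ snd _ _ _ (c1 z) cvg_snd).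
by apply: pair_cont => z; apply: cvgD; apply: cvgM;
  try (apply: cvgB); (exact: cvg_cst || exact: c2 || exact: c11 || exact: c12).
Qed.

(** For [u] on the circle, a segment starting at distance less than 1 from [u] avoids the origin,
    where rescaling is discontinuous. *)
Lemma slide_cont u (z : (R * R) * R) : eudist z.1 u < 1 -> 0 <= z.2 <= 1 ->
  {for z, continuous (fun z => slide z.1 u z.2)}.
Proof.
move=> hz hr; rewrite /slide; case: eqP => nu; last exact: segm_cont.
apply: rescale_cont; last first.
- have h := eunorm_le_dist u (segm z.1 u z.2).
  apply/eqP => e; move: h; rewrite e eudistC eudist_segm // nu addr0.
  have := eudist_ge0 z.1 u; nra.
- exact: segm_cont.
have c1 : continuous (fun z : (R * R) * R => z.1) by move=> ?; exact: cvg_fst.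
have c2 : continuous (fun z : (R * R) * R => z.2) by move=> ?; exact: cvg_snd.
have c3 : continuous (fun z : (R * R) * R => eunorm z.1).
  move=> y; exact: (@cvg_comp _ _ _ _ (@eunorm R) _ _ _ (c1 y) (@eunorm_cont R _)).
by apply: cvgD; apply: cvgM;
  try (apply: cvgB); (exact: cvg_cst || exact: c2 || exact: c3).
Qed.

End Deformation.

(** * Lifts to the disc *)

Section Gluing.
Variables (R : realType) (g : nat).
Hypothesis hg : (0 < g)%N.
Local Notation bp := (@boundary_point R g).
Local Notation side := (@side R g).
Local Notation mirror := (@mirror R g).
Local Notation glued := (@glued R g).
Implicit Types (u v w p : R * R) (r s t : R).

Lemma glued_refl u : glued u u. Proof. exact: rst_refl. Qed.
Lemma glued_sym u v : glued u v -> glued v u. Proof. exact: rst_sym. Qed.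
Lemma glued_trans v u w : glued u v -> glued v w -> glued u w.
Proof. exact: rst_trans. Qed.

Lemma glued_a i t : (i < g)%N -> t \in `[0, 1] ->
  glued (bp ((4 * i)%:R + t)) (bp ((4 * i + 3)%:R - t)).
Proof. by move=> *; apply: rst_step; exact: pair_a. Qed.

Lemma glued_b i t : (i < g)%N -> t \in `[0, 1] ->
  glued (bp ((4 * i + 1)%:R + t)) (bp ((4 * i + 4)%:R - t)).
Proof. by move=> *; apply: rst_step; exact: pair_b. Qed.

Lemma glued_norm u v : glued u v -> u = v \/ eunorm u = 1 /\ eunorm v = 1.
Proof.
elim=> {u v} [u v h|u|u v _ [->|[? ?]]|u v w _ [->|[? ?]] _ [<-|[? ?]]];
  try by [left|right].
by right; case: h => i t _ _; rewrite !bp_norm.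
Qed.

Lemma glued_disc u v : glued u v -> closed_disc u -> closed_disc v.
Proof. by case/glued_norm => [->//|[_ h] _]; exact: eunorm1_disc. Qed.

(** A finite set stable under all reflections [mirror c] with [c] a natural number; it bounds a
    gluing class without following the chains of gluings. *)
Definition dihedral s : set (R * R) :=
  [set p | exists j : nat, p = bp (s + j%:R) \/ p = bp (j%:R - s)].

Lemma mirrorK c : involutive (mirror c).
Proof.
move=> [x y]; rewrite /mirror /=.
have := cos2Dsin2 (angle g c); move: (cos _) (sin _) => a b h.
congr pair; last (transitivity ((a ^+ 2 + b ^+ 2) * y);
  first by ring); last by rewrite h mul1r.
by transitivity ((a ^+ 2 + b ^+ 2) * x); [ring|rewrite h mul1r].
Qed.

Lemma dihedral_mirror (c : nat) s p : dihedral s p -> dihedral s (mirror c%:R p).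
Proof.
(* The parameter [c - j] may be negative; modulo 4g it is replaced by the natural number
   [c + (4g - 1) * j]. *)
have h (j : nat) : (c + (4 * g).-1 * j)%:R = c%:R - j%:R + (4 * g)%:R * j%:R :> R.
  have /prednK e : (0 < 4 * g)%N by rewrite muln_gt0.
  rewrite -[in RHS]e natrD natrM -natr1; ring.
case=> j [->|->]; rewrite mirror_bp; exists (c + (4 * g).-1 * j)%N.
  right; rewrite h -(bp_periodn hg _ j); congr boundary_point; ring.
left; rewrite h -(bp_periodn hg _ j); congr boundary_point; ring.
Qed.

Lemma side_pairing_mirror u v : side_pairing g u v ->
  exists c : nat, v = mirror c%:R u.
Proof.
case=> i t hi _.
  exists (8 * i + 3)%N; rewrite mirror_bp; congr boundary_point.
  ring.
exists (8 * i + 5)%N; rewrite mirror_bp; congr boundary_point.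
ring.
Qed.

Lemma dihedral_glued s u v : glued u v -> dihedral s u <-> dihedral s v.
Proof.
elim=> {u v} [u v|u|u v _ []|u v w _ [h1 h2] _ [h3 h4]] //.
  case/side_pairing_mirror => c ->; split; first exact: dihedral_mirror.
  by move/(@dihedral_mirror c); rewrite mirrorK.
by split=> [/h1/h3|/h4/h2].
Qed.

Lemma dihedral_finite s : finite_set (dihedral s).
Proof.
have hM : (0 < 4 * g)%N by rewrite muln_gt0.
pose f (j : bool * 'I_(4 * g)) := bp (if j.1 then s + j.2%:R else j.2%:R - s).
apply: (@sub_finite_set _ _ (f @` setT)); last exact: finite_image.
have h (j : nat) : j%:R = (j %% (4 * g))%:R + (4 * g)%:R * (j %/ (4 * g))%:R :> R.
  by rewrite -natrM -natrD addnC mulnC -divn_eq.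
move=> p [j [->|->]].
  exists (true, Ordinal (ltn_pmod j hM)) => //.
  by rewrite /f /= [in RHS]h addrA bp_periodn.
exists (false, Ordinal (ltn_pmod j hM)) => //.
rewrite /f /= [in RHS]h -(bp_periodn hg _ (j %/ (4 * g))).
by congr boundary_point; ring.
Qed.

Lemma glued_finite u : finite_set [set v | glued u v].
Proof.
have [/(bp_surj hg) [s [_ ->]]|h] := pselect (eunorm u = 1).
  apply: sub_finite_set (dihedral_finite s) => v /(dihedral_glued s) h.
  by apply/h; exists 0%N; left; rewrite addr0.
apply: sub_finite_set (finite_set1 u) => v /glued_norm [->//|[]] //.
Qed.

Definition side_ball (e : R) u : Prop := forall k v, (k < 4 * g)%N ->
  side k v -> eudist v u < e -> side k u.

Lemma finite_radius (T : eqType) (A : set T) (P : T -> R -> Prop) :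
  finite_set A -> (forall a e e', e' <= e -> P a e -> P a e') ->
  (forall a, A a -> exists2 e, 0 < e & P a e) ->
  exists2 e, 0 < e & forall a, A a -> P a e.
Proof.
case/finite_seqP => l -> mono; elim: l => [|a l IH] h; first by exists 1.
have [b bl|e1 e10 h1] := IH; first by apply: h; rewrite /= in_cons bl orbT.
have [|e2 e20 h2] := h a; first by rewrite /= mem_head.
exists (Order.min e1 e2) => [|b]; first by rewrite lt_min e10.
rewrite /= in_cons => /predU1P[->|bl].
  by apply: mono h2; rewrite ge_min lexx orbT.
by apply: mono (h1 _ bl); rewrite ge_min lexx.
Qed.

Lemma side_ball_ex u : exists2 e, 0 < e & side_ball e u.
Proof.
have [|||e e0 h] := @finite_radius 'I_(4 * g) setT (fun k e => forall v,
    side k v -> eudist v u < e -> side k u).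
- exact: finite_finset.
- by move=> k e e' ee h v sv vu; apply: h sv _; exact: lt_le_trans vu ee.
- move=> k _; have [ku|ku] := pselect (side k u); first by exists 1.
  have : nbhs u (~` side k).
    by apply: open_nbhs_nbhs; split=> //; by rewrite openC; exact: side_closed.
  move/nbhs_ballP => [e /= e0 h]; exists e => // v sv vu.
  exfalso; apply: (h v) => //; rewrite -ball_normE /=.
  by apply: le_lt_trans (norm_le_eudist _ _) _; rewrite eudistC.
by exists e => // k v hk; exact: (h (Ordinal hk) I).
Qed.

(** [side_ball] ensures that a gluing move of a point close to a lift can be performed on the lift
    too, the separation by [2 * e] makes the close lift unique, and [e <= 2^-1] keeps [slide]
    continuous. *)
Definition good_radius (e : R) u : Prop := [/\ 0 < e, e <= 2^-1 &
  forall u', glued u u' -> side_ball e u' /\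
    forall u'', glued u' u'' -> eudist u' u'' < 2 * e -> u' = u''].

Lemma good_radius_ex u : exists e, good_radius e u.
Proof.
have [|||e e0 h] := @finite_radius _ [set v | glued u v] (fun v e => side_ball e v /\
    forall w, glued v w -> eudist v w < 2 * e -> v = w).
- exact: glued_finite.
- move=> v e e' ee [h1 h2]; split.
    by move=> k w hk kw wv; apply: h1 kw _ => //; exact: lt_le_trans wv ee.
  move=> w vw d; apply: h2 => //; lra.
- move=> v _; have [e1 e10 h1] := side_ball_ex v.
  have [|||e2 e20 h2] := @finite_radius _ [set w | glued v w] (fun w e =>
    eudist v w < 2 * e -> v = w).
  + exact: glued_finite.
  + by move=> w e e' ee h d; apply: h; lra.
  + move=> w _; have [->|vw] := pselect (v = w); first by exists 1.
    have d0 : 0 < eudist v w.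
      rewrite lt_def eudist_ge0 andbT; apply/eqP => h.
      by apply: vw; exact: eudist_eq0.
    by exists (eudist v w / 2); [lra|move=> ?; exfalso; lra].
  exists (Order.min e1 e2); first by rewrite lt_min e10.
  have [m1 m2] : Order.min e1 e2 <= e1 /\ Order.min e1 e2 <= e2.
    by rewrite !ge_min !lexx orbT.
  move: (Order.min _ _) m1 m2 => m m1 m2; split=> [k w hk kw wv|w vw d].
    by apply: h1 kw _ => //; exact: lt_le_trans wv m1.
  by apply: h2 => //; lra.
exists (Order.min e 2^-1).
have [m1 m2] : Order.min e 2^-1 <= e /\ Order.min e 2^-1 <= 2^-1.
  by rewrite !ge_min !lexx orbT.
have m0 : 0 < Order.min e 2^-1 by rewrite lt_min e0 /=.
move: (Order.min _ _) m0 m1 m2 => m m0 m1 m2; split=> // v uv.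
have [h1 h2] := h _ uv; split=> [k w hk kw wv|w vw d].
  by apply: h1 kw _ => //; exact: lt_le_trans wv m1.
by apply: h2 => //; lra.
Qed.

Lemma good_radius_glued e u v : glued u v -> good_radius e u -> good_radius e v.
Proof.
move=> uv [e0 e1 h]; split=> // w vw; apply: h; exact: glued_trans uv vw.
Qed.

(** A potential on the disc whose jump across each pair of sides is constant; such a [lam] defines a
    [G]-valued cocycle on the surface. *)
Definition label_const (G : groupType) (lam : R * R -> G) (A B : nat -> G) : Prop :=
  forall i t, (i < g)%N -> t \in `[0, 1] ->
    (lam (bp ((4 * i)%:R + t)) * (lam (bp ((4 * i + 3)%:R - t)))^-1 = A i /\
     lam (bp ((4 * i + 1)%:R + t)) * (lam (bp ((4 * i + 4)%:R - t)))^-1 = B i)%g.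

Lemma label_const1 (G : groupType) :
  label_const (fun=> 1%g : G) (fun=> 1%g) (fun=> 1%g).
Proof. by move=> i t _ _; rewrite mulgV. Qed.

Section Lifts.
Variables (G : groupType) (lam : R * R -> G) (A B : nat -> G).
Hypothesis lamP : label_const lam A B.

(** Transport of a lift [u] along a gluing move of the nearby point [v]. The equality of jumps
    serves the cocycle, the gluing of the slides serves the contraction of charts. *)
Definition parallel v u v' u' : Prop :=
  [/\ glued u u', eudist v' u' = eudist v u,
      (lam v * (lam v')^-1 = lam u * (lam u')^-1)%g &
      forall r, 0 <= r <= 1 -> glued (slide v u r) (slide v' u' r)].

Lemma parallel_trans v u v' u' v'' u'' :
  parallel v u v' u' -> parallel v' u' v'' u'' -> parallel v u v'' u''.
Proof.
move=> [h1 h2 h3 h4] [k1 k2 k3 k4]; split.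
- exact: glued_trans h1 k1.
- by rewrite k2.
- by rewrite -[lam v](mulgVK (lam v')) h3 -mulgA k3 !mulgA mulgVK.
- by move=> r hr; exact: glued_trans (h4 r hr) (k4 r hr).
Qed.

Lemma parallel_pair (k c : nat) a e t u : (k < 4 * g)%N ->
  (forall t, t \in `[0, 1] -> glued (bp (k%:R + t)) (bp (c%:R - t)) /\
    (lam (bp (k%:R + t)) * (lam (bp (c%:R - t)))^-1 = a)%g) ->
  t \in `[0, 1] -> side_ball e u -> eudist (bp (k%:R + t)) u < e ->
  exists u', parallel (bp (k%:R + t)) u (bp (c%:R - t)) u'.
Proof.
move=> hk hkc ht hu d.
have [|t' ht' eu] := hu k _ hk _ d; first by exists t.
have mE x : bp (c%:R - x) = mirror (k + c)%:R (bp (k%:R + x)).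
  by rewrite mirror_bp natrD; congr boundary_point; ring.
exists (bp (c%:R - t')); rewrite eu; split.
- by have [] := hkc t' ht'.
- by rewrite !mE mirror_dist.
- by rewrite (hkc _ ht).2 (hkc _ ht').2.
move=> r hr.
have [||t'' ht'' e''] := @slide_side _ _ hg k (bp (k%:R + t)) (bp (k%:R + t')) r _ _ hr;
  [by exists t|by exists t'|].
by rewrite !mE mirror_slide e'' -mE; have [] := hkc t'' ht''.
Qed.

(* The side pairings are restrictions of reflections of the disc: a gluing move
   of [v] is followed by an isometric gluing move of the nearby lift [u]. *)
Lemma lift_parallel e u v v' : good_radius e u -> eudist v u < e ->
  glued v v' -> exists u', parallel v u v' u'.
Proof.
move=> hu d vv; suff : (forall u, good_radius e u -> eudist v u < e ->
     exists u', parallel v u v' u') /\ (forall u, good_radius e u ->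
     eudist v' u < e -> exists u', parallel v' u v u') by case=> h _; exact: h.
elim: vv => {u v v' hu d} [v v' h|v|v v' _ []|v v' v'' _ [a1 a2] _ [b1 b2]] //.
- have sym1 (t : R) : t \in `[0, 1] -> 1 - t \in `[0, 1].
    by rewrite !in_itv /= => /andP[t0 t1]; rewrite subr_ge0 t1 gerBl.
  have key : exists (k c : nat) a t, [/\ (k < 4 * g)%N, (0 < c <= 4 * g)%N,
     forall t, t \in `[0, 1] -> glued (bp (k%:R + t)) (bp (c%:R - t)) /\
     (lam (bp (k%:R + t)) * (lam (bp (c%:R - t)))^-1 = a)%g, t \in `[0, 1]
     & v = bp (k%:R + t) /\ v' = bp (c%:R - t)].
    case: h => i t hi ht.
      exists (4 * i)%N, (4 * i + 3)%N, (A i), t; split=> //; try lia.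
      by move=> s hs; split; [exact: glued_a|exact: (lamP hi hs).1].
    exists (4 * i + 1)%N, (4 * i + 4)%N, (B i), t; split=> //; try lia.
    by move=> s hs; split; [exact: glued_b|exact: (lamP hi hs).2].
  case: key => k [c [a [t [hk /andP[c0 hc] hkc ht [-> ->]]]]].
  (* After replacing [t] by [1 - t] the reversed pairing has the same form, so [parallel_pair]
     covers both directions. *)
  have sw : forall t, t \in `[0, 1] -> glued (bp (c.-1%:R + t)) (bp (k.+1%:R - t)) /\
     (lam (bp (c.-1%:R + t)) * (lam (bp (k.+1%:R - t)))^-1 = a^-1)%g.
    move=> s hs; have [h1 h2] := hkc _ (sym1 _ hs).
    have -> : c.-1%:R + s = c%:R - (1 - s) by rewrite -[in RHS](prednK c0) -natr1; ring.
    have -> : k.+1%:R - s = k%:R + (1 - s) by rewrite -natr1; ring.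
    by split; [exact: glued_sym|rewrite -h2 invgM invgK].
  split=> u [_ _ /(_ u (glued_refl u)) [hb _]] d.
    exact: parallel_pair hk hkc ht hb d.
  have e1 : bp (c%:R - t) = bp (c.-1%:R + (1 - t)).
    by congr boundary_point; rewrite -[in LHS](prednK c0) -natr1; ring.
  have e2 : bp (k%:R + t) = bp (k.+1%:R - (1 - t)).
    by congr boundary_point; rewrite -natr1; ring.
  rewrite e1 in d *; rewrite e2.
  by apply: parallel_pair sw (sym1 _ ht) hb d; lia.
- split=> u hu d; exists u; split=> //; try exact: glued_refl;
  by rewrite ?mulgV // => r _; exact: glued_refl.
split=> u hu d.
  have [u' p1] := a1 u hu d; have [g1 d1 _ _] := p1.
  have [||u'' p2] := b1 u'; [exact: good_radius_glued g1 hu|by rewrite d1|].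
  by exists u''; exact: parallel_trans p1 p2.
have [u' p1] := b2 u hu d; have [g1 d1 _ _] := p1.
have [||u'' p2] := a2 u'; [exact: good_radius_glued g1 hu|by rewrite d1|].
by exists u''; exact: parallel_trans p1 p2.
Qed.

End Lifts.
End Gluing.

(** * Charts of the surface and the cocycle of a potential *)

Record charted_surface (R : realType) (g : nat) (X : topologicalType) := Charted {
  cproj : R * R -> X;
  clift : X -> R * R;
  crad : X -> R;
  surf_hausdorff : hausdorff_space X;
  cproj_cont : {within @closed_disc R, continuous cproj};
  clift_disc : forall y, closed_disc (clift y);
  cliftK : forall y, cproj (clift y) = y;
  cproj_glued : forall u v, closed_disc u -> closed_disc v ->
    (cproj u = cproj v <-> glued g u v);
  cradP : forall y, good_radius g (crad y) (clift y)
}.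

Lemma charted_surface_ex (R : realType) (g : nat) (X : topologicalType) :
  (0 < g)%N -> closed_orientable_surface R g X -> inhabited (charted_surface R g X).
Proof.
move=> hg [hX [q [qc qs qg]]].
have /choice [l hl] : forall y, exists v, closed_disc v /\ q v = y.
  move=> y; have : (q @` @closed_disc R) y by rewrite qs.
  by case=> v vD <-; exists v.
have /choice [r hr] : forall y, exists e, good_radius g e (l y).
  by move=> y; exact: good_radius_ex.
by constructor; apply: (@Charted _ _ _ q l r) => // y; [exact: (hl y).1|exact: (hl y).2].
Qed.

Section Charts.
Variables (R : realType) (g : nat) (X : topologicalType).
Hypothesis hg : (0 < g)%N.
Variable Q : charted_surface R g X.
Local Notation q := (cproj Q).
Local Notation lift := (clift Q).
Local Notation rad := (crad Q).
Local Notation glued := (@glued R g).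
Implicit Types (x y z : X) (u v w : R * R).

Definition fibre x : set (R * R) := [set u | glued (lift x) u].

Lemma fibre_disc x u : fibre x u -> closed_disc u.
Proof. by move/glued_disc; apply; exact: clift_disc. Qed.

Lemma fibreE x u : fibre x u <-> closed_disc u /\ q u = x.
Proof.
split=> [h|[uD <-]].
  have uD := fibre_disc h; split=> //.
  by rewrite -[RHS](cliftK Q); symmetry; apply/cproj_glued => //; exact: clift_disc.
by apply/(cproj_glued Q) => //; [exact: clift_disc|exact: cliftK].
Qed.

Lemma fibre_lift x : fibre x (lift x). Proof. exact: glued_refl. Qed.

Lemma fibre_glued x u v : glued u v -> fibre x u -> fibre x v.
Proof. by move=> uv xu; exact: glued_trans xu uv. Qed.

Lemma fibre2 x u v : fibre x u -> fibre x v -> glued u v.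
Proof. by move=> xu xv; apply: glued_trans xv; exact: glued_sym. Qed.

Lemma rad_gt0 x : 0 < rad x. Proof. by case: (cradP Q x). Qed.

Lemma rad_good x u : fibre x u -> good_radius g (rad x) u.
Proof. by move=> xu; exact: good_radius_glued xu (cradP Q x). Qed.

Lemma fibre_sep x u v : fibre x u -> fibre x v -> eudist u v < 2 * rad x -> u = v.
Proof.
move=> xu xv; have [_ _ /(_ u (glued_refl g u)) [_ h]] := rad_good xu.
by apply: h; exact: fibre2 xu xv.
Qed.

Definition chart x (e : R) : set X :=
  [set y | exists v u, [/\ fibre y v, fibre x u & eudist v u < e]].

Lemma chart_fibre x e y v : e <= rad x -> chart x e y -> fibre y v ->
  exists2 u, fibre x u & eudist v u < e.
Proof.
move=> he [w [u [yw xu d]]] yv.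
(* Only the geometric clauses are wanted, so the potential is constant in a trivial group. *)
have [|u' [h1 h2 _ _]] := lift_parallel hg (label_const1 {perm 'I_1})
  (rad_good xu) _ (fibre2 yw yv); first exact: lt_le_trans d he.
by exists u'; [exact: fibre_glued h1 xu|rewrite h2].
Qed.

(** The complement is the image of a compact part of the disc, and [X] is Hausdorff. *)
Lemma chart_open x e : e <= rad x -> open (chart x e).
Proof.
move=> he; pose C := @closed_disc R `&`
  \bigcap_(u in fibre x) [set v | e <= eudist v u].
have cC : compact C.
  apply: (subclosed_compact _ (@compact_closed_disc R)); last by move=> v [].
  apply: closedI; first exact: closed_closed_disc.
  apply: closed_bigI => u _.
  exact: (proj1 (continuous_closedP _) (@eudist_cont R u) _ (@closed_ge R e)).
have -> : chart x e = ~` (q @` C).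
  apply/seteqP; split=> [y xy [v [vD hv] e1]|y hy].
    have yv : fibre y v by apply/fibreE.
    have [u xu d] := chart_fibre he xy yv.
    by have := hv u xu; rewrite /= leNgt d.
  have [//|h] := pselect (chart x e y); case: hy; exists (lift y); last exact: cliftK.
  split; first exact: clift_disc.
  move=> u xu /=; rewrite leNgt; apply/negP => d.
  by apply: h; exists (lift y), u; split=> //; exact: fibre_lift.
rewrite openC; apply: compact_closed; first exact: (surf_hausdorff Q).
have CD : C `<=` @closed_disc R by move=> v [].
exact (continuous_compact (continuous_subspaceW CD (@cproj_cont _ _ _ Q)) cC).
Qed.

Lemma chart_center x e : 0 < e -> chart x e x.
Proof.
by move=> e0; exists (lift x), (lift x); split; rewrite ?eudistxx //; exact: fibre_lift.
Qed.

Definition lift_near x v : R * R := xget v [set u | fibre x u /\ eudist v u < rad x].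

Lemma lift_nearE x v u : fibre x u -> eudist v u < rad x -> lift_near x v = u.
Proof.
move=> xu d; rewrite /lift_near; case: xgetP => [w _ [xw d']|/(_ u)[]] //.
apply: (fibre_sep xw xu); have := eudist_triangle w v u; rewrite (eudistC w v); lra.
Qed.

(** The factor 4 leaves room for the triangle inequalities that compare two overlapping charts. *)
Definition schart x := chart x (rad x / 4).

Lemma schart_nbhs x : nbhs x (schart x).
Proof.
apply: open_nbhs_nbhs; split; first by apply: chart_open; have := rad_gt0 x; lra.
by apply: chart_center; have := rad_gt0 x; lra.
Qed.

Lemma schart_lift_near x y v : schart x y -> fibre y v ->
  fibre x (lift_near x v) /\ eudist v (lift_near x v) < rad x / 4.
Proof.
have r0 := rad_gt0 x; move=> xy yv.
have [|u xu d] := chart_fibre _ xy yv; first by lra.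
by rewrite (@lift_nearE x v u) //; lra.
Qed.

Section Cocycle.
Variables (G : groupType) (lam : R * R -> G) (A B : nat -> G).
Hypothesis lamP : label_const g lam A B.

Definition trans x y z : G :=
  (lam (lift_near x (lift y)) * (lam (lift_near x (lift z)))^-1)%g.

(** Let [x] have the larger radius. The move from [u'] to [t'] carries [u] in parallel to a lift of
    [x] closer than [2 * rad x] to [t], hence equal to [t]. *)
Lemma trans_indep x x' y z : schart x y -> schart x z ->
  schart x' y -> schart x' z -> trans x y z = trans x' y z.
Proof.
wlog le : x x' / rad x' <= rad x => [hw xy xz x'y x'z|xy xz x'y x'z].
  by have [h|/ltW h] := leP (rad x') (rad x); [|symmetry]; exact: hw.
have [h1 h2] := schart_lift_near xy (fibre_lift y).
have [h3 h4] := schart_lift_near xz (fibre_lift z).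
have [k1 k2] := schart_lift_near x'y (fibre_lift y).
have [k3 k4] := schart_lift_near x'z (fibre_lift z).
rewrite /trans; set u := lift_near x _ in h1 h2 *; set t := lift_near x _ in h3 h4 *.
set u' := lift_near x' _ in k1 k2 *; set t' := lift_near x' _ in k3 k4 *.
have r0 := rad_gt0 x.
have d1 := eudist_triangle u' (lift y) u; have d2 := eudist_triangle t (lift z) t'.
rewrite (eudistC u' (lift y)) in d1; rewrite (eudistC t (lift z)) in d2.
have [|t1 [e1 e2 e3 _]] := lift_parallel hg lamP (rad_good h1) _ (fibre2 k1 k3); first lra.
rewrite e3; congr (_ * (lam _)^-1)%g.
apply: (fibre_sep h3 (fibre_glued e1 h1)).
have := eudist_triangle t t' t1; lra.
Qed.

Definition cocycle y z : G :=
  trans (xget y [set x | schart x y /\ schart x z]) y z.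

Lemma cocycleE x y z : schart x y -> schart x z -> cocycle y z = trans x y z.
Proof.
move=> xy xz; rewrite /cocycle; case: xgetP => [x' _ [h1 h2]|/(_ x)[]] //.
exact: trans_indep.
Qed.

Lemma cocycle_mul x y z (w : X) : schart x y -> schart x z -> schart x w ->
  (cocycle y z * cocycle z w)%g = cocycle y w.
Proof.
by move=> xy xz xw; rewrite !(@cocycleE x) // /trans mulgA mulgVK.
Qed.

Lemma cocyclexx y : cocycle y y = 1%g.
Proof. by rewrite (@cocycleE y) ?/trans ?mulgV //; exact: nbhs_singleton (schart_nbhs y). Qed.

(** On small parts of the disc the cocycle is the coboundary of [lam (lift (q v)) * (lam v)^-1], so
    that holonomy along the image of a disc path telescopes. *)
Lemma cocycle_disc u v v' : closed_disc u -> closed_disc v -> closed_disc v' ->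
  eudist v u < rad (q u) / 4 -> eudist v' u < rad (q u) / 4 ->
  cocycle (q v) (q v') =
  (lam (lift (q v)) * (lam v)^-1 * (lam v' * (lam (lift (q v')))^-1))%g.
Proof.
move=> uD vD v'D d d'; have r0 := rad_gt0 (q u).
have fu : fibre (q u) u by apply/fibreE.
have fv : fibre (q v) v by apply/fibreE.
have fv' : fibre (q v') v' by apply/fibreE.
rewrite (@cocycleE (q u)); try by [exists v, u|exists v', u].
have [|w [h1 h2 h3 _]] := lift_parallel hg lamP (rad_good fu) _ (glued_sym fv); first lra.
have [|w' [k1 k2 k3 _]] := lift_parallel hg lamP (rad_good fu) _ (glued_sym fv'); first lra.
rewrite /trans (@lift_nearE _ _ w); [|exact: fibre_glued h1 fu|by rewrite h2; lra].
rewrite (@lift_nearE _ _ w'); [|exact: fibre_glued k1 fu|by rewrite k2; lra].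
rewrite k3 -[X in _ = (X * _)%g]invgK [in RHS]invgM invgK h3 invgM invgK.
by rewrite !mulgA mulgVK.
Qed.

End Cocycle.
End Charts.

(** * Continuity on subsets, Lebesgue numbers, concatenation *)

Lemma within_comp (T U V : topologicalType) (A : set T) (B : set U)
    (h : T -> U) (f : U -> V) :
  {within B, continuous f} -> {within A, continuous h} ->
  (forall x, A x -> B (h x)) -> {within A, continuous (fun x => f (h x))}.
Proof.
move=> /subspace_continuousP cf /subspace_continuousP ch AB.
apply/subspace_continuousP => x Ax O hO.
have := ch x Ax _ (cf _ (AB _ Ax) O hO).
rewrite /= /nbhs /= /within /= => k.
by apply: filterS k => y hy Ay; apply: hy => //; exact: AB.
Qed.

Lemma eq_within (T U : topologicalType) (A : set T) (f h : T -> U) :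
  (forall x, A x -> f x = h x) -> {within A, continuous f} ->
  {within A, continuous h}.
Proof.
by move=> fh; apply: (@subspace_eq_continuous _ A _ f h) => x /set_mem; exact: fh.
Qed.

Lemma pair_within (T U V : topologicalType) (A : set T) (f : T -> U) (h : T -> V) :
  {within A, continuous f} -> {within A, continuous h} ->
  {within A, continuous (fun x => (f x, h x))}.
Proof.
move=> /subspace_continuousP cf /subspace_continuousP ch.
by apply/subspace_continuousP => x Ax; exact: (cvg_pair (cf x Ax) (ch x Ax)).
Qed.

Lemma fst_within (T U : topologicalType) (A : set (T * U)) :
  {within A, continuous (fun z => z.1)}.
Proof. by apply: continuous_subspaceT => z; exact: cvg_fst. Qed.

Lemma snd_within (T U : topologicalType) (A : set (T * U)) :
  {within A, continuous (fun z => z.2)}.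
Proof. by apply: continuous_subspaceT => z; exact: cvg_snd. Qed.

Section Lebesgue.
Variables (R : realType) (T : topologicalType).

Definition unit_square : set (R * R) := `[0, 1] `*` `[0, 1].

(** Near-covering compactness: half of the radius at a point is spent on moving the centre, the
    other half on [n%:R^-1]. *)
Lemma lebesgue_square (F : R * R -> T) (O : T -> set T) :
  {within unit_square, continuous F} ->
  (forall a, unit_square a -> nbhs (F a) (O (F a))) ->
  \forall n \near \oo, forall a, unit_square a -> exists2 e, unit_square e &
    forall b, unit_square b -> `|a - b| <= n%:R^-1 -> O (F e) (F b).
Proof.
move=> cF hO.
have /compact_near_coveringP cv : compact unit_square.
  by apply: compact_setX; exact: segment_compact.
apply: (cv nat \oo (fun n a => exists2 e, unit_square e & forall b,
   unit_square b -> `|a - b| <= n%:R^-1 -> O (F e) (F b))) => a Ia.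
have := (proj1 (subspace_continuousP _ _) cF a Ia) _ (hO a Ia).
move/nbhs_ballP => [e /= e0 he].
exists (ball a (e / 2), [set n : nat | n%:R^-1 < e / 2]) => /=.
  split; first by apply: nbhsx_ballx; rewrite divr_gt0.
  have h2 : 0 < e / 2 by rewrite divr_gt0.
  near=> n; rewrite /= invf_plt ?posrE //; last by near: n; exact: nbhs_infty_gtr.
  near: n; exact: nbhs_infty_gtr.
move=> [a' n] /= [h1 h2]; exists a => // b Ib d.
apply: he => //; move: h1; rewrite -!ball_normE /= => h1.
by have := ler_distD a' a b; lra.
Unshelve. all: by end_near.
Qed.

Lemma lebesgue_path (f : R -> T) (O : T -> set T) :
  {within `[0, 1], continuous f} ->
  (forall a, a \in `[0, 1] -> nbhs (f a) (O (f a))) ->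
  \forall n \near \oo, forall a, a \in `[0, 1] -> exists2 e, e \in `[0, 1] &
    forall b, b \in `[0, 1] -> `|a - b| <= n%:R^-1 -> O (f e) (f b).
Proof.
move=> cf hO.
have cF : {within unit_square, continuous (fun p => f p.1)}.
    apply: (within_comp cf); last by move=> [s t] [].
  by apply: continuous_subspaceT => x; exact: cvg_fst.
have hO' a : unit_square a -> nbhs (f a.1) (O (f a.1)) by case=> h _; exact: hO.
apply: filterS (lebesgue_square cF hO') => n h a ha.
have z0 : 0 \in `[0, 1 : R] by rewrite in_itv /= lexx ler01.
have [|[e e'] [/= he _] hy] := h (a, 0); first by split.
exists e => // b hb d; apply: (hy (b, 0)); first by split.
by rewrite prod_normE /= subrr normr0 ge_max d /= invr_ge0.
Qed.

End Lebesgue.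

Lemma concat_within (R : realType) (T : topologicalType) (f h : R -> T) :
  {within `[0, 1], continuous f} -> {within `[0, 1], continuous h} -> f 1 = h 0 ->
  {within `[0, 1], continuous (loop_concat f h)}.
Proof.
move=> cf ch fh.
have E : `[0 : R, 1]%classic = `[0, 2^-1] `|` `[2^-1, 1].
  apply/seteqP; split=> x; rewrite /= !in_itv /=; last by case; lra.
  by move=> /andP[x0 x1]; have [?|?] := leP x 2^-1; [left|right]; lra.
rewrite E; apply: withinU_continuous.
- exact: interval_closed.
- exact: interval_closed.
- refine (eq_within (f := fun s : R => f (2 * s)) _ _).
    by move=> x /=; rewrite in_itv /= /loop_concat => /andP[_ ->].
  apply: (within_comp cf) => [|x /=]; last by rewrite !in_itv /=; lra.
  by apply: continuous_subspaceT => x; apply: cvgM; [exact: cvg_cst|exact: cvg_id].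
refine (eq_within (f := fun s : R => h (2 * s - 1)) _ _).
  move=> x /=; rewrite in_itv /= /loop_concat => /andP[x0 x1].
  case: ifP => // x2; have -> : x = 2^-1 by lra.
  by rewrite divff // subrr fh.
apply: (within_comp ch) => [|x /=]; last by rewrite !in_itv /=; lra.
by apply: continuous_subspaceT => x; apply: cvgB; [apply: cvgM|];
  (exact: cvg_cst || exact: cvg_id).
Qed.

Lemma concat0 (R : realType) (T : Type) (f h : R -> T) : loop_concat f h 0 = f 0.
Proof. by rewrite /loop_concat invr_ge0 ler0n mulr0. Qed.

Lemma concat1 (R : realType) (T : Type) (f h : R -> T) : loop_concat f h 1 = h 1.
Proof.
rewrite /loop_concat ifF; last by apply/negbTE; rewrite -ltNge invf_lt1 ?ltr1n.
by congr h; rewrite mulr1; ring.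
Qed.

(** * Products of a cocycle along a discrete path *)

Section Walk.
Variables (X : Type) (G : groupType) (c : X -> X -> G).

Fixpoint walk (p : nat -> X) (n : nat) : G :=
  if n is m.+1 then (walk p m * c (p m) (p m.+1))%g else 1%g.

Lemma eq_walk p p' n : (forall i, (i <= n)%N -> p i = p' i) -> walk p n = walk p' n.
Proof.
elim: n => // n IH h /=; rewrite IH ?h // => i hi.
by apply: h; exact: leqW.
Qed.

Lemma walk_cat p m n : walk p (m + n) = (walk p m * walk (fun i => p (m + i)%N) n)%g.
Proof.
by elim: n => [|n IH]; rewrite ?addn0 ?mulg1 // addnS /= IH mulgA addnS.
Qed.

Lemma walk_potential (mu : nat -> G) p n :
  (forall i, (i < n)%N -> c (p i) (p i.+1) = (mu i * (mu i.+1)^-1)%g) ->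
  walk p n = (mu 0%N * (mu n)^-1)%g.
Proof.
elim: n => [|n IH] h /=; first by rewrite mulgV.
by rewrite IH ?h // => [|i hi]; [rewrite mulgA mulgVK|apply: h; exact: leqW].
Qed.

Lemma walk_refine p n k :
  (forall i, (i < n)%N -> walk (fun j => p (k * i + j)%N) k = c (p (k * i)%N) (p (k * i.+1)%N)) ->
  walk p (k * n) = walk (fun i => p (k * i)%N) n.
Proof.
elim: n => [|n IH] h /=; first by rewrite muln0.
rewrite mulnSr walk_cat IH => [|i hi]; first by rewrite h // mulnSr.
by apply: h; exact: leqW.
Qed.

(** Commuting squares placed side by side: the products along the two rails differ only by the end
    rungs. *)
Lemma walk_ladder p p' n :
  (forall i, (i < n)%N -> (c (p i) (p i.+1) * c (p i.+1) (p' i.+1) =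
                           c (p i) (p' i) * c (p' i) (p' i.+1))%g) ->
  (walk p n * c (p n) (p' n) = c (p 0%N) (p' 0%N) * walk p' n)%g.
Proof.
elim: n => [|n IH] h /=; first by rewrite mul1g mulg1.
rewrite -mulgA h // mulgA IH ?mulgA // => i hi; apply: h; exact: leqW.
Qed.

End Walk.

(** * Holonomy of a potential *)

Section Holonomy.
Variables (R : realType) (g : nat) (X : topologicalType).
Hypothesis hg : (0 < g)%N.
Variable Q : charted_surface R g X.
Local Notation q := (cproj Q).
Local Notation lift := (clift Q).
Local Notation rad := (crad Q).
Variables (G : groupType) (lam : R * R -> G) (A B : nat -> G).
Hypothesis lamP : label_const g lam A B.
Local Notation cc := (cocycle Q lam).
Implicit Types (f h : R -> X).

Definition holn (n : nat) f : G := walk cc (fun i => f (i%:R / n%:R)) n.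

(** One chart must contain the image of a whole interval and not just of two grid points, so that
    refining the grid leaves the product unchanged. *)
Definition fine (n : nat) f : Prop := (0 < n)%N /\ forall a, a \in `[0, 1] ->
  exists x, forall b, b \in `[0, 1] -> `|a - b| <= n%:R^-1 -> schart Q x (f b).

Lemma fine_near f : {within `[0, 1], continuous f} ->
  \forall n \near \oo, fine n f.
Proof.
move=> cf; have L := lebesgue_path cf (fun a _ => schart_nbhs hg Q (f a)).
apply: filterS2 (nbhs_infty_gt 0) L => n n0 h; split=> // a /h[e _ he].
by exists (f e).
Qed.

Lemma grid_in (n i : nat) : (i <= n)%N -> (i%:R / n%:R : R) \in `[0, 1].
Proof.
move=> h; rewrite in_itv /= divr_ge0 //=.
case: n h => [|n] h; first by rewrite invr0 mulr0.
by rewrite ler_pdivrMr // mul1r ler_nat.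
Qed.

Lemma walk_block x p n : (forall j, (j <= n)%N -> schart Q x (p j)) ->
  walk cc p n = cc (p 0%N) (p n).
Proof.
elim: n => [|n IH] h /=; first by rewrite (cocyclexx hg Q lamP).
rewrite IH => [|j hj]; last by apply: h; exact: leqW.
by rewrite (cocycle_mul hg lamP (x := x)) //; apply: h.
Qed.

Lemma holn_refine n k f : fine n f -> (0 < k)%N -> holn (k * n) f = holn n f.
Proof.
case=> n0 hf k0; rewrite /holn walk_refine => [|i hi].
  apply: eq_walk => i _; congr (f _).
  by rewrite !natrM -mulf_div divff ?mul1r // pnatr_eq0 -lt0n.
have k0' : 0 < k%:R :> R by rewrite ltr0n.
have n0' : 0 < n%:R :> R by rewrite ltr0n.
have [x hx] := hf _ (grid_in (ltnW hi)).
rewrite (@walk_block x) ?addn0 ?mulnSr // => j hj.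
apply: hx; first by apply: grid_in; rewrite -(leq_pmul2l k0) mulnSr in hi; lia.
have -> : i%:R / n%:R - (k * i + j)%:R / (k * n)%:R = - (j%:R / k%:R / n%:R) :> R.
  by rewrite natrD !natrM; field; rewrite !gt_eqF.
rewrite normrN ger0_norm ?divr_ge0 // ler_piMl ?invr_ge0 ?ler0n //.
by rewrite ler_pdivrMr // mul1r ler_nat.
Qed.

(** Both values agree with that of the common refinement [n * m]. *)
Lemma holn_fine n m f : fine n f -> fine m f -> holn n f = holn m f.
Proof.
move=> hn hm; rewrite -(holn_refine hn hm.1) mulnC.
by rewrite (holn_refine hm hn.1).
Qed.

Definition holo f : G := holn (xget 0%N [set n | fine n f]) f.

Lemma holoE n f : fine n f -> holo f = holn n f.
Proof.
by move=> h; rewrite /holo; case: xgetP => [m _ hm|/(_ n)//]; exact: holn_fine.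
Qed.

Lemma loop_fine x0 f h : is_loop x0 f -> is_loop x0 h ->
  \forall n \near \oo, fine n f /\ fine n h.
Proof.
case=> cf _ _ [ch _ _]; have := fine_near cf; have := fine_near ch.
by move=> h1 h2; near=> n; split; near: n.
Unshelve. all: by end_near.
Qed.

(** For a fine grid each small square is mapped into one chart, where the cocycle rule makes it
    commute; the end rungs of every ladder are trivial because the ends stay at [x0]. *)
Lemma holo_homotopy x0 f h : is_loop x0 f -> is_loop x0 h ->
  loop_homotopic x0 f h -> holo f = holo h.
Proof.
move=> lf lh [H [cH H1 H2]].
have L := lebesgue_square cH (fun a _ => schart_nbhs hg Q (H a)).
have : \forall n \near \oo, holo f = holo h; last by case=> n _; apply; exact: leqnn.
have Fi := loop_fine lf lh.
near=> n.
have [ff fh] : fine n f /\ fine n h by near: n.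
have hL : forall a, unit_square a -> exists2 e, unit_square e & forall b,
   unit_square b -> `|a - b| <= n%:R^-1 -> schart Q (H e) (H b) by near: n.
rewrite (holoE ff) (holoE fh).
pose p (j i : nat) := H (i%:R / n%:R, j%:R / n%:R).
have e0 : holn n f = walk cc (p 0%N) n.
  by apply: eq_walk => i hi; rewrite /p mul0r (H1 _ (grid_in hi)).1.
have e1 : holn n h = walk cc (p n) n.
  apply: eq_walk => i hi; rewrite /p divff ?pnatr_eq0 -?lt0n ?ff.1 //.
  by rewrite (H1 _ (grid_in hi)).2.
rewrite e0 e1; have : forall j, (j <= n)%N -> walk cc (p 0%N) n = walk cc (p j) n.
  elim=> // j IH hj; rewrite (IH (ltnW hj)).
  have e2 k : (k <= n)%N -> p k 0%N = x0 /\ p k n = x0.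
    move=> hk; have [h1 h2] := H2 _ (grid_in hk).
    by rewrite /p mul0r divff ?pnatr_eq0 -?lt0n ?ff.1.
  have := @walk_ladder _ _ cc (p j) (p j.+1) n.
  rewrite !(e2 j (ltnW hj)).1 !(e2 j (ltnW hj)).2 !(e2 j.+1 hj).1 !(e2 j.+1 hj).2.
  rewrite (cocyclexx hg Q lamP) mulg1 mul1g; apply => i hi.
  have [|[a b] _ hab] := hL (i%:R / n%:R, j%:R / n%:R).
    by split; apply: grid_in; exact: ltnW.
  have corner (s t : nat) : (s <= 1)%N -> (t <= 1)%N ->
      schart Q (H (a, b)) (p (t + j)%N (s + i)%N).
    move=> s1 t1; apply: hab; first by split; apply: grid_in => /=; lia.
    have nz : 0 <= n%:R^-1 :> R by rewrite invr_ge0.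
    have k (k1 k' : nat) : (k1 <= 1)%N -> `|k'%:R / n%:R - (k1 + k')%:R / n%:R| <= n%:R^-1 :> R.
      move=> hk1; rewrite natrD -mulrBl opprD addrCA subrr addr0 mulNr normrN.
      by rewrite ger0_norm ?divr_ge0 // ler_piMl // (ler_nat R _ 1).
    by rewrite prod_normE /= ge_max !k.
  rewrite !(cocycle_mul hg lamP (x := H (a, b))) //;
  by [exact: (corner 0%N 0%N)|exact: (corner 0%N 1%N)|exact: (corner 1%N 0%N)
     |exact: (corner 1%N 1%N)].
by apply.
Unshelve. all: by end_near.
Qed.

Lemma holn_concat n f h : (0 < n)%N -> f 1 = h 0 ->
  holn (n + n) (loop_concat f h) = (holn n f * holn n h)%g.
Proof.
move=> n0 fh; have n0' : 0 < n%:R :> R by rewrite ltr0n.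
have nz : n%:R != 0 :> R by rewrite gt_eqF.
have nn : (n + n)%:R = 2 * n%:R :> R by ring.
rewrite /holn walk_cat; congr mulg; apply: eq_walk => i hi; rewrite /loop_concat nn.
  rewrite ifT; last first.
    rewrite ler_pdivrMr ?mulr_gt0 // mulKf ?ler_nat //.
  by congr f; field.
have -> : 2 * ((n + i)%:R / (2 * n%:R)) - 1 = i%:R / n%:R :> R.
  by rewrite natrD; field.
case: ifP => //; case: i hi => [|i] hi.
  have -> : 2 * ((n + 0)%:R / (2 * n%:R)) = 1 :> R by rewrite addn0; field.
  by rewrite mul0r fh.
rewrite ler_pdivrMr ?mulr_gt0 // mulKf // ler_nat => h1; exfalso; lia.
Qed.

Lemma holo_concat x0 f h : is_loop x0 f -> is_loop x0 h ->
  holo (loop_concat f h) = (holo f * holo h)%g.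
Proof.
move=> lf lh; have Fi := loop_fine lf lh.
have [cf f0 f1] := lf; have [ch h0 h1] := lh.
have fh : f 1 = h 0 by rewrite f1.
have [N _ hN] := fine_near (concat_within cf ch fh).
have [M _ hM] := Fi.
pose n := maxn N M.
have hn : fine (n + n) (loop_concat f h).
  by apply: hN => /=; rewrite /n; lia.
have [ff fhh] : fine n f /\ fine n h by apply: hM; rewrite /= /n leq_maxr.
by rewrite (holoE hn) (holoE ff) (holoE fhh) holn_concat // ff.1.
Qed.

Definition disc_path (c : R -> R * R) : Prop :=
  {within `[0, 1], continuous c} /\ forall s, s \in `[0, 1] -> closed_disc (c s).

Lemma disc_path_proj c : disc_path c -> {within `[0, 1], continuous (fun s => q (c s))}.
Proof. by case=> cc cD; exact: (within_comp (@cproj_cont _ _ _ Q) cc cD). Qed.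

Lemma holn_disc_path c : disc_path c -> \forall n \near \oo,
  holn n (fun s => q (c s)) = (lam (lift (q (c 0%R))) * (lam (c 0%R))^-1 *
     (lam (c 1%R) * (lam (lift (q (c 1%R))))^-1))%g.
Proof.
move=> [cC cD].
pose O u := [set v | eudist v u < rad (q u) / 4].
have hO u : nbhs u (O u).
  apply: open_nbhs_nbhs; split; last by rewrite /O /= eudistxx divr_gt0 ?rad_gt0.
  exact: (proj1 (continuousP _) (@eudist_cont R u) _ (@open_lt R _)).
have L := lebesgue_path cC (fun a _ => hO (c a)).
near=> n.
have n0 : (0 < n)%N by near: n; exact: nbhs_infty_gt.
have n0' : 0 < n%:R :> R by rewrite ltr0n.
have hL : forall a, a \in `[0, 1] -> exists2 e, e \in `[0, 1] & forall b,
   b \in `[0, 1] -> `|a - b| <= n%:R^-1 -> O (c e) (c b) by near: n.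
pose mu i := let u := c (i%:R / n%:R) in (lam (lift (q u)) * (lam u)^-1)%g.
rewrite /holn (@walk_potential _ _ cc mu) /mu.
  by rewrite mul0r divff ?gt_eqF // invgM invgK.
move=> i hi; have hi0 := grid_in (ltnW hi); have hi1 := grid_in hi.
have [e he h] := hL _ hi0.
rewrite (cocycle_disc hg lamP (u := c e)); try exact: cD.
- by rewrite invgM invgK.
- by apply: h => //; rewrite subrr normr0 invr_ge0 ltW.
apply: h => //; rewrite -mulrBl -natr1 opprD addrA subrr sub0r mulN1r normrN.
by rewrite ger0_norm // invr_ge0 ltW.
Unshelve. all: by end_near.
Qed.

(** The corrections by chosen lifts cancel at both ends and at the junction; what remains is the
    jump of [lam] where the loop crosses the boundary. *)
Lemma holo_two_disc_paths c c' : disc_path c -> disc_path c' ->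
  q (c 0%R) = q (c' 1%R) -> lift (q (c 0%R)) = c 0 -> c' 1 = c 0 -> q (c 1%R) = q (c' 0%R) ->
  holo (loop_concat (fun s => q (c s)) (fun s => q (c' s))) =
  (lam (c 1%R) * (lam (c' 0%R))^-1)%g.
Proof.
move=> dc dc' e0 e1 e2 e3.
have [N _ hN] := fine_near (concat_within (disc_path_proj dc) (disc_path_proj dc') e3).
have [M _ hM] := holn_disc_path dc.
have [K _ hK] := holn_disc_path dc'.
pose n := maxn 1 (maxn N (maxn M K)).
rewrite (@holoE (n + n)); last by apply: hN => /=; rewrite /n; lia.
rewrite holn_concat //; last by rewrite /n; lia.
rewrite hM; last by rewrite /= /n; lia.
rewrite hK; last by rewrite /= /n; lia.
by rewrite e2 e1 !mulgV mulg1 mul1g e3 !mulgA mulgVK.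
Qed.

Lemma holonomy_hom (x0 : X) (S : groupType) (cls : (R -> X) -> S) :
  (forall a : S, exists2 f, is_loop x0 f & cls f = a) ->
  (forall f h, is_loop x0 f -> is_loop x0 h ->
          (cls f = cls h <-> loop_homotopic x0 f h)) ->
  (forall f h, is_loop x0 f -> is_loop x0 h ->
          cls (loop_concat f h) = (cls f * cls h)%g) ->
  exists2 phi : S -> G, {morph phi : a b / (a * b)%g} &
    forall f, is_loop x0 f -> phi (cls f) = holo f.
Proof.
move=> csurj chom cmul.
have /choice [r hr] : forall a : S, exists f, is_loop x0 f /\ cls f = a.
  by move=> a; have [f ? ?] := csurj a; exists f.
have phiE f : is_loop x0 f -> holo (r (cls f)) = holo f.
  move=> lf; have [h1 h2] := hr (cls f).
  by apply: (holo_homotopy h1 lf); exact/(chom _ _ h1 lf).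
exists (fun a => holo (r a)) => // a b.
have [l1 <-] := hr a; have [l2 <-] := hr b.
rewrite -cmul // !phiE //; first exact: holo_concat l1 l2.
have [[c1 h1 h2] [c2 h3 h4]] := (l1, l2).
split; first by apply: concat_within => //; rewrite h2.
  by rewrite concat0.
by rewrite concat1.
Qed.

End Holonomy.

(* The cocycle with values [hA i] and [hB i] on the i-th pairs of sides is a
   coboundary: its potential at the vertices is forced step by step around the
   polygon, and closes up because [comm_prod l = 1]. *)
Section Potential.
Variables (R : realType) (g : nat).
Hypothesis hg : (0 < g)%N.
Local Notation bp := (@boundary_point R g).
Variables (G : groupType) (l : seq (G * G)).
Hypothesis sl : size l = g.
Hypothesis comm1 : comm_prod l = 1%g.

Definition hA i : G := (nth (1, 1)%g l i).1.
(** Inverted because the boundary word reads alpha beta^-1 alpha^-1 beta, the commutator of alpha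
    and beta^-1; compare [generators]. *)
Definition hB i : G := ((nth (1, 1)%g l i).2^-1)%g.

(** In the interior of the sides only the jumps are prescribed; they are placed entirely on the
    first side of each pair. *)
Definition edge_value (k : nat) : G :=
  match (k %% 4)%N with 0 => hA (k %/ 4) | 1 => hB (k %/ 4) | _ => 1%g end.

Definition vertex_value (k : nat) : G :=
  let i := (k %/ 4)%N in
  match (k %% 4)%N with
  | 0 => comm_prod (drop i l)
  | 1 => (hB i * comm_prod (drop i.+1 l))%g
  | 2 => ((hA i)^-1 * (hB i * comm_prod (drop i.+1 l)))%g
  | _ => ((hB i)^-1 * ((hA i)^-1 * (hB i * comm_prod (drop i.+1 l))))%g
  end.

(** Continuity is irrelevant, since only jumps between glued points count. Off the circle the
    default parameter 0 yields the constant [vertex_value 0]. *)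
Definition potential (p : R * R) : G :=
  let s := xget 0 [set s | 0 <= s < (4 * g)%:R /\ p = bp s] in
  let k := Num.truncn s in
  if s == k%:R then vertex_value k else edge_value k.

Lemma potentialE s : 0 <= s < (4 * g)%:R -> let k := Num.truncn s in
  potential (bp s) = if s == k%:R then vertex_value k else edge_value k.
Proof.
move=> hs; rewrite /potential; case: xgetP => [s' _ [hs' e]|/(_ s)[]//].
by rewrite (bp_inj hg hs hs' e).
Qed.

Lemma potential_edge k t : (k < 4 * g)%N -> 0 < t < 1 ->
  potential (bp (k%:R + t)) = edge_value k.
Proof.
move=> hk /andP[t0 t1].
have tr : Num.truncn (k%:R + t) = k.
  by apply: truncn_def; rewrite lerDl ltW //= -natr1 ltrD2l.
rewrite potentialE ?tr; last first.
  rewrite addr_ge0 ?ler0n ?ltW //=; apply: (@lt_le_trans _ _ k.+1%:R).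
    by rewrite -natr1 ltrD2l.
  by rewrite ler_nat.
by rewrite ifF //; apply/eqP; lra.
Qed.

Lemma vertex_value_last : vertex_value (4 * g) = 1%g.
Proof. by rewrite /vertex_value modnMr mulKn // -sl drop_size. Qed.

Lemma vertex_value0 : vertex_value 0 = 1%g.
Proof. by rewrite /vertex_value /= drop0. Qed.

Lemma potential_vertex (k : nat) : (k <= 4 * g)%N -> potential (bp k%:R) = vertex_value k.
Proof.
rewrite leq_eqVlt => /predU1P[->|hk].
  rewrite -[X in bp X]add0r bp_period // (@potentialE 0) ?lexx ?ltr0n ?muln_gt0 //.
  by rewrite truncn0 eqxx vertex_value0 vertex_value_last.
by rewrite potentialE ?ler0n ?ltr_nat // natrK eqxx.
Qed.

Lemma vertex_value4 i : (i < g)%N ->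
  [/\ vertex_value (4 * i) = comm_prod (drop i l),
      vertex_value (4 * i + 1) = (hB i * comm_prod (drop i.+1 l))%g,
      vertex_value (4 * i + 2) = ((hA i)^-1 * (hB i * comm_prod (drop i.+1 l)))%g,
      vertex_value (4 * i + 3) = ((hB i)^-1 * ((hA i)^-1 * (hB i * comm_prod (drop i.+1 l))))%g &
      vertex_value (4 * i + 4) = comm_prod (drop i.+1 l)].
Proof.
move=> hi; have h k j r : (k = 4 * j + r)%N -> (r < 4)%N -> (k %% 4 = r /\ k %/ 4 = j)%N.
  by lia.
rewrite /vertex_value.
have [-> ->] := h (4 * i)%N i 0%N (esym (addn0 _)) isT.
have [-> ->] := h (4 * i + 1)%N i 1%N erefl isT.
have [-> ->] := h (4 * i + 2)%N i 2%N erefl isT.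
have [-> ->] := h (4 * i + 3)%N i 3%N erefl isT.
by have [|-> ->] := h (4 * i + 4)%N i.+1 0%N _ isT; first by lia.
Qed.

Lemma edge_value4 i : [/\ edge_value (4 * i) = hA i, edge_value (4 * i + 1) = hB i,
  edge_value (4 * i + 2) = 1%g & edge_value (4 * i + 3) = 1%g].
Proof.
have h k j r : (k = 4 * j + r)%N -> (r < 4)%N -> (k %% 4 = r /\ k %/ 4 = j)%N.
  by lia.
rewrite /edge_value.
have [-> ->] := h (4 * i)%N i 0%N (esym (addn0 _)) isT.
have [-> ->] := h (4 * i + 1)%N i 1%N erefl isT.
have [-> _] := h (4 * i + 2)%N i 2%N erefl isT.
by have [-> _] := h (4 * i + 3)%N i 3%N erefl isT.
Qed.

Lemma comm_prod_drop i : (i < g)%N ->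
  comm_prod (drop i l) =
  (hA i * ((hB i)^-1 * ((hA i)^-1 * (hB i * comm_prod (drop i.+1 l)))))%g.
Proof.
move=> hi; rewrite (drop_nth (1, 1)%g) ?sl //= /hA /hB invgK.
by rewrite !mulgA.
Qed.

Lemma potential_label : label_const g potential hA hB.
Proof.
move=> i t hi; rewrite in_itv /= => ht.
have [v0 v1 v2 v3 v4] := vertex_value4 hi; have cd := comm_prod_drop hi.
have e0 : (4 * i + 3)%:R - 1 = (4 * i + 2)%:R :> R by ring.
have e1 : (4 * i)%:R + 1 = (4 * i + 1)%:R :> R by ring.
have e2 : (4 * i + 1)%:R + 1 = (4 * i + 2)%:R :> R by ring.
have e3 : (4 * i + 4)%:R - 1 = (4 * i + 3)%:R :> R by ring.
have [->|t0] := eqVneq t 0.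
  rewrite !addr0 !subr0 !potential_vertex ?v0 ?v1 ?v2 ?v3 ?v4; try lia.
  by rewrite cd; split; rewrite ?mulgK.
have [->|t1] := eqVneq t 1.
  rewrite e0 e1 e2 e3 !potential_vertex ?v0 ?v1 ?v2 ?v3 ?v4; try lia.
  by split; rewrite invgM ?invgK ?mulgA ?mulgV ?mul1g ?mulgK ?mulgV ?mul1g.
have ht' : 0 < t < 1 by rewrite lt_def t0 lt_def eq_sym t1.
have hs : 0 < 1 - t < 1 by lra.
have f0 : (4 * i + 3)%:R - t = (4 * i + 2)%:R + (1 - t) :> R by ring.
have f1 : (4 * i + 4)%:R - t = (4 * i + 3)%:R + (1 - t) :> R by ring.
rewrite f0 f1 !potential_edge //; try lia.
have [-> -> -> ->] := edge_value4 i.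
by rewrite invg1 !mulg1.
Qed.

End Potential.

(** * Homotopies of paths *)

Section Paths.
Variables (R : realType) (X : topologicalType).
Implicit Types (f h a b c : R -> X).
Local Notation I2 := (@unit_square R).
Local Notation concat := (@loop_concat R X).

Definition is_path f : Prop := {within `[0, 1], continuous f}.

Definition path_homotopic f h : Prop := exists H : R * R -> X,
  [/\ {within I2, continuous H},
      forall s, s \in `[0, 1] -> H (s, 0) = f s /\ H (s, 1) = h s &
      forall t, t \in `[0, 1] -> H (0, t) = f 0 /\ H (1, t) = f 1].

Definition rev_path f : R -> X := fun s => f (1 - s).

Lemma in01 (s : R) : (s \in `[0, 1]) = (0 <= s <= 1). Proof. by rewrite in_itv. Qed.
Lemma in01_0 : (0 : R) \in `[0, 1]. Proof. by rewrite in01 lexx ler01. Qed.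
Lemma in01_1 : (1 : R) \in `[0, 1]. Proof. by rewrite in01 lexx ler01. Qed.

Lemma lin_cont (u v : R) : continuous (fun s : R => u + v * s).
Proof.
by move=> x; apply: cvgD; [exact: cvg_cst|apply: cvgM; [exact: cvg_cst|exact: cvg_id]].
Qed.

Lemma path_homotopic_path f h : path_homotopic f h -> is_path f /\ is_path h.
Proof.
case=> H [cH H1 _].
have k (t : R) : t \in `[0, 1] -> {within `[0, 1], continuous (fun s => H (s, t))}.
  move=> ht; apply: (within_comp cH) => [|x hx]; last by split.
  by apply: continuous_subspaceT; apply: pair_cont => x; [exact: cvg_id|exact: cvg_cst].
by split; [refine (eq_within _ (k 0 in01_0)) | refine (eq_within _ (k 1 in01_1))];
  move=> s /H1 [].
Qed.

Lemma path_homotopic_ends f h : path_homotopic f h -> h 0 = f 0 /\ h 1 = f 1.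
Proof.
case=> H [_ H1 H2]; have [<- <-] := H2 1 in01_1.
by rewrite (H1 0 in01_0).2 (H1 1 in01_1).2.
Qed.

Lemma peq_loop x0 f h : is_loop x0 f -> path_homotopic f h -> loop_homotopic x0 f h.
Proof. by case=> _ f0 f1 [H [cH H1 H2]]; exists H; split=> // t /H2; rewrite f0 f1. Qed.

Lemma eq_peq f h : is_path f -> (forall s, s \in `[0, 1] -> f s = h s) -> path_homotopic f h.
Proof.
move=> cf fh; exists (fun p => f p.1); split=> // [|s /fh -> //].
apply: (within_comp cf) => [|x []//].
by apply: continuous_subspaceT => x; exact: cvg_fst.
Qed.

Lemma peq_refl f : is_path f -> path_homotopic f f.
Proof. by move=> cf; exact: eq_peq. Qed.

Lemma swap_within (A B : set R) (H : R * R -> X) : {within A `*` B, continuous H} ->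
  {within B `*` A, continuous (fun p => H (p.2, p.1))}.
Proof.
move=> cH; apply: (within_comp cH) => [|x []//].
by apply: continuous_subspaceT; apply: pair_cont => x; [exact: cvg_snd|exact: cvg_fst].
Qed.

Lemma peq_sym f h : path_homotopic f h -> path_homotopic h f.
Proof.
move=> fh; have [h0 h1] := path_homotopic_ends fh.
have [H [cH H1 H2]] := fh; exists (fun p => H (p.1, 1 + (-1) * p.2)); split.
- apply: (within_comp cH).
    apply: continuous_subspaceT; apply: pair_cont => x; first exact: cvg_fst.
    by apply: cvgD; [exact: cvg_cst|apply: cvgM; [exact: cvg_cst|exact: cvg_snd]].
  by move=> x []; rewrite /= !in01 => h2 h3; split; rewrite /= in01 //; lra.
- move=> s hs /=; have [e1 e2] := H1 _ hs.
  by split; rewrite -?e1 -?e2; congr (H (_, _)); ring.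
move=> t ht /=; rewrite h0 h1; apply: H2; rewrite !in01 in ht *; lra.
Qed.

Lemma closed_rect (A B : set R) : closed A -> closed B -> closed (A `*` B).
Proof.
move=> cA cB; have -> : A `*` B = (@fst R R @^-1` A) `&` (@snd R R @^-1` B) by [].
apply: closedI.
  by apply: (proj1 (continuous_closedP _) _ _ cA) => x; exact: cvg_fst.
by apply: (proj1 (continuous_closedP _) _ _ cB) => x; exact: cvg_snd.
Qed.

Lemma concat_square (F K : R * R -> X) : {within I2, continuous F} ->
  {within I2, continuous K} -> (forall t, t \in `[0, 1] -> F (1, t) = K (0, t)) ->
  {within I2, continuous (fun p => concat (fun s => F (s, p.2)) (fun s => K (s, p.2)) p.1)}.
Proof.
move=> cF cK FK; have E : I2 = (`[0, 2^-1] `*` `[0, 1]) `|` (`[2^-1, 1] `*` `[0, 1]).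
  apply/seteqP; split=> -[x y]; rewrite /unit_square /= !in01 !in_itv /=.
    by move=> [/andP[x0 x1] hy]; have [?|?] := leP x 2^-1; [left|right]; split=> //; lra.
  by case=> -[? ?]; split=> //; lra.
have lin (u v : R) : continuous (fun p : R * R => (u + v * p.1, p.2)).
  apply: pair_cont => x; last exact: cvg_snd.
  by apply: cvgD; [exact: cvg_cst|apply: cvgM; [exact: cvg_cst|exact: cvg_fst]].
rewrite E; apply: withinU_continuous.
- by apply: closed_rect; exact: interval_closed.
- by apply: closed_rect; exact: interval_closed.
- refine (eq_within (f := fun p : R * R => F (0 + 2 * p.1, p.2)) _ _).
    move=> [x y] /= [] /=; rewrite !in_itv /= /loop_concat => /andP[_ ->] _.
    by rewrite add0r.
  apply: (within_comp cF) => [|[x y] [] /=]; first exact: continuous_subspaceT (lin _ _).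
  by rewrite !in_itv /= => ? ?; split; rewrite /= in_itv /=; lra.
refine (eq_within (f := fun p : R * R => K (-1 + 2 * p.1, p.2)) _ _).
  move=> [x y] [/=]; rewrite !in_itv /= /loop_concat => /andP[x0 x1] hy.
  rewrite addrC; case: ifP => // x2; have -> : x = 2^-1 by lra.
  by rewrite divff // subrr FK // in01.
apply: (within_comp cK) => [|[x y] [] /=]; first exact: continuous_subspaceT (lin _ _).
by rewrite !in_itv /= => ? ?; split; rewrite /= in_itv /=; lra.
Qed.

Lemma peq_trans h f k : path_homotopic f h -> path_homotopic h k -> path_homotopic f k.
Proof.
move=> fh hk; have [h0 h1] := path_homotopic_ends fh.
have [H [cH H1 H2]] := fh; have [K [cK K1 K2]] := hk.
(* Homotopies are concatenated in the second variable, hence the exchange of coordinates before and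
   after. *)
have := concat_square (swap_within cH) (swap_within cK).
move=> /(_ (fun t ht => etrans (H1 t ht).2 (esym (K1 t ht).1))) /swap_within cL.
exists (fun p => concat (fun s => H (p.1, s)) (fun s => K (p.1, s)) p.2); split=> //.
  by move=> s hs /=; rewrite concat0 concat1 (H1 s hs).1 (K1 s hs).2.
have aux (s : R) : s \in `[0, 1] -> (s <= 2^-1 -> 2 * s \in `[0, 1]) /\
    (~~ (s <= 2^-1) -> 2 * s - 1 \in `[0, 1]).
  by rewrite !in01 -ltNge; lra.
move=> t /aux [a1 a2]; rewrite /loop_concat /=; case: ifPn => [/a1/H2|/a2/K2] //.
by rewrite h0 h1.
Qed.

Lemma peq_concat a a' b b' : path_homotopic a a' -> path_homotopic b b' -> a 1 = b 0 ->
  path_homotopic (concat a b) (concat a' b').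
Proof.
move=> [H [cH H1 H2]] [K [cK K1 K2]] ab.
have HK t : t \in `[0, 1] -> H (1, t) = K (0, t).
  by move=> ht; rewrite (H2 t ht).2 (K2 t ht).1.
exists (fun p => concat (fun s => H (s, p.2)) (fun s => K (s, p.2)) p.1); split.
- exact: concat_square.
- move=> s; rewrite in01 /loop_concat /= => hs; case: ifPn => h.
    by apply: H1; rewrite in01; lra.
  by apply: K1; rewrite in01; move: h; rewrite -ltNge; lra.
by move=> t ht; rewrite !concat0 !concat1 (H2 t ht).1 (K2 t ht).2.
Qed.

(** The straight-line homotopy in the plane, followed by [F]; reparametrizations and deformations
    inside the disc are obtained from it. *)
Lemma peq_segm (A : set (R * R)) (F : R * R -> X) (c c' : R -> R * R) :
  {within A, continuous F} -> {within `[0, 1], continuous c} ->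
  {within `[0, 1], continuous c'} -> c 0 = c' 0 -> c 1 = c' 1 ->
  (forall s t, s \in `[0, 1] -> t \in `[0, 1] -> A (segm (c s) (c' s) t)) ->
  path_homotopic (fun s => F (c s)) (fun s => F (c' s)).
Proof.
move=> cF cc cc' e0 e1 hA; exists (fun p => F (segm (c p.1) (c' p.1) p.2)); split.
- apply: (within_comp cF); last by move=> [s t] []; exact: hA.
  have k (d : R -> R * R) : {within `[0, 1], continuous d} -> forall x, I2 x ->
      (d p.1 @[p --> within I2 (nbhs x)] --> d x.1).
    move=> cd; apply/subspace_continuousP; apply: (within_comp cd); last by move=> x [].
    by apply: continuous_subspaceT => x; exact: cvg_fst.
  apply/subspace_continuousP => x Ix.
  have kt : p.2 @[p --> within I2 (nbhs x)] --> x.2.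
    by apply: cvg_within_filter; exact: cvg_snd.
  have k1 (d : R -> R * R) : {within `[0, 1], continuous d} ->
      (d p.1).1 @[p --> within I2 (nbhs x)] --> (d x.1).1.
    by move=> /k/(_ x Ix) kd; exact: (@cvg_comp _ _ _ _ fst _ _ _ kd cvg_fst).
  have k2 (d : R -> R * R) : {within `[0, 1], continuous d} ->
      (d p.1).2 @[p --> within I2 (nbhs x)] --> (d x.1).2.
    by move=> /k/(_ x Ix) kd; exact: (@cvg_comp _ _ _ _ snd _ _ _ kd cvg_snd).
  have kt' : (1 - p.2) @[p --> within I2 (nbhs x)] --> (1 - x.2).
    by apply: cvgB; [exact: cvg_cst|exact: kt].
  exact: (cvg_pair (cvgD (cvgM kt' (k1 _ cc)) (cvgM kt (k1 _ cc')))
                   (cvgD (cvgM kt' (k2 _ cc)) (cvgM kt (k2 _ cc')))).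
- by move=> s _; rewrite segm0 segm1.
move=> t _; rewrite e0 e1 /segm; split; congr F;
by rewrite -!mulrDl subrK !mul1r -surjective_pairing.
Qed.

Lemma peq_reparam f (u v : R -> R) : is_path f -> {within `[0, 1], continuous u} ->
  {within `[0, 1], continuous v} -> u 0 = v 0 -> u 1 = v 1 ->
  (forall s, s \in `[0, 1] -> u s \in `[0, 1] /\ v s \in `[0, 1]) ->
  path_homotopic (fun s => f (u s)) (fun s => f (v s)).
Proof.
move=> cf cu cv e0 e1 h.
have k (w : R -> R) : {within `[0, 1], continuous w} ->
    {within `[0, 1], continuous (fun s : R => (w s, 0 : R))}.
  move=> cw; apply: (within_comp (f := fun x : R => (x, 0 : R)) (B := setT) _ cw) => //.
  by apply: continuous_subspaceT; apply: pair_cont => x; [exact: cvg_id|exact: cvg_cst].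
apply: (peq_segm (A := `[0, 1] `*` setT) (F := fun p => f p.1) _ (k _ cu) (k _ cv)).
- apply: (within_comp cf) => [|x []//].
  by apply: continuous_subspaceT => x; exact: cvg_fst.
- by rewrite e0.
- by rewrite e1.
move=> s t /h []; rewrite !in01 => hu hv ht; split=> //=.
by rewrite /segm /= in01; nra.
Qed.

Lemma id_within (A : set R) : {within A, continuous (fun s : R => s)}.
Proof. by apply: continuous_subspaceT => x; exact: cvg_id. Qed.

Lemma cst_within (U : topologicalType) (A : set R) (u : U) : {within A, continuous (fun _ : R => u)}.
Proof. by apply: continuous_subspaceT => x; exact: cvg_cst. Qed.

Lemma flip_within (A : set R) : {within A, continuous (fun s : R => 1 - s)}.
Proof.
by apply: continuous_subspaceT => s; apply: cvgB; [exact: cvg_cst|exact: cvg_id].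
Qed.
Arguments flip_within : clear implicits.

Lemma rev_path_path f : is_path f -> is_path (rev_path f).
Proof.
move=> cf; apply: (within_comp cf) => [|s /=]; last by rewrite !in01; lra.
by apply: continuous_subspaceT => x; apply: cvgB; [exact: cvg_cst|exact: cvg_id].
Qed.

Lemma concat_comp (Y : Type) (f : Y -> X) (u v : R -> Y) s :
  f (loop_concat u v s) = concat (fun s => f (u s)) (fun s => f (v s)) s.
Proof. by rewrite /loop_concat; case: ifP. Qed.

Lemma concat_mem (Y : Type) (A : set Y) (u v : R -> Y) :
  (forall s, s \in `[0, 1] -> A (u s)) -> (forall s, s \in `[0, 1] -> A (v s)) ->
  forall s, s \in `[0, 1] -> A (loop_concat u v s).
Proof.
move=> hu hv s; rewrite (in01 s) /loop_concat => hs; case: ifPn => h.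
  by apply: hu; rewrite in01; lra.
by apply: hv; rewrite in01; move: h; rewrite -ltNge; lra.
Qed.

Lemma eq_concat a a' b b' : (forall s, s \in `[0, 1] -> a s = a' s) ->
  (forall s, s \in `[0, 1] -> b s = b' s) ->
  forall s, s \in `[0, 1] -> concat a b s = concat a' b' s.
Proof.
move=> ha hb s; rewrite (in01 s) /loop_concat => hs; case: ifPn => h.
  by apply: ha; rewrite in01; lra.
by apply: hb; rewrite in01; move: h; rewrite -ltNge; lra.
Qed.

(** Units, inverses and associativity are all instances, each being a statement about pieces of a
    single path [f]. *)
Lemma peq_concat_reparam f (u v w : R -> R) : is_path f ->
  {within `[0, 1], continuous u} -> {within `[0, 1], continuous v} ->
  {within `[0, 1], continuous w} -> u 1 = v 0 -> w 0 = u 0 -> w 1 = v 1 ->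
  (forall s, s \in `[0, 1] -> [/\ u s \in `[0, 1], v s \in `[0, 1] & w s \in `[0, 1]]) ->
  path_homotopic (concat (fun s => f (u s)) (fun s => f (v s))) (fun s => f (w s)).
Proof.
move=> cf cu cv cw uv w0 w1 h.
have := peq_reparam cf (concat_within cu cv uv) cw.
rewrite concat0 concat1 => /(_ (esym w0) (esym w1)) k.
apply: peq_trans (k _); last first.
  move=> s hs; split; last by case: (h s hs).
  by apply: (@concat_mem _ [set` `[0, 1]]) hs => t /h [].
apply: eq_peq => [|s _]; last by rewrite -concat_comp.
apply: concat_within; last by rewrite uv.
  by apply: within_comp cf cu _ => s /h [].
by apply: within_comp cf cv _ => s /h [].
Qed.

Lemma lin_within (A : set R) (u v : R) : {within A, continuous (fun s => u + v * s)}.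
Proof. by apply: continuous_subspaceT; exact: lin_cont. Qed.

Lemma peq_unitr a : is_path a -> path_homotopic (concat a (fun=> a 1)) a.
Proof.
move=> ca; apply: (peq_concat_reparam ca (@id_within _) (@cst_within R _ 1) (@id_within _)) => // s.
by rewrite !in01 lexx ler01.
Qed.

Lemma peq_unitl a : is_path a -> path_homotopic (concat (fun=> a 0) a) a.
Proof.
move=> ca; apply: (peq_concat_reparam ca (@cst_within R _ 0) (@id_within _) (@id_within _)) => // s.
by rewrite !in01 lexx ler01.
Qed.

Lemma peq_inv a : is_path a -> path_homotopic (concat (rev_path a) a) (fun=> a 1).
Proof.
move=> ca; have cu := flip_within `[0, 1].
apply: (peq_concat_reparam ca cu (@id_within _) (@cst_within R _ 1)) => //.
- by rewrite subrr.
- by rewrite subr0.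
by move=> s; rewrite !in01 => hs; split; lra.
Qed.

Lemma peq_inv_r a : is_path a -> path_homotopic (concat a (rev_path a)) (fun=> a 0).
Proof.
move=> ca; have cu := flip_within `[0, 1].
apply: (peq_concat_reparam ca (@id_within _) cu (@cst_within R _ 0)) => //.
- by rewrite subr0.
- by rewrite subrr.
by move=> s; rewrite !in01 => hs; split; lra.
Qed.

Lemma peq_assoc a b c : is_path a -> is_path b -> is_path c -> a 1 = b 0 -> b 1 = c 0 ->
  path_homotopic (concat (concat a b) c) (concat a (concat b c)).
Proof.
(* [a], [b] and [c] are the pieces of [G] over [0, 1/2], [1/2, 3/4] and [3/4, 1]. *)
move=> ca cb cc ab bc; set G := concat a (concat b c).
have cG : is_path G.
  by apply: concat_within => //; [exact: concat_within|rewrite concat0].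
have h2 : 2 * 2^-1 = 1 :> R by rewrite divff.
have ea s : s \in `[0, 1] -> G (0 + 2^-1 * s) = a s.
  rewrite in01 /G /loop_concat add0r => hs; rewrite ifT; last by lra.
  by rewrite mulrA h2 mul1r.
have eb s : s \in `[0, 1] -> G (2^-1 + 4^-1 * s) = b s.
  rewrite in01 /G /loop_concat => hs; case: ifP => h.
    have -> : s = 0 by lra.
    by rewrite mulr0 addr0 h2 ab.
  by rewrite ifT; [congr b; field|lra].
have ec s : s \in `[0, 1] -> G (3 / 4 + 4^-1 * s) = c s.
  rewrite in01 /G /loop_concat => hs; rewrite ifF; last by apply/negbTE; rewrite -ltNge; lra.
  case: ifP => h; last by congr c; field.
  have -> : s = 0 by lra.
  by rewrite -bc; congr b; field.
have cu : {within `[0, 1], continuous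
    (loop_concat (fun s : R => 0 + 2^-1 * s) (fun s => 2^-1 + 4^-1 * s))}.
  by apply: concat_within; [exact: lin_within|exact: lin_within|lra].
have := peq_concat_reparam cG cu (@lin_within _ (3 / 4) 4^-1) (@id_within _).
rewrite concat0 concat1.
have k1 : 2^-1 + 4^-1 * 1 = 3 / 4 + 4^-1 * 0 :> R by lra.
have k2 : 0 = 0 + 2^-1 * 0 :> R by lra.
have k3 : 1 = 3 / 4 + 4^-1 * 1 :> R by lra.
move=> /(_ k1 k2 k3) k; apply: peq_trans (k _) => [|s hs].
  apply: eq_peq.
    by apply: concat_within => //; [exact: concat_within|rewrite concat1].
  apply: eq_concat => s hs; last by rewrite ec.
  rewrite concat_comp; apply: eq_concat hs => t ht; [by rewrite ea|by rewrite eb].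
split=> //; last by move: hs; rewrite !in01; lra.
by apply: (@concat_mem _ [set` `[0, 1]]) hs => t /=; rewrite !in01; lra.
Qed.

Lemma rev_path0 a : rev_path a 0 = a 1. Proof. by rewrite /rev_path subr0. Qed.
Lemma rev_path1 a : rev_path a 1 = a 0. Proof. by rewrite /rev_path subrr. Qed.

Lemma peq_cancel a p b b' p' c :
  is_path a -> is_path p -> is_path b -> is_path b' -> is_path p' -> is_path c ->
  a 1 = p 0 -> p 1 = b 0 -> b 1 = b' 0 -> b' 1 = p' 0 -> p' 1 = c 0 -> p 1 = p' 0 ->
  path_homotopic (concat b b') (fun=> p' 0) ->
  path_homotopic (concat (concat a (concat p b)) (concat b' (concat p' c)))
    (concat a (concat (concat p p') c)).
Proof.
move=> ca cp cb cb' cp' cc e1 e2 e3 e4 e5 e6 H.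
have c1 : is_path (concat p' c) by exact: concat_within.
have c2 : is_path (concat b' (concat p' c)) by apply: concat_within; rewrite ?concat0.
have c3 : is_path (concat p b) by exact: concat_within.
apply: peq_trans (peq_assoc ca c3 c2 _ _) _; rewrite ?concat0 ?concat1 //.
apply: peq_concat; [exact: peq_refl| |by rewrite !concat0].
apply: peq_trans (peq_assoc cp cb c2 _ _) _; rewrite ?concat0 //.
apply: peq_trans (peq_sym (peq_assoc cp cp' cc _ _)); rewrite ?concat0 ?concat1 //.
apply: peq_concat; [exact: peq_refl| |by rewrite concat0].
apply: peq_trans (peq_sym (peq_assoc cb cb' c1 _ _)) _; rewrite ?concat0 //.
apply: (peq_trans (h := concat (fun=> concat p' c 0) (concat p' c))); last exact: peq_unitl.
by apply: peq_concat; rewrite ?concat0 ?concat1 //; exact: peq_refl.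
Qed.

(** By convexity of the square, segments join its bottom side to the path along the other three. *)
Lemma square_path_homotopic (M : R * R -> X) : {within I2, continuous M} ->
  path_homotopic (fun s => M (s, 0)) (concat (fun t => M (0, t))
    (concat (fun s => M (s, 1)) (rev_path (fun t => M (1, t))))).
Proof.
move=> cM.
pose bottom (s : R) : R * R := (s, 0).
pose c := loop_concat (fun t : R => (0 : R, t))
  (loop_concat (fun s : R => (s, 1 : R)) (fun t => (1 : R, 1 - t))).
have cc : {within `[0, 1], continuous c}.
  apply: concat_within; last by rewrite concat0.
    by apply: pair_within; [exact: cst_within|exact: id_within].
  apply: concat_within; last by rewrite subr0.
    by apply: pair_within; [exact: id_within|exact: cst_within].
  by apply: pair_within; [exact: cst_within|exact: flip_within].
have cb : {within `[0, 1], continuous bottom}.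
  by apply: pair_within; [exact: id_within|exact: cst_within].
have -> : concat (fun t => M (0, t)) (concat (fun s => M (s, 1))
    (rev_path (fun t => M (1, t)))) = fun s => M (c s).
  by apply/funext => s; rewrite /c concat_comp; congr concat; apply/funext => t;
    rewrite concat_comp.
have hc s : s \in `[0, 1] -> I2 (c s).
  apply: concat_mem => {}s hs; first by split=> //=; exact: in01_0.
  apply: concat_mem hs => {}s hs; first by split=> //=; exact: in01_1.
  by split; rewrite /= ?in01_1 //; move: hs; rewrite !in01; lra.
apply: (peq_segm cM cb cc) => [||s t /[dup] /hc].
- by rewrite /c concat0.
- by rewrite /c !concat1 subrr.
case: (c s) => a b [/=]; rewrite !in01 => ha hb hs ht.
by split; rewrite /= in01; nra.
Qed.

Lemma square_rows (M : R * R -> X) t : {within I2, continuous M} -> t \in `[0, 1] ->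
  is_path (fun s => M (s, t)) /\ is_path (fun s => M (t, s)).
Proof.
move=> cM ht; split; apply: (within_comp cM) => [|s hs]; try by split.
  by apply: pair_within; [exact: id_within|exact: cst_within].
by apply: pair_within; [exact: cst_within|exact: id_within].
Qed.

End Paths.

Lemma hausdorff_setX (T U : topologicalType) :
  hausdorff_space T -> hausdorff_space U -> hausdorff_space (T * U)%type.
Proof.
move=> hT hU [x r] [y t] h; congr pair.
  apply: hT => A B Ax By; have [||[z w] [[Az _] [Bz _]]] := h (A `*` setT) (B `*` setT).
  - by exists (A, setT) => //; split=> //; exact: filterT.
  - by exists (B, setT) => //; split=> //; exact: filterT.
  by exists z.
apply: hU => A B Ar Bt; have [||[z w] [[_ Aw] [_ Bw]]] := h (setT `*` A) (setT `*` B).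
- by exists (setT, A) => //; split=> //; exact: filterT.
- by exists (setT, B) => //; split=> //; exact: filterT.
by exists w.
Qed.

(** * Contraction of a chart to its centre *)

Section Contraction.
Variables (R : realType) (g : nat) (X : topologicalType).
Hypothesis hg : (0 < g)%N.
Variable Q : charted_surface R g X.
Local Notation q := (cproj Q).
Local Notation lift := (clift Q).
Local Notation rad := (crad Q).

Definition contraction x y (r : R) : X := q (slide (lift y) (lift_near Q x (lift y)) r).

(** The slides of two lifts of [y] are glued at every time, by the last clause of [parallel], so any
    lift computes the contraction. *)
Lemma contractionE x y v u r : fibre Q y v -> fibre Q x u ->
  eudist v u < rad x -> r \in `[0, 1] -> contraction x y r = q (slide v u r).
Proof.
move=> yv xu d; rewrite in01 => hr.
have [u' [h1 h2 _ h4]] := lift_parallel hg (label_const1 {perm 'I_1})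
  (rad_good xu) d (glued_sym yv).
have xu' : fibre Q x u' by exact: fibre_glued h1 xu.
rewrite /contraction (lift_nearE xu') ?h2 //.
symmetry; apply/(cproj_glued Q); last exact: h4.
  by apply: slide_disc => //; [exact: fibre_disc yv|exact: fibre_disc xu].
by apply: slide_disc => //; [exact: clift_disc|exact: fibre_disc xu'].
Qed.

Lemma slide_path (v u : R * R) : eudist v u < 1 ->
  {within `[0, 1], continuous (slide v u)}.
Proof.
move=> d.
have cs : {within [set v] `*` `[0, 1], continuous (fun z : (R * R) * R => slide z.1 u z.2)}.
  apply: continuous_in_subspaceT => -[w r] /set_mem [/= -> hr].
  by apply: slide_cont => //; rewrite /= -in01.
have cp : {within `[0, 1], continuous (fun r : R => (v, r))}.
  by apply: pair_within; [exact: cst_within|exact: id_within].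
by apply: (within_comp cs cp) => r hr; split.
Qed.

Lemma slide_proj_within u (e : R) : e < 1 -> closed_disc u ->
  {within (@closed_disc R `&` [set v | eudist v u <= e]) `*` `[0, 1],
    continuous (fun z : (R * R) * R => q (slide z.1 u z.2))}.
Proof.
move=> e1 uD; apply: (within_comp (@cproj_cont _ _ _ Q)).
  apply: continuous_in_subspaceT => z /set_mem [[_ /= h1]].
  rewrite in_itv /= => h2; apply: slide_cont => //; exact: le_lt_trans h1 e1.
by move=> [v r] [[/= h1 h2]]; rewrite in_itv /= => h3; exact: slide_disc.
Qed.

(* [contraction] is continuous because the disc is compact: the preimage of a
   closed set is the preimage of a finite union of images of compact sets. *)
Lemma contraction_within x (f : R -> X) : is_path f ->
  (forall s, s \in `[0, 1] -> schart Q x (f s)) ->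
  {within @unit_square R, continuous (fun p => contraction x (f p.1) p.2)}.
Proof.
move=> cf hf; apply/continuous_closedP => C cC; apply/closed_subspaceP.
pose e := rad x / 4; have r0 := rad_gt0 Q x.
have r1 : rad x <= 2^-1 by case: (cradP Q x).
pose Z u : set ((R * R) * R) :=
  (@closed_disc R `&` [set v | eudist v u <= e]) `*` `[0, 1].
have cZ u : compact (Z u).
  apply: compact_setX; last exact: segment_compact.
  apply: compact_closedI; first exact: compact_closed_disc.
  exact: (proj1 (continuous_closedP _) (@eudist_cont R u) _ (@closed_le R e)).
pose F u z := q (slide z.1 u z.2).
pose D u := (fun z : (R * R) * R => (q z.1, z.2)) @` (Z u `&` F u @^-1` C).
have cD u : fibre Q x u -> closed (D u).
  move=> xu; apply: compact_closed.
    by apply: hausdorff_setX; [exact: (surf_hausdorff Q)|exact: Rhausdorff].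
  have [V cV VE] : exists2 V : set ((R * R) * R), closed V &
      V `&` Z u = F u @^-1` C `&` Z u.
    apply/closed_subspaceP; apply: (proj1 (continuous_closedP _) _ _ cC).
    by apply: slide_proj_within; [rewrite /e; lra|exact: fibre_disc xu].
  rewrite /D setIC -VE setIC; apply: continuous_compact; last exact: compact_closedI.
  apply: pair_within; last exact: snd_within.
  by apply: (within_comp (@cproj_cont _ _ _ Q)); [exact: fst_within|move=> z [[[]]]].
pose W := \bigcup_(u in fibre Q x) D u.
have cW : closed W by apply: closed_bigcup => //; exact: glued_finite.
have cG : {within @unit_square R, continuous (fun p : R * R => (f p.1, p.2))}.
  apply: pair_within; last exact: snd_within.
  by apply: (within_comp cf); [exact: fst_within|move=> z []].
have /closed_subspaceP [V cV VE] := proj1 (continuous_closedP _) cG _ cW.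
exists V => //; rewrite VE; apply/seteqP; split=> -[s r] [/= h Isr]; split=> //.
  case: h => u xu [[v t] [[[/= vD d] tI] FC] [e1 e2]].
  rewrite /from_subspace /= (@contractionE x (f s) v u) -?e2 //.
    by apply/fibreE.
  by apply: le_lt_trans d _; rewrite /e; lra.
have [Is Ir] := Isr; have hs := hf s Is.
have [h1 h2] := schart_lift_near hg hs (fibre_lift Q (f s)).
exists (lift_near Q x (lift (f s))) => //; exists (lift (f s), r) => /=.
  split; last exact: h.
  by split=> //; split; [exact: clift_disc|exact: ltW].
by rewrite cliftK.
Qed.

End Contraction.

(** * Presentation of the fundamental group *)

Section Generation.
Variables (R : realType) (g : nat) (X : topologicalType).
Hypothesis hg : (0 < g)%N.
Variable Q : charted_surface R g X.
Local Notation q := (cproj Q).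
Local Notation lift := (clift Q).
Local Notation glued := (@glued R g).
Local Notation bp := (@boundary_point R g).
Local Notation concat := (@loop_concat R X).
Variables (x0 : X) (S : groupType) (cls : (R -> X) -> S).
Hypothesis cls_surj : forall a : S, exists2 f, is_loop x0 f & cls f = a.
Hypothesis cls_eq : forall f h, is_loop x0 f -> is_loop x0 h ->
  (cls f = cls h <-> loop_homotopic x0 f h).
Hypothesis cls_mul : forall f h, is_loop x0 f -> is_loop x0 h ->
  cls (loop_concat f h) = (cls f * cls h)%g.
Implicit Types (u v : R * R) (p f h : R -> X).

Lemma segm_disc_path v u : closed_disc v -> closed_disc u ->
  disc_path (fun s => segm v u s).
Proof.
move=> vD uD; split; last by move=> s; rewrite in01; exact: segm_disc.
apply: continuous_subspaceT; apply: pair_cont => s; apply: cvgD; apply: cvgM;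
  try (apply: cvgB); (exact: cvg_cst || exact: cvg_id).
Qed.

Definition ray u : R -> X := fun s => q (segm (lift x0) u s).
Definition tether y := ray (lift y).

Lemma ray_path u : closed_disc u -> is_path (ray u).
Proof.
by move=> uD; apply: disc_path_proj; apply: segm_disc_path => //; exact: clift_disc.
Qed.
Lemma ray0 u : ray u 0 = x0. Proof. by rewrite /ray segm0 cliftK. Qed.
Lemma ray1 u : ray u 1 = q u. Proof. by rewrite /ray segm1. Qed.
Lemma tether_path y : is_path (tether y).
Proof. by apply: ray_path; exact: clift_disc. Qed.
Arguments tether_path : clear implicits.
Lemma tether0 y : tether y 0 = x0. Proof. exact: ray0. Qed.
Lemma tether1 y : tether y 1 = y. Proof. by rewrite /tether ray1 cliftK. Qed.

Lemma cls_peq f h : is_loop x0 f -> path_homotopic f h -> cls f = cls h.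
Proof.
move=> lf fh; apply/cls_eq => //; last exact: peq_loop fh.
have [e0 e1] := path_homotopic_ends fh; have [_ f0 f1] := lf.
by split; rewrite ?e0 ?e1 //; exact: (path_homotopic_path fh).2.
Qed.

Definition tethered p : R -> X :=
  concat (tether (p 0)) (concat p (rev_path (tether (p 1)))).

(** Closing up by tethers makes the class multiplicative on all paths, so that loops can be cut into
    arbitrary pieces. *)
Definition pclass p : S := cls (tethered p).

Lemma tail_path p : is_path p -> is_path (concat p (rev_path (tether (p 1)))).
Proof.
move=> cp; apply: concat_within; rewrite ?rev_path0 ?tether1 //.
exact (rev_path_path (tether_path _)).
Qed.

Lemma tethered_loop p : is_path p -> is_loop x0 (tethered p).
Proof.
move=> cp; rewrite /tethered; split; last 2 first.
- by rewrite concat0 tether0.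
- by rewrite !concat1 rev_path1 tether0.
apply: concat_within; rewrite ?concat0 ?tether1 //; first exact: tether_path.
exact: tail_path.
Qed.

Lemma pclass_peq p p' : path_homotopic p p' -> pclass p = pclass p'.
Proof.
move=> pp; have [cp cp'] := path_homotopic_path pp.
have [e0 e1] := path_homotopic_ends pp.
apply: cls_peq; first exact: tethered_loop.
rewrite /tethered e0 e1; apply: peq_concat; rewrite ?concat0 ?tether1 //.
  exact: peq_refl (tether_path _).
apply: peq_concat; rewrite ?rev_path0 ?tether1 //.
exact: peq_refl (rev_path_path (tether_path _)).
Qed.

Lemma pclass_concat p p' : is_path p -> is_path p' -> p 1 = p' 0 ->
  pclass (concat p p') = (pclass p * pclass p')%g.
Proof.
move=> cp cp' pp; rewrite /pclass -cls_mul; try exact: tethered_loop.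
symmetry; apply: cls_peq.
  have [[c1 h1 h2] [c2 h3 h4]] := (tethered_loop cp, tethered_loop cp').
  split; rewrite ?concat0 ?concat1 //.
  by apply: concat_within => //; rewrite h2.
rewrite /tethered concat0 concat1 -pp; have ct := tether_path.
apply: peq_cancel => //; rewrite ?rev_path0 ?rev_path1 ?tether1 ?tether0 //;
  try exact: rev_path_path.
by have := peq_inv (ct (p 1)); rewrite tether1 -pp.
Qed.

Lemma cst_path (y : X) : is_path (fun _ : R => y).
Proof. by apply: continuous_subspaceT => s; exact: cvg_cst. Qed.

Arguments cst_path : clear implicits.

Lemma pclass_cst y : pclass (fun=> y) = 1%g.
Proof.
apply: (mulgI (pclass (fun=> y))); rewrite mulg1 -pclass_concat //; try exact: cst_path.
by congr cls; rewrite /loop_concat; congr tethered; apply/funext => s; case: ifP.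
Qed.

Lemma pclass_rev p : is_path p -> pclass (rev_path p) = ((pclass p)^-1)%g.
Proof.
move=> cp; apply: (mulIg (pclass p)); rewrite mulVg -pclass_concat //.
- by rewrite (pclass_peq (peq_inv cp)) pclass_cst.
- exact: rev_path_path.
by rewrite rev_path1.
Qed.

Lemma tether_x0 s : tether x0 s = x0.
Proof.
rewrite /tether /ray -[RHS](cliftK Q); congr q.
by case: (lift x0) => a b; rewrite /segm /=; congr pair; ring.
Qed.

Lemma pclass_loop f : is_loop x0 f -> pclass f = cls f.
Proof.
move=> lf; have [cf f0 f1] := lf; symmetry; apply: cls_peq => //.
have e : tether x0 = (fun=> x0) by apply/funext => s; exact: tether_x0.
rewrite /tethered f0 f1 e /rev_path; apply: peq_sym.
apply: (peq_trans (h := concat (fun=> x0) f)).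
  apply: peq_concat; [exact: peq_refl (cst_path _)| |by rewrite concat0].
  by have := peq_unitr cf; rewrite f1.
by have := peq_unitl cf; rewrite f0.
Qed.

(** The class of going to [u] inside the disc and returning along the tether of [q u]. By
    [mark_label] it is a potential with values in [S] itself. *)
Definition mark u : S := pclass (ray u).

Lemma cst_loop : is_loop x0 (fun _ : R => x0).
Proof. by split=> //; exact: cst_path. Qed.

Lemma cls_cst : cls (fun=> x0) = 1%g.
Proof. by rewrite -(pclass_loop cst_loop) pclass_cst. Qed.

Lemma concat_loop f h : is_path f -> is_path h -> f 0 = x0 -> f 1 = h 0 -> h 1 = x0 ->
  is_loop x0 (concat f h).
Proof. by move=> cf ch f0 fh h1; split; rewrite ?concat0 ?concat1 //; exact: concat_within. Qed.

Lemma mark_lift y : mark (lift y) = 1%g.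
Proof.
have ct := tether_path y; have cr := rev_path_path ct.
have t0 := tether0 y.
have l : is_loop x0 (concat (tether y) (rev_path (tether y))).
  by apply: concat_loop => //; rewrite ?rev_path0 ?rev_path1.
rewrite /mark -/(tether y) /pclass /tethered t0 tether1.
have -> : tether x0 = (fun=> x0) by apply/funext => s; exact: tether_x0.
rewrite cls_mul //; last exact: cst_loop.
by rewrite (cls_peq l (peq_inv_r ct)) t0 cls_cst mulg1.
Qed.

(** The disc is convex, so the path deforms to the detour through the base lift. *)
Lemma pclass_disc_path (c : R -> R * R) : disc_path c ->
  pclass (fun s => q (c s)) = ((mark (c 0%R))^-1 * mark (c 1%R))%g.
Proof.
move=> dc; have [cc cD] := dc.
have D0 := cD 0 (in01_0 R); have D1 := cD 1 (in01_1 R).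
have c0 := ray_path D0; have c1 := ray_path D1.
rewrite /mark -pclass_rev // -pclass_concat ?rev_path1 ?ray0 //; last exact: rev_path_path.
apply: pclass_peq.
pose c' := loop_concat (fun s => segm (lift x0) (c 0) (1 - s)) (segm (lift x0) (c 1)).
have -> : concat (rev_path (ray (c 0))) (ray (c 1)) = (fun s => q (c' s)).
  by apply/funext => s; rewrite /c' concat_comp.
have p0D := clift_disc Q x0.
have [s0 s0D] := segm_disc_path p0D D0; have [s1 s1D] := segm_disc_path p0D D1.
have k (s : R) : s \in `[0, 1] -> 1 - s \in `[0, 1] by rewrite !in01; lra.
apply: (peq_segm (@cproj_cont _ _ _ Q) cc).
- apply: concat_within => //; last by rewrite subrr !segm0.
  apply: (within_comp s0) => [|s /k//].
  by apply: continuous_subspaceT => x; apply: cvgB; [exact: cvg_cst|exact: cvg_id].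
- by rewrite /c' concat0 subr0 segm1.
- by rewrite /c' concat1 segm1.
move=> s t hs; rewrite in01 => ht; apply: segm_disc ht; first exact: cD.
by apply: concat_mem hs => r hr; [apply/s0D/k|exact: s1D].
Qed.

Lemma cls_two_rays u v : closed_disc u -> closed_disc v -> q u = q v ->
  cls (concat (ray u) (fun s => q (segm v (lift x0) s))) = (mark u * (mark v)^-1)%g.
Proof.
move=> uD vD uv; have cu := ray_path uD; have cv := ray_path vD.
have e : (fun s => q (segm v (lift x0) s)) = rev_path (ray v).
  by apply/funext => s; rewrite /rev_path /ray; congr q; rewrite /segm; congr pair; ring.
rewrite e -pclass_loop; last first.
  apply: concat_loop; rewrite ?rev_path0 ?rev_path1 ?ray0 ?ray1 //.
  exact: rev_path_path.
rewrite pclass_concat ?pclass_rev ?rev_path0 ?ray1 //; exact: rev_path_path.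
Qed.

(** Two glued sides have the same image in [X]; its initial piece has one class, computed by marks
    along either side. *)
Lemma mark_side (k c : nat) :
  (forall t, t \in `[0, 1] -> glued (bp (k%:R + t)) (bp (c%:R - t))) ->
  forall t, t \in `[0, 1] ->
  (mark (bp (k%:R + t)) * (mark (bp (c%:R - t)))^-1 = mark (bp k%:R) * (mark (bp c%:R))^-1)%g.
Proof.
move=> hkc t ht.
have bc : continuous (@boundary_point R g).
  have ca : continuous (fun s : R => 2 * pi * s / (4 * g)%:R).
    by move=> s; apply: cvgM; [apply: cvgM; [exact: cvg_cst|exact: cvg_id]|exact: cvg_cst].
  apply: pair_cont => s.
    exact: (@cvg_comp _ _ _ _ cos _ _ _ (ca s) (@continuous_cos R _)).
  exact: (@cvg_comp _ _ _ _ sin _ _ _ (ca s) (@continuous_sin R _)).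
have d (w r : R) : disc_path (fun s => bp (w + r * s)).
  split=> [|s _]; last exact: bp_disc.
  apply: continuous_subspaceT => s.
  exact: (@cvg_comp _ _ _ _ (@boundary_point R g) _ _ _ (@lin_cont R w r s) (bc _)).
have e : path_homotopic (fun s => q (bp (k%:R + t * s))) (fun s => q (bp (c%:R + (- t) * s))).
  apply: eq_peq => [|s]; first exact: disc_path_proj (d _ _).
  rewrite !in01 => hs; apply/(cproj_glued Q); try exact: bp_disc.
  by rewrite mulNr; apply: hkc; move: ht; rewrite !in01; nra.
have := pclass_peq e; rewrite !pclass_disc_path // !mulr0 !addr0 !mulr1 => E.
rewrite -[mark (bp (k%:R + t))](mulKVg (mark (bp k%:R))) E.
by rewrite !mulgA mulgK.
Qed.

Definition alpha i : S := (mark (bp (4 * i)%:R) * (mark (bp (4 * i + 3)%:R))^-1)%g.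
Definition beta i : S := (mark (bp (4 * i + 1)%:R) * (mark (bp (4 * i + 4)%:R))^-1)%g.

Lemma mark_label : label_const g mark alpha beta.
Proof.
move=> i t hi ht; split; apply: mark_side => // s hs.
  exact: glued_a.
exact: glued_b.
Qed.

Definition generators : seq (S * S) := [seq (alpha i, (beta i)^-1)%g | i <- iota 0 g].

(** The jumps of [mark] multiply up once around the polygon, and [bp] has period 4g. *)
Lemma generators_relation : comm_prod generators = 1%g.
Proof.
suff h k n : (k + n = g)%N -> (comm_prod [seq (alpha i, (beta i)^-1)%g | i <- iota k n] *
    mark (bp (4 * (k + n))%:R) = mark (bp (4 * k)%:R))%g.
  have := h 0%N g erefl; rewrite add0n muln0 -[X in bp X]add0r bp_period // => e.
  by apply: (mulIg (mark (bp 0))); rewrite mul1g.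
elim: n k => [|n IH] k kn /=; first by rewrite addn0 mul1g.
have hk : (k < g)%N by rewrite -kn; lia.
have [a0 b0] := mark_label hk (in01_0 R); have [a1 b1] := mark_label hk (in01_1 R).
rewrite !addr0 !subr0 in a0 b0.
rewrite -mulgA -addSnnS IH; last by rewrite addSnnS.
have e0 : (4 * k)%:R + 1 = (4 * k + 1)%:R :> R by ring.
have e1 : (4 * k + 3)%:R - 1 = (4 * k + 2)%:R :> R by ring.
have e2 : (4 * k + 1)%:R + 1 = (4 * k + 2)%:R :> R by ring.
have e3 : (4 * k + 4)%:R - 1 = (4 * k + 3)%:R :> R by ring.
rewrite e0 e1 in a1; rewrite e2 e3 in b1.
have -> : (4 * k.+1 = 4 * k + 4)%N by lia.
have A0 : mark (bp (4 * k)%:R) = (alpha k * mark (bp (4 * k + 3)%:R))%g.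
  by rewrite -a0 mulgVK.
have B1 : mark (bp (4 * k + 3)%:R) = ((beta k)^-1 * mark (bp (4 * k + 2)%:R))%g.
  by rewrite -b1 invgM invgK mulgVK.
have A1 : mark (bp (4 * k + 2)%:R) = ((alpha k)^-1 * mark (bp (4 * k + 1)%:R))%g.
  by rewrite -a1 invgM invgK mulgVK.
have B0 : mark (bp (4 * k + 1)%:R) = (beta k * mark (bp (4 * k + 4)%:R))%g.
  by rewrite -b0 mulgVK.
by rewrite A0 B1 A1 B0 invgK !mulgA.
Qed.

Section Closure.
Variable P : S -> Prop.
Hypotheses (P1 : P 1%g) (PM : forall a b, P a -> P b -> P (a * b)%g)
  (PV : forall a, P a -> P a^-1%g)
  (Pgen : forall ab, ab \in generators -> P ab.1 /\ P ab.2).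

Lemma closure_glued u v : glued u v -> P (mark u * (mark v)^-1)%g.
Proof.
have Pab i : (i < g)%N -> P (alpha i) /\ P (beta i).
  move=> hi; have [|/= h1 /PV] := @Pgen (alpha i, (beta i)^-1)%g.
    by apply/mapP; exists i; rewrite ?mem_iota.
  by rewrite invgK.
elim=> {u v} [u v [] i t hi ht|u|u v _ /PV|u v w _ h1 _ h2].
- by rewrite (mark_label hi ht).1; exact: (Pab i hi).1.
- by rewrite (mark_label hi ht).2; exact: (Pab i hi).2.
- by rewrite mulgV.
- by rewrite invgM invgK.
by have := PM h1 h2; rewrite mulgA mulgVK.
Qed.

(** Contracting the chart gives a square with bottom [f], constant top and sides coming from disc
    paths. The class of [f] is thus the jump of [mark] between two lifts of [x], and lifts of one
    point are joined by side pairings. *)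
Lemma closure_chart x f : is_path f -> (forall s, s \in `[0, 1] -> schart Q x (f s)) ->
  P (pclass f).
Proof.
move=> cf hf.
have cM := contraction_within hg cf hf.
have [h0 d0] := schart_lift_near hg (hf 0 (in01_0 R)) (fibre_lift Q (f 0)).
have [h1 d1] := schart_lift_near hg (hf 1 (in01_1 R)) (fibre_lift Q (f 1)).
set v0 := lift (f 0) in h0 d0; set v1 := lift (f 1) in h1 d1.
set u0 := lift_near Q x v0 in h0 d0; set u1 := lift_near Q x v1 in h1 d1.
have r1 : crad Q x <= 2^-1 by case: (cradP Q x).
have sd v u : closed_disc v -> closed_disc u -> eudist v u < crad Q x / 4 ->
    disc_path (fun r => slide v u r).
  move=> vD uD d; split=> [|s]; last by rewrite in01; exact: slide_disc.
  by apply: slide_path; lra.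
have D0 : disc_path (slide v0 u0).
  by apply: sd => //; [exact: clift_disc|exact: fibre_disc h0].
have D1 : disc_path (slide v1 u1).
  by apply: sd => //; [exact: clift_disc|exact: fibre_disc h1].
pose M (p : R * R) := contraction Q x (f p.1) p.2.
have M0 s : M (s, 0) = f s by rewrite /M /contraction slide0 cliftK.
have M1 s : s \in `[0, 1] -> M (s, 1) = x.
  move=> hs; rewrite /M /contraction slide1.
  have [h _] := schart_lift_near hg (hf s hs) (fibre_lift Q (f s)).
  by have [] := proj1 (fibreE _ _ _) h.
have [_ c0] := square_rows cM (in01_0 R).
have [cx c1] := square_rows cM (in01_1 R).
have -> : pclass f = ((mark v0)^-1 * mark u0 * ((mark v1)^-1 * mark u1)^-1)%g.
  have e0 : path_homotopic f (fun s => M (s, 0)) by apply: eq_peq => // s _; rewrite M0.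
  have e1 : path_homotopic (fun s => M (s, 1)) (fun=> x) by exact: eq_peq.
  have r0 := rev_path_path c1.
  rewrite (pclass_peq (peq_trans e0 (square_path_homotopic cM))).
  rewrite !pclass_concat ?concat0 ?rev_path0 //; last by apply: concat_within; rewrite ?rev_path0.
  rewrite pclass_rev // (pclass_peq e1) pclass_cst mul1g.
  rewrite (pclass_disc_path D0) (pclass_disc_path D1).
  by rewrite !slide0 !slide1.
rewrite /v0 /v1 !mark_lift invg1 !mul1g; apply: closure_glued.
exact: fibre2 h0 h1.
Qed.

Lemma closure_path f : is_path f -> P (pclass f).
Proof.
move=> cf; pose sub (a b s : R) := f (a + (b - a) * s).
have hsub (a b s : R) : a \in `[0, 1] -> b \in `[0, 1] -> s \in `[0, 1] ->
    a + (b - a) * s \in `[0, 1] by rewrite !in01; nra.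
have csub (a b : R) : a \in `[0, 1] -> b \in `[0, 1] -> is_path (sub a b).
  move=> ha hb; apply: (within_comp cf); first exact: lin_within.
  by move=> s /=; exact: hsub.
have msub (a b : R) : a \in `[0, 1] -> b \in `[0, 1] ->
    pclass (sub 0 b) = (pclass (sub 0 a) * pclass (sub a b))%g.
  move=> ha hb; have h0 := in01_0 R.
  rewrite -pclass_concat; try exact: csub.
    symmetry; apply: pclass_peq; apply: (peq_concat_reparam cf); try exact: lin_within.
    - by ring.
    - by rewrite !mulr0.
    - by ring.
    by move=> s hs; split; exact: hsub.
  by rewrite /sub; congr f; ring.
have [n _ /(_ n (leqnn n)) [n0 hn]] := fine_near hg Q cf.
have n0' : 0 < n%:R :> R by rewrite ltr0n.
have grid i : (i <= n)%N -> (i%:R / n%:R : R) \in `[0, 1] by exact: grid_in.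
have : forall i, (i <= n)%N -> P (pclass (sub 0 (i%:R / n%:R))).
  elim=> [_|i IH hi].
    have -> : sub 0 (0%:R / n%:R) = fun=> f 0.
      by apply/funext => s; rewrite /sub; congr f; rewrite mul0r subrr mul0r addr0.
    by rewrite pclass_cst.
  rewrite (msub (i%:R / n%:R)); try exact: grid; last by apply: grid; exact: ltnW.
  apply: PM; first by apply: IH; exact: ltnW.
  have [x hx] := hn _ (grid i (ltnW hi)).
  apply: (@closure_chart x) => [|s hs].
    by apply: csub; apply: grid => //; exact: ltnW.
  apply: hx; first by apply: hsub => //; apply: grid => //; exact: ltnW.
  rewrite opprD addrA subrr sub0r normrN -mulrBl -natr1 addrAC subrr add0r mul1r.
  move: hs; rewrite in01 => /andP[s0 s1].
  have nn : 0 <= n%:R^-1 :> R by rewrite invr_ge0 ltW.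
  by rewrite normrM !ger0_norm // ler_piMr.
move=> /(_ n (leqnn n)); rewrite divff ?gt_eqF //.
by have -> : sub 0 1 = f by apply/funext => s; rewrite /sub; congr f; ring.
Qed.

Lemma closure_all a : P a.
Proof.
have [f lf <-] := cls_surj a; rewrite -pclass_loop //; apply: closure_path.
by case: lf.
Qed.

End Closure.

(** The holonomy of the potential attached to [l]: on the loop that crosses the boundary between two
    glued points it is the jump of this potential. *)
Lemma generators_hom (G : groupType) (l : seq (G * G)) :
  size l = g -> comm_prod l = 1%g ->
  exists2 f : S -> G, {morph f : a b / (a * b)%g} &
    [seq (f ab.1, f ab.2) | ab <- generators] = l.
Proof.
move=> sl l1; have pl := @potential_label R g hg G l sl l1.
have [phi phiM phiE] := holonomy_hom hg Q pl cls_surj cls_eq cls_mul.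
exists phi => //.
have phi_mark u v : closed_disc u -> closed_disc v -> q u = q v ->
    phi (mark u * (mark v)^-1)%g = (potential g l u * (potential g l v)^-1)%g.
  move=> uD vD uv; rewrite -cls_two_rays // phiE.
    have d1 := segm_disc_path (clift_disc Q x0) uD.
    have d2 := segm_disc_path vD (clift_disc Q x0).
    by rewrite (holo_two_disc_paths hg pl d1 d2) ?segm0 ?segm1 ?cliftK.
  apply: concat_loop; rewrite ?ray0 ?ray1 ?segm0 ?segm1 ?cliftK //; first exact: ray_path.
  by apply: disc_path_proj; apply: segm_disc_path => //; exact: clift_disc.
have phi1 : phi 1%g = 1%g by apply: (mulgI (phi 1%g)); rewrite -phiM !mulg1.
have phiV a : phi a^-1%g = ((phi a)^-1)%g.
  by apply: (mulgI (phi a)); rewrite -phiM !mulgV phi1.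
have phi_ab i : (i < g)%N -> phi (alpha i) = hA l i /\ phi (beta i) = hB l i.
  move=> hi; have [h1 h2] := pl i 0 hi (in01_0 R).
  rewrite !addr0 !subr0 in h1 h2; split.
    rewrite /alpha phi_mark ?h1 //; try exact: bp_disc.
    apply/(cproj_glued Q); try exact: bp_disc.
    by have := @glued_a R g i 0 hi (in01_0 R); rewrite addr0 subr0.
  rewrite /beta phi_mark ?h2 //; try exact: bp_disc.
  apply/(cproj_glued Q); try exact: bp_disc.
  by have := @glued_b R g i 0 hi (in01_0 R); rewrite addr0 subr0.
apply: (@eq_from_nth _ (1, 1)%g); first by rewrite !size_map size_iota sl.
rewrite !size_map size_iota => i hi.
rewrite (nth_map (1, 1)%g) ?size_map ?size_iota // (nth_map 0%N) ?size_iota // nth_iota //=.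
have [-> e] := phi_ab i hi; rewrite add0n phiV e /hA /hB invgK.
by case: (nth _ _ _).
Qed.

Lemma surface_group_presentation : surface_presentation generators.
Proof.
split; first exact: generators_relation.
  by move=> P P1 PM PV Pgen; exact: closure_all.
move=> G l; rewrite size_map size_iota; exact: generators_hom.
Qed.

End Generation.

Theorem corollary5p6 (R : realType) (g : nat) (hg : (2 <= g)%N)
    (X : topologicalType) (hX : closed_orientable_surface R g X) (x0 : X)
    (S : groupType) (hS : is_fundamental_group R x0 S)
    (m : nat) (gamma : 'I_m -> S) (hgamma : forall i, gamma i <> 1%g) :
  exists (T : simplicial_tree) (rho : tree_action S T),
    [/\ locally_finite T, minimal_action rho, faithful_action rho
      & forall i, loxodromic rho (gamma i)].
Proof.
have g0 : (0 < g)%N by exact: ltnW.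
have [Q] := charted_surface_ex g0 hX.
have [cls [cls_surj cls_eq cls_mul]] := hS.
have pres := surface_group_presentation g0 Q cls_surj cls_eq cls_mul.
(* With this [d] there are [d + 3], that is g + 1, involutions in each factor. *)
apply: (surface_group_action (d := (g - 2)%N) _ pres) => //.
by rewrite size_map size_iota -addn2 subnK.
Qed.
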